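(* Let $s\ge2$, $t\ge1$ and $k\ge1$ be integers, put $T=t\cdot\phi(s,t)$, and suppose $k\ge(t+T)(t-1)$. There exists $n_0=n_0(s,k)$ such that for all $n\ge n_0$ the following holds. Let $\mathcal F\subset\binom{[n]}{k}$ be an extremal family (i.e. of maximum possible cardinality) among all subfamilies of $\binom{[n]}{k}$ that do not contain a sunflower with $s$ petals and core of size exactly $t-1$. Then there exists a family $\mathcal S_*$ of subsets of $[n]$ such that (1) $\mathcal S_*$ does not contain a sunflower with $s$ petals and core of size at most $t-1$; (2) $\mathcal S_*\subset\bigcup_{q=t}^{T}\binom{\operatorname{supp}\mathcal S_*^{(t)}}{q}$; (3) the vector $\widetilde\phi(\mathcal S_* )=(\widetilde\phi_0(\mathcal S_* ),\dots,\widetilde\phi_{T-t}(\mathcal S_* ))$ is maximal in the lexicographical order among all families satisfying (1) and (2) (with that family in place of $\mathcal S_*$); and $$\mathcal F=\Big\{F\in\binom{[n]}{k} : F\cap\operatorname{supp}\mathcal S_*^{(t)}\in\mathcal S_*\Big\}.$$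
   Context: $[n]=\{1,\dots,n\}$, and $\binom{X}{q}$ is the family of all $q$-element subsets of $X$. A family of $s$ (distinct) sets $\{F_1,\dots,F_s\}$ is a sunflower with $s$ petals if $F_i\cap F_j=\bigcap_{u=1}^s F_u$ for all distinct $i,j\in[s]$; the set $\bigcap_{u=1}^sF_u$ is its core. $\phi(s,t)$ denotes the maximum size of a family of $t$-element sets (on an arbitrary ground set) that does not contain a sunflower with $s$ petals (with arbitrary core). For a family $\mathcal S$: $\operatorname{supp}\mathcal S=\bigcup_{S\in\mathcal S}S$ and $\mathcal S^{(h)}=\{S\in\mathcal S : |S|=h\}$. The components of $\widetilde\phi$ are $$\widetilde\phi_0(\mathcal S)=|\mathcal S^{(t)}|,\qquad \widetilde\phi_i(\mathcal S)=|\mathcal S^{(t+i)}|+\sum_{j=0}^{i-1}|\mathcal S^{(t+j)}|\binom{T-|\operatorname{supp}\mathcal S^{(t)}|}{i-j}\quad(1\le i\le T-t),$$ with the convention $\binom{m}{a}=0$ if $m<a$. *)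

(* Defs.v *)
From mathcomp Require Import all_boot all_order.
From Stdlib Require Import ClassicalEpsilon.

Set Implicit Arguments.
Unset Strict Implicit.
Unset Printing Implicit Defensive.

Section Families.
Variable V : finType.
Implicit Types (X : {set V}) (F G P S : {set {set V}}).

Definition ksubsets X (q : nat) : {set {set V}} :=
  [set A : {set V} | (A \subset X) && (#|A| == q)].

Definition core P : {set V} := \bigcap_(A in P) A.

(* A set of sets is a family of distinct sets, so #|P| counts the petals. *)
Definition sunflower (s : nat) P : Prop :=
  #|P| = s /\ {in P &, forall A B, A != B -> A :&: B = core P}.

(* [c] is the condition on the size of the forbidden cores. *)
Definition sunflower_free (s : nat) (c : nat -> Prop) F : Prop :=
  forall P, P \subset F -> sunflower s P -> ~ c #|core P|.

Definition layer S (h : nat) : {set {set V}} := [set A in S | #|A| == h].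

Definition supp S : {set V} := cover S.

End Families.

(* A finite family of finite sets lives on a finite ground set, so letting V
   range over all finite types covers arbitrary ground sets. *)
Definition has_uniform_sunflower_free (s t m : nat) : Prop :=
  exists (V : finType) (F : {set {set V}}),
    [/\ F \subset ksubsets [set: V] t,
        sunflower_free s (fun=> True) F & #|F| = m].

Definition is_max (Q : nat -> Prop) (m : nat) : Prop :=
  Q m /\ forall m', Q m' -> m' <= m.

(* The maximum exists for s >= 2, see [phiP]. *)
Definition phi (s t : nat) : nat :=
  epsilon (inhabits 0) (is_max (has_uniform_sunflower_free s t)).

Definition bigT (s t : nat) : nat := t * phi s t.

Section Extremal.
Variable V : finType.
Implicit Types (F G S : {set {set V}}).

Definition extremal (s k t : nat) F : Prop :=
  let admissible G := G \subset ksubsets [set: V] k /\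
                      sunflower_free s (fun c => c = t - 1) G in
  admissible F /\ forall G, admissible G -> #|G| <= #|F|.

(* For i = 0 the sum is empty and this is #|layer S t|. The subtraction
   bigT s t - #|_| is truncated; this agrees with the convention that a binomial
   coefficient vanishes when its upper index is smaller than its lower index,
   as i - j > 0 in the sum. *)
Definition phi_tilde (s t : nat) S (i : nat) : nat :=
  #|layer S (t + i)| +
  \sum_(0 <= j < i)
     #|layer S (t + j)| * 'C(bigT s t - #|supp (layer S t)|, i - j).

(* [seqlexi nat] is [seq nat] with the lexicographic order. *)
Definition phi_tilde_vec (s t : nat) S : seqlexi nat :=
  mkseq (phi_tilde s t S) (bigT s t - t).+1.

Definition kernel_family (s t : nat) S : Prop :=
  sunflower_free s (fun c => c <= t - 1) S /\
  S \subset \bigcup_(t <= q < (bigT s t).+1) ksubsets (supp (layer S t)) q.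

Definition lex_maximal_kernel (s t : nat) S : Prop :=
  kernel_family s t S /\
  forall S', kernel_family s t S' ->
    (phi_tilde_vec s t S' <= phi_tilde_vec s t S)%O.

End Extremal.

Section ErdosRado.

Fixpoint erdos_rado_bound (s t : nat) : nat :=
  if t is t'.+1 then s * t'.+1 * erdos_rado_bound s t' else 1.

Lemma erdos_rado (V : finType) (s t : nat) (F : {set {set V}}) :
  2 <= s -> F \subset ksubsets [set: V] t ->
  sunflower_free s (fun=> True) F -> #|F| <= erdos_rado_bound s t.
Proof.
move=> s2; elim: t F => [|t IH] F /subsetP FT Ffree.
  rewrite /= -(cards1 (set0 : {set V})); apply/subset_leq_card/subsetP => A /FT.
  by rewrite !inE subsetT cards_eq0.
have cardF A : A \in F -> #|A| = t.+1 by move=> /FT; rewrite inE => /andP[_ /eqP].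
have triv0 : (set0 \subset F) && trivIset (set0 : {set {set V}}).
  by rewrite sub0set; apply/trivIsetP => A B; rewrite inE.
have [D /maxsetP[/andP[DF /trivIsetP tD] maxD] _] :=
  @maxset_exists _ (fun D => (D \subset F) && trivIset D) set0 triv0.
have Ds : #|D| < s.
  rewrite ltnNge; apply/negP => sD.
  have [P PD Ps] : exists2 P : {set {set V}}, P \subset D & #|P| = s.
    have : 0 < #|ksubsets D s| by rewrite /ksubsets cards_draws bin_gt0.
    by case/card_gt0P => P; rewrite inE => /andP[PD /eqP]; exists P.
  have core0 A B : A \in P -> B \in P -> A != B -> A :&: B = set0.
    move=> AP BP AB; apply/eqP; rewrite setI_eq0.
    by apply: tD => //; apply: (subsetP PD).
  apply: (Ffree P _ _ I); first exact: subset_trans DF.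
  split=> // A B AP BP AB; rewrite core0 //; apply/esym/eqP; rewrite -subset0.
  rewrite -(core0 A B) //; apply/subsetP => x /bigcapP xP.
  by rewrite inE !xP.
pose Y := cover D.
have cY : #|Y| <= s * t.+1.
  apply: leq_trans (leq_card_cover D) _.
  rewrite (eq_bigr (fun=> t.+1)) => [|A /(subsetP DF) /cardF //].
  by rewrite sum_nat_const leq_mul2r ltnW.
have meetY A : A \in F -> exists2 y, y \in Y & y \in A.
  move=> AF; case: (boolP [disjoint A & Y]) => [dAY|]; last first.
    by rewrite -setI_eq0 => /set0Pn[y /setIP[yA yY]]; exists y.
  have AD : A \in D.
    suff <- : A |: D = D by rewrite setU11.
    apply: maxD; last exact: subsetUr.
    rewrite subUset sub1set AF DF /=.
    have dA B : B \in D -> [disjoint A & B].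
      by move=> BD; apply: disjointWr dAY; apply: bigcup_sup BD.
    apply/trivIsetP => B C /setU1P[->|BD] /setU1P[->|CD]; rewrite ?eqxx //.
    - by move=> _; apply: dA.
    - by move=> _; rewrite disjoint_sym; apply: dA.
    - exact: tD.
  have AY : A \subset Y by apply: bigcup_sup AD.
  have /card_gt0P[x xA] : 0 < #|A| by rewrite cardF.
  by exists x => //; apply: (subsetP AY).
pose Fy y := [set A in F | y \in A].
have FyB y : #|Fy y| <= erdos_rado_bound s t.
  pose L := [set A :\ y | A in Fy y].
  have <- : #|L| = #|Fy y|.
    apply: card_in_imset => A B; rewrite !inE => /andP[_ yA] /andP[_ yB] e.
    by rewrite -(setD1K yA) -(setD1K yB) e.
  have LP B : B \in L -> y \notin B /\ y |: B \in F.
    by case/imsetP => A; rewrite inE => /andP[AF yA] ->; rewrite setD11 setD1K.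
  apply: IH.
    apply/subsetP => B BL; have [yB yF] := LP _ BL.
    by rewrite inE subsetT /=; move: (cardF _ yF); rewrite cardsU1 yB add1n => -[->].
  move=> P PL [Ps Pc] _.
  have yP B : B \in P -> y \notin B by move=> /(subsetP PL) /LP[].
  have injP : {in P &, injective (fun B => y |: B)}.
    by move=> B C BP CP /= e; rewrite -(setU1K (yP _ BP)) e setU1K ?yP.
  apply: (Ffree [set y |: B | B in P] _ _ I).
    by apply/subsetP => _ /imsetP[B /(subsetP PL) /LP[_ ?] ->].
  have coreE : core [set y |: B | B in P] = y |: core P.
    apply/setP => x; rewrite in_setU1; apply/bigcapP/idP => [xP|].
      case: eqVneq => //= xy; apply/bigcapP => B BP.
      have := xP _ (imset_f (fun B => y |: B) BP).
      by rewrite in_setU1 (negPf xy).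
    case/orP => [/eqP ->|/bigcapP xP] _ /imsetP[B BP ->]; first exact: setU11.
    by rewrite in_setU1 xP ?orbT.
  split; first by rewrite card_in_imset.
  move=> _ _ /imsetP[B BP ->] /imsetP[C CP ->] BC.
  rewrite coreE -setUIr Pc //; by apply: contraNneq BC => ->.
have FY : F \subset \bigcup_(y in Y) Fy y.
  apply/subsetP => A AF; have [y yY yA] := meetY _ AF.
  by apply/bigcupP; exists y => //; rewrite inE AF.
apply: leq_trans (subset_leq_card FY) _.
apply: (@leq_trans (\sum_(y in Y) #|Fy y|)).
  elim/big_rec2: _ => [|y m U _ le]; first by rewrite cards0.
  by rewrite (leq_trans (leq_card_setU _ _)) ?leq_add2l.
apply: (@leq_trans (\sum_(y in Y) erdos_rado_bound s t)); first exact: leq_sum.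
by rewrite sum_nat_const leq_mul2r cY orbT.
Qed.

Lemma phiP (s t : nat) :
  2 <= s -> is_max (has_uniform_sunflower_free s t) (phi s t).
Proof.
move=> s2; apply: epsilon_spec.
set Q := has_uniform_sunflower_free s t.
have Q0 : Q 0.
  exists bool, set0; rewrite cards0 sub0set; split=> // P.
  by rewrite subset0 => /eqP -> [] s0; rewrite -s0 cards0 in s2.
have Qb m : Q m -> m <= erdos_rado_bound s t.
  by case=> V [F [FT Ff <-]]; apply: erdos_rado.
pose q m : bool := if excluded_middle_informative (Q m) then true else false.
have qP m : reflect (Q m) (q m).
  by rewrite /q; case: excluded_middle_informative => ?; constructor.
have exq : exists m, q m by exists 0; apply/qP.
have ubq m : q m -> m <= erdos_rado_bound s t by move=> /qP /Qb.
case: (ex_maxnP exq ubq) => m /qP Qm mmax.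
by exists m; split=> // m' /qP /mmax.
Qed.

End ErdosRado.

(* Main.v *)
(* Let K consist of the members of F and of the cores of large sunflowers in F:
   a sunflower in K lifts to one in F with the same core, so K contains no
   sunflower with s petals and core of size t - 1, and no set of size t - 1.
   A set X outside K has a bounded cover: a bounded set disjoint from X that
   meets every member of F above X. For A in F the rules "X determines the
   elements of A in the cover of X" define a closure system on A whose closed
   sets lie in K, and all but O(n^(k-t-1)) members of F have no generating set
   of size less than k - t. For these the closure system must contain every
   superset of some t-set D; the only exception is s = t = 2, k = 4. The t-sets
   D that stay in K together with every subset of a fixed (t-1)-set form a
   sunflower-free family, so there are at most phi(s,t) of them; as F has about
   phi(s,t) C(n,k-t) members, one family of phi(s,t) such sets serves all but
   O(n^(k-t-1)) members of F. Let Y be its support, |Y| <= T.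

   For a random sequence w outside Y, let S_w be the family of the A in Y such
   that A, joined with any subset of the initial segment of w of length k - |A|,
   lies in K. It has no forbidden sunflower, so its weight, the size of its
   trace family, is at most |F|; and the average deficit over w is exactly the
   number of members of F that are defective, that is, not accounted for by any
   S_w. A defective member causes a deficit for every w whose beginning lies in
   it, and these w outweigh the defective members by a factor of order n. So
   there are none, S_w has full weight for every w, and comparing sequences
   with a common beginning shows that F is a trace family. Finally |F| is a
   combination of the entries of the vector phi~ with coefficients C(n-T,k-t-i),
   which decrease so fast that maximality means lexicographic maximality. *)
Require Import Defs.
From mathcomp Require Import all_boot all_order.
From mathcomp Require Import perm zify.
From Stdlib Require Import Classical.

Set Implicit Arguments.
Unset Strict Implicit.
Unset Printing Implicit Defensive.

(** * Counting *)

Section Counting.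

Lemma leq_card_bigcup (I T : finType) (P : pred I) (F : I -> {set T}) :
  #|\bigcup_(i | P i) F i| <= \sum_(i | P i) #|F i|.
Proof.
elim/big_rec2: _ => [|i m U _ le]; first by rewrite cards0.
by rewrite (leq_trans (leq_card_setU _ _)) ?leq_add2l.
Qed.

Lemma card_le_sum (I T : finType) (J : {set I}) (X : {set T}) (F : I -> {set T}) :
  {in X, forall x, exists2 i, i \in J & x \in F i} ->
  #|X| <= \sum_(i in J) #|F i|.
Proof.
move=> H; apply: leq_trans (leq_card_bigcup _ _).
apply/subset_leq_card/subsetP => x /H[i iJ xi].
by apply/bigcupP; exists i.
Qed.

(** The union bound in the form that the encoding arguments below use: [J] lists the codes, and
    [F i] contains the objects with code [i]. *)
Lemma card_le_mul (I T : finType) (J : {set I}) (X : {set T}) (F : I -> {set T}) c :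
  {in X, forall x, exists2 i, i \in J & x \in F i} ->
  {in J, forall i, #|F i| <= c} -> #|X| <= #|J| * c.
Proof.
move=> /card_le_sum le H; apply: leq_trans le _.
by rewrite -sum_nat_const; apply: leq_sum.
Qed.

Lemma sum_card_exchange (I J : finType) (A : {set I}) (B : {set J}) (r : I -> J -> bool) :
  \sum_(i in A) #|[set j in B | r i j]| = \sum_(j in B) #|[set i in A | r i j]|.
Proof.
under eq_bigr => i _ do rewrite -sum1_card big_mkcond /=.
under [RHS]eq_bigr => j _ do rewrite -sum1_card big_mkcond /=.
rewrite (eq_bigr (fun i => \sum_(j in B) (if r i j then 1 else 0))); last first.
  move=> i _; rewrite [RHS]big_mkcond /=; apply: eq_bigr => j _; rewrite inE.
  by case: (j \in B).
rewrite exchange_big /=; apply: eq_bigr => j _.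
rewrite big_mkcond /=; apply: eq_bigr => i _; rewrite inE.
by case: (i \in A).
Qed.

Lemma sum_bool_card (T : finType) (D : {set T}) (p : pred T) :
  \sum_(x in D) (p x : nat) = #|[set x in D | p x]|.
Proof.
rewrite -sum1_card big_mkcond [RHS]big_mkcond /=; apply: eq_bigr => x _.
by rewrite inE; case: (x \in D); case: (p x).
Qed.

Lemma card_ksubsets (V : finType) (X : {set V}) q : #|ksubsets X q| = 'C(#|X|, q).
Proof. exact: cards_draws. Qed.

Lemma ksubsetsP (V : finType) (X A : {set V}) q :
  reflect (A \subset X /\ #|A| = q) (A \in ksubsets X q).
Proof. by rewrite inE; apply: (iffP andP) => -[? /eqP]. Qed.

Lemma ksubset_exists (V : finType) (X : {set V}) q :
  q <= #|X| -> exists2 A : {set V}, A \subset X & #|A| = q.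
Proof.
move=> qX; have /card_gt0P[A] : 0 < #|ksubsets X q| by rewrite card_ksubsets bin_gt0.
by case/ksubsetsP; exists A.
Qed.

Lemma between_exists (V : finType) (Z X : {set V}) q :
  Z \subset X -> #|Z| <= q <= #|X| ->
  exists A : {set V}, [/\ Z \subset A, A \subset X & #|A| = q].
Proof.
move=> ZX /andP[Zq qX].
have [|B BX Bq] := @ksubset_exists _ (X :\: Z) (q - #|Z|).
  by rewrite cardsD (setIidPr ZX) leq_sub2r.
move: BX; rewrite subsetD => /andP[BX dB].
exists (Z :|: B); split; rewrite ?subsetUl // ?subUset ?ZX //.
by rewrite cardsU setIC disjoint_setI0 // cards0 subn0 Bq subnKC.
Qed.

Lemma card_supersets (V : finType) (Z R : {set V}) q :
  Z \subset R -> #|Z| <= q ->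
  #|[set X in ksubsets R q | Z \subset X]| = 'C(#|R| - #|Z|, q - #|Z|).
Proof.
move=> ZR Zq.
have -> : #|R| - #|Z| = #|R :\: Z| by rewrite cardsD (setIidPr ZR).
rewrite -card_ksubsets.
have <- : #|[set Z :|: B | B in ksubsets (R :\: Z) (q - #|Z|)]| =
          #|ksubsets (R :\: Z) (q - #|Z|)|; last first.
  apply: eq_card => X; apply/idP/imsetP.
    rewrite inE => /andP[/ksubsetsP[XR Xq] ZX]; exists (X :\: Z).
      by apply/ksubsetsP; rewrite setSD // cardsD (setIidPr ZX) Xq.
    by rewrite -{1}(setID X Z) (setIidPr ZX).
  case=> B /ksubsetsP[]; rewrite subsetD => /andP[BR dB] Bq ->.
  rewrite inE subsetUl andbT; apply/ksubsetsP; rewrite subUset ZR BR; split=> //.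
  by rewrite cardsU setIC disjoint_setI0 // cards0 subn0 Bq subnKC.
apply: card_in_imset => B C /ksubsetsP[]; rewrite subsetD => /andP[_ dB] _.
case/ksubsetsP; rewrite subsetD => /andP[_ dC] _ e.
have E (D : {set V}) : [disjoint D & Z] -> D = (Z :|: D) :\: Z.
  by move=> d; rewrite setDUl setDv set0U; apply/esym/setDidPl.
by rewrite (E _ dB) e -E.
Qed.

Lemma bin_leq_exp n j : 'C(n, j) <= n ^ j.
Proof.
apply: (@leq_trans (n ^_ j)); first by rewrite -bin_ffact leq_pmulr ?fact_gt0.
elim: j => [|j IH]; first by rewrite ffactn0.
by rewrite ffactnSr expnSr leq_mul // leq_subr.
Qed.

Lemma exp_leq_bin d j : exists c, 0 < c /\ exists N, forall n, N <= n ->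
  n ^ j <= c * 'C(n - d, j).
Proof.
(* Once [n >= 2 * (d + j)], each of the [j] factors of the falling factorial of [n - d] is at least
   [n / 2]. *)
exists (2 ^ j * j`!); rewrite muln_gt0 expn_gt0 fact_gt0; split=> //.
exists (2 * (d + j)) => n nN.
rewrite -mulnA [X in _ * X]mulnC bin_ffact.
have {nN} : 2 * (d + j) <= n by [].
elim: j => [|j IH] nN; first by rewrite ffactn0.
rewrite ffactnSr !expnS -mulnA.
have {}IH : n ^ j <= 2 ^ j * (n - d) ^_ j by apply: IH; lia.
have h : n <= 2 * (n - d - j) by lia.
by have := leq_mul h IH; set a := _ ^_ _; set b := 2 ^ _; set x := n - d - j; nia.
Qed.

Lemma exp_leq_bin_uniform d m : exists c, 0 < c /\ exists N, forall n j, N <= n -> j <= m ->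
  n ^ j <= c * 'C(n - d, j).
Proof.
elim: m => [|m [c [c0 [N H]]]].
  by exists 1; split=> //; exists 0 => n [|j] // _ _; rewrite bin0.
have [c' [c'0 [N' H']]] := exp_leq_bin d m.+1.
exists (c + c'); split; first by rewrite addn_gt0 c0.
exists (N + N') => n j nN; rewrite leq_eqVlt => /orP[/eqP ->|jm].
  by apply: leq_trans (H' n _) _; [lia|rewrite leq_mul2r leq_addl orbT].
by apply: leq_trans (H n j _ jm) _; [lia|rewrite leq_mul2r leq_addr orbT].
Qed.

(** By Pascal's rule, each deleted point costs at most [n ^ (j - 1)] of the [j]-sets; the factor [n]
    keeps the exponents natural. *)
Lemma bin_sub_leq d j n : n * 'C(n, j) <= n * 'C(n - d, j) + d * n ^ j.
Proof.
elim: d => [|d IH]; first by rewrite subn0 leq_addr.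
apply: leq_trans IH _; rewrite mulSn addnA leq_add2r.
rewrite subnS; case: (n - d) (leq_subr d n) => [|m] mn; first exact: leq_addr.
rewrite /=; case: j => [|j]; first by rewrite !bin0; lia.
rewrite binS mulnDr leq_add2l expnS leq_mul2l; apply/orP; right.
apply: leq_trans (bin_leq_exp _ _) _.
by case: j => // j; rewrite leq_exp2r // ltnW.
Qed.

End Counting.

(** * Sunflowers and trace families *)

Section Traces.
Variable V : finType.
Implicit Types (A B Y : {set V}) (S F : {set {set V}}).

Definition trace_family (k : nat) Y S : {set {set V}} :=
  [set A in ksubsets [set: V] k | A :&: Y \in S].

Lemma trace_familyP k Y S A :
  reflect (#|A| = k /\ A :&: Y \in S) (A \in trace_family k Y S).
Proof. by rewrite !inE subsetT; apply: (iffP andP) => -[/eqP ? ?]; split=> //; apply/eqP. Qed.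

Lemma card_fiber k Y A : A \subset Y -> #|A| <= k ->
  #|[set F in ksubsets [set: V] k | F :&: Y == A]| = 'C(#|~: Y|, k - #|A|).
Proof.
move=> AY Ak; rewrite -card_ksubsets.
have dA (X : {set V}) : X \subset ~: Y -> X :&: A = set0.
  move=> XY; apply/eqP; rewrite setI_eq0 disjoints_subset.
  by apply: subset_trans XY _; rewrite setCS.
have <- : #|[set A :|: X | X in ksubsets (~: Y) (k - #|A|)]| =
          #|ksubsets (~: Y) (k - #|A|)|.
  apply: card_in_imset => X X' /ksubsetsP[/dA dX _] /ksubsetsP[/dA dX' _] e.
  have E (Z : {set V}) : Z :&: A = set0 -> Z = (A :|: Z) :\: A.
    by move=> d; rewrite setDUl setDv set0U; apply/esym/setDidPl; rewrite -setI_eq0 d.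
  by rewrite (E _ dX) e -E.
apply: eq_card => F; apply/idP/imsetP.
  rewrite inE => /andP[/ksubsetsP[_ Fk] /eqP FA]; exists (F :\: Y).
    apply/ksubsetsP; split; first by rewrite setDE subsetIr.
    by have := cardsID Y F; rewrite FA Fk => <-; lia.
  by rewrite -FA setID.
case=> X /ksubsetsP[XY Xk] ->; rewrite inE; apply/andP; split.
  apply/ksubsetsP; split; first exact: subsetT.
  by rewrite cardsU setIC dA // cards0 subn0 Xk subnKC.
rewrite setIUl (setIidPl AY) (_ : X :&: Y = set0) ?setU0 //.
by apply/eqP; rewrite setI_eq0 disjoints_subset.
Qed.

Lemma card_by_trace F Y :
  #|F| = \sum_(A in powerset Y) #|[set X in F | X :&: Y == A]|.
Proof.
rewrite -sum1_card (partition_big (fun X => X :&: Y) (fun A => A \in powerset Y)) /=.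
  apply: eq_bigr => A _; rewrite -sum1_card; apply: eq_bigl => X.
  by rewrite !inE.
by move=> X _; rewrite inE subsetIr.
Qed.

Lemma card_trace_family k Y S :
  {in S, forall A, A \subset Y /\ #|A| <= k} ->
  #|trace_family k Y S| = \sum_(A in S) 'C(#|~: Y|, k - #|A|).
Proof.
move=> SY; rewrite -sum1_card.
rewrite (partition_big (fun X => X :&: Y) (fun A => A \in S)) /=; last first.
  by move=> X /trace_familyP[].
apply: eq_bigr => A AS; have [AY Ak] := SY _ AS.
rewrite -card_fiber // -sum1_card; apply: eq_bigl => X.
by rewrite !inE; case: (X :&: Y =P A) => [->|]; rewrite ?AS ?andbT ?andbF.
Qed.

End Traces.

Section Sunflowers.
Variables (V : finType) (s : nat).
Hypothesis s2 : 2 <= s.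
Implicit Types (A B C D Y : {set V}) (P S F G : {set {set V}}).

(** As [s >= 2], every petal has a partner, so the common pairwise intersection lies in all petals
    and is the core. *)
Lemma sunflower_intro P C : #|P| = s ->
  {in P &, forall A B, A != B -> A :&: B = C} -> sunflower s P /\ core P = C.
Proof.
move=> Ps PC; suff cC : core P = C by split=> //; split=> // A B ? ? ?; rewrite cC PC.
have other A : exists2 B, B \in P & B != A.
  have : 0 < #|P :\ A| by rewrite -(ltn_add2l (A \in P)) addn0 -cardsD1 Ps (leq_ltn_trans (leq_b1
    _)).
  by case/card_gt0P => B; rewrite !inE => /andP[BA BP]; exists B.
apply/eqP; rewrite eqEsubset; apply/andP; split; last first.
  apply/bigcapsP => A AP; have [B BP BA] := other A.
  by rewrite -(PC _ _ BP AP BA) subsetIr.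
have [A AP _] := other set0; have [B BP BA] := other A.
by rewrite -(PC _ _ BP AP BA) subsetI !bigcap_inf.
Qed.

Lemma phi_ub t F : F \subset ksubsets [set: V] t ->
  sunflower_free s (fun=> True) F -> #|F| <= phi s t.
Proof. by move=> Ft Ff; have [_] := phiP t s2; apply; exists V, F. Qed.

(** Adding [A] would exceed the maximum [phi s t], and a sunflower created in this way has [A] as a
    petal. *)
Lemma phi_extend t F A : F \subset ksubsets [set: V] t ->
  #|F| = phi s t -> sunflower_free s (fun=> True) F ->
  #|A| = t -> A \notin F -> exists2 P : {set {set V}}, P \subset F & sunflower s (A |: P).
Proof.
move=> Ft Fphi Ff At AF; apply: NNPP => noP.
have : #|A |: F| <= phi s t.
  apply: phi_ub => [|P PF Ps _].
    by rewrite subUset Ft sub1set andbT; apply/ksubsetsP; rewrite subsetT.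
  case: (boolP (A \in P)) => AP.
    apply: noP; exists (P :\ A); last by rewrite setD1K.
    by apply/subsetP => B /setD1P[BA /(subsetP PF)]; rewrite !inE (negPf BA).
  apply: (Ff P) => //; apply/subsetP => B BP; have := subsetP PF _ BP.
  by case/setU1P => // BA; rewrite -BA BP in AP.
by rewrite cardsU1 AF Fphi; lia.
Qed.

(** Traces on [Y] turn a sunflower into a sunflower whose core does not grow. Distinct petals have
    distinct traces: a common trace would lie in the core and have fewer than [t] points. *)
Lemma trace_admissible k t Y S : 1 <= t ->
  {in S, forall A, t <= #|A|} -> sunflower_free s (fun c => c <= t - 1) S ->
  trace_family k Y S \subset ksubsets [set: V] k /\
  sunflower_free s (fun c => c = t - 1) (trace_family k Y S).
Proof.
move=> t1 St Sf; split; first by apply/subsetP => A /[!inE] /andP[].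
move=> P PS [Ps Pc] ct.
have PS' A : A \in P -> A :&: Y \in S by move=> /(subsetP PS) /trace_familyP[].
have gI A B : A \in P -> B \in P -> A != B -> (A :&: Y) :&: (B :&: Y) = core P :&: Y.
  by move=> AP BP AB; rewrite setIACA setIid (Pc _ _ AP BP AB).
have cY : #|core P :&: Y| <= t - 1 by rewrite -ct; apply/subset_leq_card/subsetIl.
have ginj : {in P &, injective (fun A => A :&: Y)}.
  move=> A B AP BP /= e; apply/eqP/negPn/negP => AB.
  have := gI _ _ AP BP AB; rewrite -e setIid => e'.
  by have := St _ (PS' _ AP); rewrite e'; lia.
have [||Is Ic] := @sunflower_intro [set A :&: Y | A in P] (core P :&: Y).
- by rewrite card_in_imset.
- move=> _ _ /imsetP[A AP ->] /imsetP[B BP ->] AB; apply: gI => //.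
  by apply: contraNneq AB => ->.
apply: (Sf _ _ Is); last by rewrite Ic.
by apply/subsetP => _ /imsetP[A AP ->]; apply: PS'.
Qed.

End Sunflowers.

(** * Families attaining [phi s t] and the lower bound for extremal families *)

Section PhiFamily.
Variables (s t : nat).
Hypotheses (s2 : 2 <= s) (t1 : 1 <= t).

Lemma phi_gt0 : 0 < phi s t.
Proof.
have [_] := phiP t s2; apply; exists 'I_t, [set setT]; split.
- by rewrite sub1set; apply/ksubsetsP; rewrite subsetT cardsT card_ord.
- move=> P /subset_leq_card; rewrite cards1 => P1 [Ps _] _; lia.
- by rewrite cards1.
Qed.

Lemma leq_bigT : t <= bigT s t.
Proof. by rewrite /bigT leq_pmulr ?phi_gt0. Qed.

Lemma card_supp_leq (V : finType) (F : {set {set V}}) :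
  F \subset ksubsets [set: V] t -> #|F| <= phi s t -> #|supp F| <= bigT s t.
Proof.
move=> Ft Fp; apply: leq_trans (leq_card_cover _) _.
rewrite (eq_bigr (fun=> t)) => [|A /(subsetP Ft) /ksubsetsP[] //].
by rewrite sum_nat_const mulnC leq_mul2l Fp orbT.
Qed.

(** The maximum is attained on some unspecified ground type, but the support has at most [bigT s t]
    points and can be embedded into [V]. *)
Lemma phi_family (V : finType) : bigT s t <= #|V| ->
  exists F : {set {set V}}, [/\ F \subset ksubsets [set: V] t,
    sunflower_free s (fun=> True) F & #|F| = phi s t].
Proof.
move=> TV; have [[V0 [F0 [F0t F0f F0p]]] _] := phiP t s2.
have /card_gt0P[v0 _] : 0 < #|V| by have := leq_bigT; lia.
pose Y := supp F0.
have Yn : #|Y| <= #|V| by apply: leq_trans TV; apply: card_supp_leq; rewrite ?F0p.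
(* The i-th point of [Y] goes to the i-th point of [V]; the default [v0] is never reached on [Y]. *)
pose f x := nth v0 (enum V) (index x (enum Y)).
have finj : {in Y &, injective f}.
  move=> x y xY yY /eqP; rewrite nth_uniq ?enum_uniq //.
  - by move/eqP; apply: (index_inj x); rewrite mem_enum.
  - by rewrite -cardE; apply: leq_trans Yn; rewrite cardE index_mem mem_enum.
  - by rewrite -cardE; apply: leq_trans Yn; rewrite cardE index_mem mem_enum.
have subY A : A \in F0 -> A \subset Y by move=> AF; apply: bigcup_sup AF.
have imI (A B : {set V0}) : A \subset Y -> B \subset Y -> f @: (A :&: B) = f @: A :&: f @: B.
  move=> AY BY; apply: imsetI => x y xA yB; apply: finj.
    exact: (subsetP AY). exact: (subsetP BY).
have iminj (A B : {set V0}) : A \subset Y -> B \subset Y -> f @: A = f @: B -> A = B.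
  have sub (C D : {set V0}) : C \subset Y -> D \subset Y -> f @: C \subset f @: D -> C \subset D.
    move=> CY DY /subsetP CD; apply/subsetP => x xC.
    have /imsetP[y yD e] := CD _ (imset_f f xC).
    by rewrite (finj x y) //; [exact: (subsetP CY)|exact: (subsetP DY)].
  by move=> AY BY e; apply/eqP; rewrite eqEsubset; apply/andP; split; apply: sub; rewrite // e.
exists [set f @: A | A : {set V0} in F0]; split.
- apply/subsetP => _ /imsetP[A AF ->]; apply/ksubsetsP; split; first exact: subsetT.
  rewrite card_in_imset; first by have /ksubsetsP[] := subsetP F0t _ AF.
  by move=> x y xA yA; apply: finj; apply: (subsetP (subY _ AF)).
- move=> P PF [Ps Pc] _.
  pose P0 := [set A in F0 | f @: A \in P].
  have P0P : P = [set f @: A | A : {set V0} in P0].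
    apply/setP => B; apply/idP/imsetP => [BP|[A]]; last by rewrite inE => /andP[_ ?] ->.
    have /imsetP[A AF e] := subsetP PF _ BP.
    by exists A => //; rewrite inE AF -e BP.
  have P0Y A : A \in P0 -> A \subset Y by rewrite inE => /andP[/subY].
  have P0s : #|P0| = s.
    rewrite -Ps P0P card_in_imset // => A B AP BP; exact: iminj (P0Y _ AP) (P0Y _ BP).
  have : exists2 C : {set V0}, C \subset Y & {in P0 &, forall A B, A != B -> A :&: B = C}.
    have /card_gt0P[A AP] : 0 < #|P0| by rewrite P0s ltnW.
    have : 0 < #|P0 :\ A| by rewrite -(ltn_add2l (A \in P0)) addn0 -cardsD1 P0s (leq_ltn_trans
      (leq_b1 _)).
    case/card_gt0P => B; rewrite in_setD1 => /andP[BA BP].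
    exists (A :&: B); first by apply: subset_trans (P0Y _ AP); apply: subsetIl.
    have IP C D : C \in P0 -> D \in P0 -> C != D -> f @: C :&: f @: D = core P.
      move=> CP DP CD; apply: Pc; rewrite ?P0P ?imset_f //.
      by apply: contraNneq CD => /iminj ->; rewrite ?P0Y.
    move=> C D CP DP CD; apply: iminj.
    - by apply: subset_trans (P0Y _ CP); apply: subsetIl.
    - by apply: subset_trans (P0Y _ AP); apply: subsetIl.
    by rewrite !imI ?P0Y // IP // IP // eq_sym.
  case=> C _ /(sunflower_intro s2 P0s)[sP0 _]; apply: (F0f P0) => //.
  by apply/subsetP => A; rewrite inE => /andP[].
- rewrite -F0p card_in_imset // => A B AF BF; exact: iminj (subY _ AF) (subY _ BF).
Qed.

(** The competitor consists of the [k]-sets whose trace on the support of a family attaining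
    [phi s t] belongs to that family. *)
Lemma extremal_lower (V : finType) k (F : {set {set V}}) :
  t <= k -> bigT s t <= #|V| -> extremal s k t F ->
  phi s t * 'C(#|V| - bigT s t, k - t) <= #|F|.
Proof.
move=> tk TV [_ Fmax]; have [D [Dt Df Dp]] := phi_family TV.
have DP A : A \in D -> #|A| = t by move=> /(subsetP Dt) /ksubsetsP[].
apply: leq_trans (Fmax (trace_family k (supp D) D) _); last first.
  apply: trace_admissible => // [A /DP -> //|].
  by move=> P PD Ps _; apply: (Df P).
rewrite card_trace_family; last first.
  by move=> A AD; rewrite DP //; split=> //; apply: bigcup_sup AD.
rewrite (eq_bigr (fun=> 'C(#|~: supp D|, k - t))) => [|A /DP -> //].
rewrite sum_nat_const Dp leq_mul2l; apply/orP; right.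
apply: leq_bin2l; rewrite cardsCs setCK leq_sub2l //.
by apply: card_supp_leq; rewrite ?Dp.
Qed.

End PhiFamily.

(** * Cores of large sunflowers *)

Section KernelDef.
Variable V : finType.
Implicit Types (X A B U : {set V}) (P F : {set {set V}}).

(** A sunflower around [X] with any number of petals. Requiring [X] to lie in every petal keeps the
    notion meaningful for at most one petal, so that maximal stars exist and stars are closed under
    subfamilies. *)
Definition star X P : bool :=
  [forall A in P, (X \subset A) && [forall B in P, (A != B) ==> (A :&: B == X)]].

Definition kern (Q : nat) F : {set {set V}} :=
  F :|: [set X | [exists P : {set {set V}}, [&& P \subset F, #|P| == Q & star X P]]].

Lemma starP X P : reflect
  ({in P, forall A, X \subset A} /\ {in P &, forall A B, A != B -> A :&: B = X}) (star X P).
Proof.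
apply: (iffP forall_inP) => [H|[H1 H2] A AP]; last first.
  rewrite H1 //=; apply/forall_inP => B BP; apply/implyP => AB; apply/eqP; exact: H2.
split=> [A /H /andP[] //|A B /H /andP[_ /forall_inP H'] /H' /implyP AB ne].
by apply/eqP/AB.
Qed.

Lemma starS X P P' : P' \subset P -> star X P -> star X P'.
Proof.
move=> /subsetP PP /starP[H1 H2]; apply/starP; split=> [A /PP /H1 //|A B /PP AP /PP BP].
exact: H2.
Qed.

Lemma kernP Q F X : X \in kern Q F ->
  X \in F \/ exists P : {set {set V}}, [/\ P \subset F, #|P| = Q & star X P].
Proof.
rewrite inE => /orP[XF|]; first by left.
by rewrite inE => /existsP[P /and3P[PF /eqP PQ Ps]]; right; exists P.
Qed.

Lemma sub_kern Q F : F \subset kern Q F.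
Proof. exact: subsetUl. Qed.

(** Outside [X] the petals are disjoint, so fewer than [Q] points cannot meet all [Q] of them
    there. *)
Lemma kern_avoid Q F X U : X \in kern Q F -> #|U| < Q ->
  exists A, [/\ A \in F, X \subset A & A :&: U \subset X].
Proof.
move=> /kernP[XF _|[P [PF PQ /starP[XP PX]]] UQ]; first by exists X; rewrite subsetIl.
apply: NNPP => noA; suff : #|P| <= #|U| by rewrite PQ leqNgt UQ.
rewrite -[#|U|]muln1.
apply: (@card_le_mul _ _ _ _ (fun u => [set A in P | (u \in A) && (u \notin X)])).
  move=> A AP; have /subsetPn[u] : ~~ (A :&: U \subset X).
    apply/negP => AU; apply: noA; exists A; split=> //.
      exact: (subsetP PF).
    exact: XP.
  by rewrite inE => /andP[uA uU] uX; exists u; rewrite ?inE ?AP ?uA.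
move=> u _; apply/card_le1_eqP => A B; rewrite !inE => /and3P[AP uA uX] /and3P[BP uB _].
by apply/eqP; apply: contraNT uX => AB; rewrite -(PX _ _ BP AP AB) inE uA uB.
Qed.

End KernelDef.

Section Kernel.
Variables (V : finType) (s k t Q : nat) (F : {set {set V}}).
Hypotheses (s2 : 2 <= s) (tk : t - 1 < k) (Qk : s * k < Q).
Hypothesis Fk : F \subset ksubsets [set: V] k.
Hypothesis Ff : sunflower_free s (fun c => c = t - 1) F.
Implicit Types (X A B C U : {set V}) (P : {set {set V}}).
Local Notation K := (kern Q F).

Lemma family_card A : A \in F -> #|A| = k.
Proof. by move=> /(subsetP Fk) /ksubsetsP[]. Qed.

Lemma leq_s_Q : s <= Q.
Proof. by apply: leq_trans (ltnW Qk); rewrite leq_pmulr //; lia. Qed.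

Lemma kern_card X : X \in K -> #|X| <= k.
Proof.
move=> XK; have [|A [AF XA _]] := @kern_avoid _ _ _ _ set0 XK; first by rewrite cards0; lia.
by rewrite -(family_card AF) subset_leq_card.
Qed.

Lemma kern_card_family X : X \in K -> #|X| = k -> X \in F.
Proof.
move=> XK Xk; have [|A [AF XA _]] := @kern_avoid _ _ _ _ set0 XK; first by rewrite cards0; lia.
suff -> : X = A by [].
by apply/eqP; rewrite eqEcard XA Xk (family_card AF) leqnn.
Qed.

Lemma kern_card_neq X : X \in K -> #|X| <> t - 1.
Proof.
move=> /kernP[/family_card -> e|[P [PF PQ sP]] Xt]; first by lia.
have [|P' P'P P's] := @ksubset_exists _ P s; first by rewrite PQ leq_s_Q.
have /starP[_ H] := starS P'P sP.
have [sP' cP'] := sunflower_intro s2 P's H.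
by apply: (Ff _ sP'); [apply: subset_trans PF|rewrite cP'].
Qed.

(* A set of K outside F is replaced by a petal through it that avoids the other
   sets of the sunflower. *)
Lemma kern_lift P : P \subset K -> sunflower s P ->
  exists2 P' : {set {set V}}, P' \subset F & sunflower s P' /\ core P' = core P.
Proof.
have [m] := ubnP #|P :\: F|; elim: m P => // m IH P Pm PK [Ps Pc].
have [/eqP|/set0Pn[A]] := eqVneq (P :\: F) set0.
  by rewrite setD_eq0 => PF; exists P.
rewrite inE => /andP[AF AP].
(* The [s] sets of [P] cover at most [s * k] points, which is why [Q] is taken larger than
   [s * k]. *)
have Uk : #|cover P| < Q.
  apply: leq_ltn_trans Qk; apply: leq_trans (leq_card_cover _) _.
  by rewrite -Ps -sum_nat_const; apply: leq_sum => B /(subsetP PK) /kern_card.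
have [B [BF AB BU]] := kern_avoid (subsetP PK _ AP) Uk.
have BP : B \notin P.
  apply/negP => BP; suff e : A = B by rewrite e BF in AF.
  apply/eqP; rewrite eqEsubset AB; apply: subset_trans BU.
  by rewrite subsetI subxx; apply: bigcup_sup BP.
have CB C : C \in P -> C != A -> C :&: B = core P.
  move=> CP CA; rewrite -(Pc C A) //; apply/eqP; rewrite eqEsubset (setIS _ AB) andbT.
  rewrite subsetI subsetIl; apply: subset_trans BU; rewrite subsetI subsetIr.
  by apply: subset_trans (subsetIl _ _) _; apply: bigcup_sup CP.
pose P1 := B |: (P :\ A).
have P1s : #|P1| = s.
  rewrite cardsU1 !inE (negPf BP) andbF -Ps (cardsD1 A P) AP //.
have [|sP1 cP1] := @sunflower_intro _ _ s2 P1 (core P) P1s.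
  move=> C D /setU1P[->|/setD1P[CA CP]] /setU1P[->|/setD1P[DA DP]] CD.
  - by rewrite eqxx in CD.
  - by rewrite setIC CB.
  - by rewrite CB.
  - exact: Pc.
rewrite -cP1; apply: IH => //; last first.
  rewrite subUset sub1set (subsetP (sub_kern _ _) _ BF) /=.
  by apply: subset_trans PK; apply: subD1set.
suff lt : #|P1 :\: F| < #|P :\: F| by apply: leq_trans lt Pm.
apply: proper_card; apply/properP; split; last first.
  exists A; first by rewrite inE AF AP.
  by apply/negP; rewrite !inE eqxx /= orbF => /andP[_ /eqP e]; rewrite e BF in AF.
apply/subsetP => C; rewrite !inE => /andP[CF /orP[/eqP e|/andP[_ ->]]]; last by rewrite CF.
by rewrite e BF in CF.
Qed.

Lemma kern_free P : P \subset K -> sunflower s P -> #|core P| <> t - 1.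
Proof. by move=> PK /(kern_lift PK)[P' P'F [sP' <-]]; apply: Ff. Qed.

(** The form in which [kern_free] is applied: the sunflower in [K] is the image of an index family.
    Injectivity of [g] is automatic, since a repeated value would equal [C], and [K] has no set of
    size [t - 1]. *)
Lemma kern_glue P (g : {set V} -> {set V}) C : #|P| = s ->
  {in P, forall B, g B \in K} ->
  {in P &, forall A B, A != B -> g A :&: g B = C} -> #|C| <> t - 1.
Proof.
move=> Ps gK gC Ct.
have ginj : {in P &, injective g}.
  move=> A B AP BP e; apply/eqP/negPn/negP => AB.
  have := gC _ _ AP BP AB; rewrite -e setIid => e'.
  by apply: (kern_card_neq (gK _ AP)); rewrite e'.
have [||sP cP] := @sunflower_intro _ _ s2 (g @: P) C.
- by rewrite card_in_imset.
- move=> _ _ /imsetP[A AP ->] /imsetP[B BP ->] AB; apply: gC => //.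
  by apply: contraNneq AB => ->.
apply: (kern_free _ sP); last by rewrite cP.
by apply/subsetP => _ /imsetP[A AP ->]; apply: gK.
Qed.

(** Take a maximal star around [X] in [F] and remove [X] from its union. As [X] is not in [K], the
    star has a bounded number of petals; a member above [X] that misses the cover could be added to
    the star. *)
Lemma kern_cover : exists cov : {set V} -> {set V}, forall X, X \notin K ->
  [/\ #|cov X| <= k * Q, [disjoint cov X & X] &
      {in F, forall A, X \subset A -> exists2 z, z \in cov X & z \in A}].
Proof.
suff H X : exists Y : {set V}, X \notin K -> [/\ #|Y| <= k * Q, [disjoint Y & X] &
      {in F, forall A, X \subset A -> exists2 z, z \in Y & z \in A}].
  by have [cov ?] := fin_all_exists H; exists cov.
pose p P := (P \subset F) && star X P.
have p0 : p set0 by rewrite /p sub0set; apply/starP; split=> A; rewrite inE.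
have [P /maxsetP[/andP[PF sP] maxP] _] := maxset_exists p0.
exists (cover P :\: X) => XK; split.
- apply: leq_trans (subset_leq_card (subsetDl _ _)) _.
  apply: leq_trans (leq_card_cover _) _.
  rewrite (eq_bigr (fun=> k)) => [|A /(subsetP PF) /family_card //].
  rewrite sum_nat_const mulnC leq_mul2l; apply/orP; right.
  rewrite leqNgt; apply/negP => /ltnW /ksubset_exists[P' P'P P'Q].
  case/negP: XK; rewrite !inE; apply/orP; right; apply/existsP; exists P'.
  by rewrite (subset_trans P'P PF) P'Q eqxx (starS P'P).
- by rewrite disjoint_sym disjoints_subset setCD subsetUr.
- move=> A AF XA; apply: NNPP => noz.
  have sub B : B \in P -> A :&: B \subset X.
    move=> BP; apply/subsetP => z /setIP[zA zB]; apply/negPn/negP => zX.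
    apply: noz; exists z => //; rewrite inE zX; apply/bigcupP; by exists B.
  have AP : A \in P.
    suff <- : A |: P = P by rewrite setU11.
    have /starP[XP PX] := sP.
    apply: maxP; last exact: subsetUr.
    rewrite /p subUset sub1set AF PF /=; apply/starP; split.
      by move=> B /setU1P[->|/XP].
    have AB B : B \in P -> A :&: B = X.
      by move=> BP; apply/eqP; rewrite eqEsubset sub // subsetI XA XP.
    move=> B C /setU1P[->|BP] /setU1P[->|CP] ne.
    - by rewrite eqxx in ne.
    - exact: AB.
    - by rewrite setIC AB.
    - exact: PX.
  (* Since [A] is itself a petal, [sub] applied to [A] gives [A \subset X]. *)
  case/negP: XK; suff -> : X = A by apply: (subsetP (sub_kern _ _)).
  by apply/eqP; rewrite eqEsubset XA -{1}(setIid A) sub.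
Qed.

End Kernel.

(** * Closure systems without closed sets of size t - 1 *)

Section Closure.
Variables (V : finType) (k t : nat) (F : {set V}) (cl : {set {set V}}).
Implicit Types (A D W X Y : {set V}).

(** In this section [F] is a single set of points, standing for one member of the family, and [cl]
    is its system of closed sets. A set is generating if its closure is all of [F]. *)
Definition generating W := forall Y, Y \in cl -> W \subset Y -> Y = F.

Hypotheses (Fk : #|F| = k) (t1 : 1 <= t).
Hypothesis Fcl : F \in cl.
Hypothesis clF : {in cl, forall A, A \subset F}.
Hypothesis clI : {in cl &, forall A B, A :&: B \in cl}.
Hypothesis clt : {in cl, forall A, #|A| <> t - 1}.
Hypothesis gen : forall W, W \subset F -> generating W -> k <= #|W| + t.

(** Let [W] be a minimal generating set and [N x] the closure of [W :\ x]; by minimality this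
    closure does not regain [x]. *)
Lemma minimal_generating : exists W (N : V -> {set V}),
  [/\ W \subset F, k <= #|W| + t & {in W, forall x, N x \in cl /\ N x :&: W = W :\ x}].
Proof.
pose g W := (W \subset F) && [forall Y in cl, (W \subset Y) ==> (Y == F)].
have gP W : reflect (W \subset F /\ generating W) (g W).
  apply: (iffP andP) => -[WF H]; split=> //.
    by move=> Y Ycl WY; have /forall_inP /(_ _ Ycl) /implyP /(_ WY) /eqP := H.
  by apply/forall_inP => Y Ycl; apply/implyP => WY; apply/eqP; apply: H.
have gF : g F.
  by apply/gP; split=> // Y /clF YF FY; apply/eqP; rewrite eqEsubset YF.
have [W /minsetP[/gP[WF Wg] Wmin] _] := minset_exists gF.
pose N x := \bigcap_(Y in cl | W :\ x \subset Y) Y.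
have Ncl A : F :&: \bigcap_(Y in cl | A \subset Y) Y \in cl.
  elim/big_rec: _ => [|Y U /andP[Ycl _] IH]; first by rewrite setIT.
  by rewrite setICA clI.
have NF x : N x = F :&: N x.
  by apply/esym/setIidPr; apply: bigcap_inf; rewrite Fcl (subset_trans (subD1set _ _)).
exists W, N; split=> [//||x xW]; first exact: gen.
have Nx : N x \in cl by rewrite NF Ncl.
have WN : W :\ x \subset N x by apply/bigcapsP => Y /andP[].
split=> //; suff xN : x \notin N x.
  apply/setP => y; rewrite !inE; case: eqVneq => [->|yx] /=; first by rewrite (negPf xN).
  by apply: andb_idl => yW; apply: (subsetP WN); rewrite !inE yx.
apply/negP => xN; suff : W :\ x = W by move/setP/(_ x); rewrite !inE eqxx xW.
apply: Wmin; last exact: subD1set.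
apply/gP; split; first by apply: subset_trans WF; apply: subD1set.
move=> Y Ycl WY; apply: Wg => //; rewrite -(setD1K xW) subUset sub1set WY andbT.
by apply: (subsetP _ _ xN); apply: bigcap_inf; rewrite Ycl.
Qed.

Section Generators.
Variables (W : {set V}) (N : V -> {set V}).
Hypothesis WF : W \subset F.
Hypothesis kW : k <= #|W| + t.
Hypothesis Ncl : {in W, forall x, N x \in cl}.
Hypothesis NW : {in W, forall x, N x :&: W = W :\ x}.
Let S := F :\: W.
(** On [W] this closed set is exactly [W :\: A], so its size can be tuned through [A]; only its part
    in [S], which has at most [t] points, is not prescribed. *)
Let M A := F :&: \bigcap_(x in A) N x.

Lemma meet_cl A : A \subset W -> M A \in cl.
Proof.
move=> /subsetP AW; rewrite /M; elim/big_rec: _ => [|x U /AW /Ncl NU IH]; first by rewrite setIT.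
by rewrite setICA clI.
Qed.

Lemma meetW A : A \subset W -> M A :&: W = W :\: A.
Proof.
move=> /subsetP AW; apply/setP => y; rewrite !inE.
case: (boolP (y \in W)) => yW; rewrite ?andbF ?andbT // (subsetP WF) //=.
apply/bigcapP/idP => [H|yA x xA].
  by apply/negP => yA; have := H _ yA; have /setP/(_ y) := NW yW; rewrite !inE eqxx yW andbT =>
    ->.
have /setP/(_ y) := NW (AW _ xA); rewrite !inE yW andbT => ->.
by rewrite andbT; apply: contraNneq yA => ->.
Qed.

Lemma card_meet A : A \subset W -> #|M A| = #|W| - #|A| + #|M A :&: S|.
Proof.
move=> AW; rewrite -[LHS](cardsID W) meetW // cardsD (setIidPr AW); congr (_ + _).
by apply: eq_card => y; rewrite /M /S !inE; case: (y \in F); rewrite ?andbF //= andbT andbC.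
Qed.

Lemma cardW : #|W| + #|S| = k.
Proof. by rewrite -Fk -(cardsID W F) (setIidPr WF). Qed.

(** Otherwise [A] can be enlarged inside [W] without changing the part of [M A] in [S], until the
    closed set has the forbidden size [t - 1]. *)
Lemma no_short_meet A : A \subset W -> M A :&: S = M W :&: S -> #|M W :&: S| <= t - 1 ->
  #|W| + #|M W :&: S| < #|A| + (t - 1).
Proof.
move=> AW AS Jt; rewrite ltnNge; apply/negP => le.
have [|A' [AA' A'W A'c]] := @between_exists _ A W (#|W| + #|M W :&: S| - (t - 1)) AW.
  by lia.
apply: (clt (meet_cl A'W)); rewrite card_meet // A'c.
have -> : M A' :&: S = M W :&: S.
  apply/eqP; rewrite eqEsubset -{1}AS; apply/andP; split; apply: setSI; apply: setIS.
    apply/bigcapsP => x xA; apply: bigcap_inf; exact: (subsetP AA').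
  apply/bigcapsP => x xA; apply: bigcap_inf; exact: (subsetP A'W).
have := subset_leq_card AW; lia.
Qed.

(** For every [y] of [S] outside [M W], one [x] in [W] with [y] outside [N x] suffices to exclude
    [y]; these [x] form [A]. *)
Lemma meet_witness : exists2 A : {set V}, A \subset W &
  M A :&: S = M W :&: S /\ #|A| + #|M W :&: S| <= #|S|.
Proof.
(* The default [y] is not taken for [y] in [S :\: M W], as [fP] shows. *)
pose f y := odflt y [pick x in W | y \notin N x].
have fP y : y \in S :\: M W -> f y \in W /\ y \notin N (f y).
  rewrite !inE => /andP[yM /andP[yW yF]]; rewrite /f; case: pickP => [x /andP[] //|no].
  case/negP: yM; rewrite yF /=; apply/bigcapP => x xW.
  by have := no x; rewrite xW /= => /negbFE.
exists (f @: (S :\: M W)).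
  by apply/subsetP => _ /imsetP[y /fP[? _] ->].
split.
  apply/eqP; rewrite eqEsubset; apply/andP; split.
    apply/subsetP => y /setIP[yM yS]; rewrite in_setI yS andbT; apply/negPn/negP => yW.
    have yD : y \in S :\: M W by rewrite inE yW.
    have [fW yN] := fP _ yD; case/negP: yN; move: yM; rewrite inE => /andP[_ /bigcapP]; apply.
    by apply: imset_f.
  apply: setSI; apply: setIS; apply/bigcapsP => x /imsetP[y /fP[xW _] ->].
  exact: bigcap_inf.
rewrite -(cardsID (M W) S) addnC setIC leq_add2l; exact: leq_imset_card.
Qed.

(** Such an [X] is [M (F :\: X)], as every [N x] contains [S]. *)
Lemma full_meet : S \subset M W -> forall X, S \subset X -> X \subset F -> X \in cl.
Proof.
move=> SM X SX XF; have AW : F :\: X \subset W by rewrite subDset setUC -subDset.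
suff -> : X = M (F :\: X) by apply: meet_cl.
apply/setP => y; case: (boolP (y \in W)) => yW.
  have /setP/(_ y) := meetW AW; rewrite !inE yW !andbT => ->.
  by case: (boolP (y \in X)) => //=; rewrite (subsetP WF).
case: (boolP (y \in F)) => yF; last first.
  by rewrite inE (negPf yF); apply: contraNF yF; apply: (subsetP XF).
have yS : y \in S by rewrite inE yW.
rewrite (subsetP SX) // inE yF; apply/esym/bigcapP => x /(subsetP AW) xW.
by have := subsetP SM _ yS; rewrite inE => /andP[_ /bigcapP]; apply.
Qed.

End Generators.

(* Either all supersets of some t-set are closed, or the intersections of the
   closures of a minimal generating set minus one point contain one of size t-1. *)
Lemma closure_good : t = 1 \/ 3 * t <= k.+1 -> t <= k ->
  exists D, [/\ D \subset F, #|D| = t & forall X, D \subset X -> X \subset F -> X \in cl].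
Proof.
move=> tk tlek; have [W [N [WF kW NP]]] := minimal_generating.
have Ncl x xW := (NP x xW).1; have NW x xW := (NP x xW).2.
pose S := F :\: W; pose M A := F :&: \bigcap_(x in A) N x.
have WS : #|W| + #|S| = k by apply: cardW.
have [A AW [AS Ac]] := @meet_witness W N.
have := @no_short_meet W N WF kW Ncl NW A AW AS; rewrite -/S -/(M W) => H.
have AWc := subset_leq_card AW.
have JS : #|M W :&: S| <= #|S| by apply: subset_leq_card (subsetIr _ _).
rewrite -/S -/(M W) in Ac.
have [Jt|Jt] := leqP #|M W :&: S| (t - 1).
  (* With [j = #|M W :&: S|] the bounds give [k - t + 2 * j < 2 * t - 1], against [3 * t <= k.+1];
     for [t = 1] they give [#|W| < #|A|]. *)
  by have := H Jt; case: tk => tk; lia.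
have e : M W :&: S = S by apply/eqP; rewrite eqEcard subsetIr /=; lia.
have SM : S \subset M W by rewrite -e subsetIl.
exists S; split; [exact: subsetDl|lia|exact: (full_meet WF Ncl NW SM)].
Qed.

(** If no suitable [D] arises, then [#|W| = #|S| = 2] and [M W] is empty. The sets [M [set x]] for
    the two points of [W] are then disjoint and, as size 1 is forbidden, have two points each. *)
Lemma closure_corner : t = 2 -> k = 4 ->
  (exists D, [/\ D \subset F, #|D| = t & forall X, D \subset X -> X \subset F -> X \in cl]) \/
  exists A B, [/\ A \in cl, B \in cl, #|A| = 2, #|B| = 2 & A :&: B = set0 /\ F = A :|: B].
Proof.
move=> t2 k4; have [W [N [WF kW NP]]] := minimal_generating.
have Ncl x xW := (NP x xW).1; have NW x xW := (NP x xW).2.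
pose S := F :\: W; pose M A := F :&: \bigcap_(x in A) N x.
have WS : #|W| + #|S| = k by apply: cardW.
have [A AW [AS Ac]] := @meet_witness W N.
have noM := @no_short_meet W N WF kW Ncl NW.
have := noM A AW AS; rewrite -/S -/(M W) => H.
have AWc := subset_leq_card AW.
have JS : #|M W :&: S| <= #|S| by apply: subset_leq_card (subsetIr _ _).
rewrite -/S -/(M W) in Ac.
have [Jt|Jt] := leqP #|M W :&: S| (t - 1); last first.
  left; have e : M W :&: S = S by apply/eqP; rewrite eqEcard subsetIr /=; lia.
  have SM : S \subset M W by rewrite -e subsetIl.
  exists S; split; [exact: subsetDl|lia|exact: (full_meet WF Ncl NW SM)].
right; have {}H := H Jt.
have W2 : #|W| = 2 by lia.
have J0 : #|M W :&: S| = 0 by lia.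
have MW0 : M W = set0.
  apply/eqP; rewrite -cards_eq0; have := card_meet WF NW (subxx W).
  by rewrite -/(M W) -/S J0 => ->; rewrite subnn.
have big x : x \in W -> 2 <= #|M [set x]|.
  move=> xW; have x1 : [set x] \subset W by rewrite sub1set.
  have := card_meet WF NW x1; rewrite -/(M _) -/S cards1 W2 => ->.
  case: (posnP #|M [set x] :&: S|) => [e|]; last by lia.
  have e' : M [set x] :&: S = M W :&: S.
    by move/eqP: e; rewrite cards_eq0 => /eqP ->; apply/esym/eqP; rewrite -cards_eq0 J0.
  by have := noM _ x1 e'; rewrite -/S -/(M W) J0 W2 cards1 t2 => /(_ isT).
have /cards2P[x [y [xy Wxy]]] : #|W| == 2 by rewrite W2.
have xW : x \in W by rewrite Wxy !inE eqxx.
have yW : y \in W by rewrite Wxy !inE eqxx orbT.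
have MI : M [set x] :&: M [set y] = set0.
  by rewrite -MW0 /M Wxy !big_set1 bigcap_setU !big_set1 setIACA setIid.
have MUF : M [set x] :|: M [set y] \subset F by rewrite subUset !subsetIl.
have := subset_leq_card MUF; rewrite cardsU MI cards0 subn0 Fk k4 => c.
have := big _ xW; have := big _ yW => by2 bx2.
exists (M [set x]), (M [set y]); split; [| |lia|lia|split=> //].
- by apply: (meet_cl Ncl); rewrite sub1set.
- by apply: (meet_cl Ncl); rewrite sub1set.
by apply/esym/eqP; rewrite eqEcard MUF cardsU MI cards0 subn0 Fk k4 andTb (leq_add bx2 by2).
Qed.

End Closure.

(** * Members with a short generating set *)

Definition good (V : finType) (t : nat) (K : {set {set V}}) (D A : {set V}) : bool :=
  [&& D \subset A, #|D| == t & [forall X in powerset A, (D \subset X) ==> (X \in K)]].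

Lemma goodP (V : finType) t (K : {set {set V}}) (D A : {set V}) :
  reflect [/\ D \subset A, #|D| = t & forall X : {set V}, D \subset X -> X \subset A -> X \in K]
          (good t K D A).
Proof.
apply: (iffP and3P) => [[DA /eqP Dt /forall_inP H]|[DA Dt H]]; split=> //.
- by move=> X DX XA; have := H X; rewrite inE => /(_ XA) /implyP; apply.
- exact/eqP.
- by apply/forall_inP => X; rewrite inE => XA; apply/implyP => DX; apply: H.
Qed.

Section Encoding.
Variables (V : finType) (s k t Q : nat) (F : {set {set V}}) (cov : {set V} -> {set V}).
Hypotheses (s2 : 2 <= s) (tk : t - 1 < k) (Qk : s * k < Q).
Hypothesis Fk : F \subset ksubsets [set: V] k.
Hypothesis Ff : sunflower_free s (fun c => c = t - 1) F.
Local Notation K := (kern Q F).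
Hypothesis covP : forall X : {set V}, X \notin K -> [/\ #|cov X| <= k * Q, [disjoint cov X & X] &
      {in F, forall A : {set V}, X \subset A -> exists2 z, z \in cov X & z \in A}].
Implicit Types (A X Y Z W : {set V}).

Definition closed_in A : {set {set V}} :=
  [set Y in powerset A | [forall X in powerset Y, (X \notin K) ==> (A :&: cov X \subset Y)]].

Lemma closed_inP A Y : reflect
  (Y \subset A /\ forall X, X \subset Y -> X \notin K -> A :&: cov X \subset Y)
  (Y \in closed_in A).
Proof.
rewrite !inE; apply: (iffP andP) => [[YA /forall_inP H]|[YA H]]; split=> //.
  by move=> X XY XK; have := H X; rewrite inE => /(_ XY) /implyP; apply.
by apply/forall_inP => X; rewrite inE => XY; apply/implyP => XK; apply: H.
Qed.

Lemma closed_in_self A : A \in closed_in A.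
Proof. by apply/closed_inP; split=> // X _ _; apply: subsetIl. Qed.

Lemma closed_in_meet A : {in closed_in A &, forall Y Z, Y :&: Z \in closed_in A}.
Proof.
move=> Y Z /closed_inP[YA HY] /closed_inP[ZA HZ]; apply/closed_inP; split.
  exact: subset_trans (subsetIl _ _) YA.
by move=> X; rewrite !subsetI => /andP[XY XZ] XK; rewrite -!subsetI subsetI HY // HZ.
Qed.

(** A closed [Y] outside [K] would have to contain a point of [cov Y], which is disjoint from
    [Y]. *)
Lemma closed_in_kern A : A \in F -> closed_in A \subset K.
Proof.
move=> AF; apply/subsetP => Y /closed_inP[YA HY]; apply/negPn/negP => YK.
have [_ dY /(_ A AF YA)[z zc zA]] := covP YK.
have /subsetP/(_ z) := HY _ (subxx Y) YK; rewrite inE zA zc => /(_ isT) zY.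
by have := disjointFr dY zc; rewrite zY.
Qed.

Definition nbr Z : {set V} := \bigcup_(X in powerset Z | X \notin K) cov X.

(** The sets obtained from [W] in [j] steps, each adding a point of the cover of some subset outside
    [K]. No member [A] enters the definition, so the number of these sets bounds the number of
    members generated by [W], independently of the size of [V]. *)
Fixpoint reach (j : nat) W : {set {set V}} :=
  if j is j'.+1 then \bigcup_(Z in reach j' W) [set z |: Z | z in nbr Z] else [set W].

Lemma card_reach_mem j W Z : Z \in reach j W -> #|Z| <= #|W| + j.
Proof.
elim: j Z => [|j IH] Z /=; first by rewrite inE addn0 => /eqP ->.
case/bigcupP => Y /IH le /imsetP[z _ ->]; rewrite cardsU1 addnS.
by have := leq_b1 (z \notin Y); lia.
Qed.

Lemma card_reach j W : #|W| + j <= k -> #|reach j W| <= (2 ^ k * (k * Q)) ^ j.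
Proof.
elim: j => [|j IH] le /=; first by rewrite cards1.
rewrite expnSr; apply: leq_trans (_ : #|reach j W| * (2 ^ k * (k * Q)) <= _); last first.
  by rewrite leq_mul2r IH ?orbT //; lia.
apply: (@card_le_mul _ _ _ _ (fun Z => [set z |: Z | z in nbr Z])).
  by move=> Y /bigcupP[Z ZR Yz]; exists Z.
move=> Z ZR; apply: leq_trans (leq_imset_card _ _) _.
apply: (@leq_trans (#|powerset Z| * (k * Q))); last first.
  rewrite leq_mul2r card_powerset leq_exp2l //; apply/orP; right.
  by have := card_reach_mem ZR; lia.
apply: (@leq_trans (#|powerset Z :\: K| * (k * Q))).
  apply: (@card_le_mul _ _ _ _ cov) => [z /bigcupP[X /andP[XZ XK] zX]|X].
    by exists X => //; rewrite inE XK.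
  by rewrite inE => /andP[/covP[]].
by rewrite leq_mul2r subset_leq_card ?orbT // subsetDl.
Qed.

(** A set between [W] and [A] other than [A] is not closed, so some rule supplies a further point of
    [A]. *)
Lemma reach_generating A W j : A \in F -> W \subset A -> generating A (closed_in A) W ->
  #|W| + j = k -> A \in reach j W.
Proof.
move=> AF WA gW Wj; have Ak := family_card Fk AF.
suff H i : i <= j -> exists Z, [/\ Z \in reach i W, W \subset Z, Z \subset A & #|Z| = #|W| + i].
  have [Z [ZR _ ZA Zc]] := H j (leqnn _).
  suff <- : Z = A by [].
  by apply/eqP; rewrite eqEcard ZA Ak Zc Wj /=.
elim: i => [|i IH] ij; first by exists W; rewrite /= inE addn0.
have [Z [ZR WZ ZA Zc]] := IH (ltnW ij).
have [X [XZ XK /subsetPn[z]]] : exists X, [/\ X \subset Z, X \notin K & ~~ (A :&: cov X \subset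
  Z)].
  apply: NNPP => noX; have ZE : Z = A.
    apply: gW => //; apply/closed_inP; split=> // X XZ XK; apply/negPn/negP => h.
    by apply: noX; exists X.
  by move: Zc; rewrite ZE Ak; lia.
rewrite inE => /andP[zA zX] zZ; exists (z |: Z); split.
- apply/bigcupP; exists Z => //; apply/imsetP; exists z => //.
  by apply/bigcupP; exists X => //; rewrite inE XZ.
- exact: subset_trans WZ (subsetUr _ _).
- by rewrite subUset sub1set zA.
- by rewrite cardsU1 zZ Zc addnS.
Qed.

Definition short_generated : {set {set V}} :=
  [set A in F | [exists W : {set V}, [&& W \subset A, #|W| + t < k &
     [forall Y in closed_in A, (W \subset Y) ==> (Y == A)]]]].

(** Such a member is in [reach t.+1 W] for some [W] of size [k - t - 1]: there are at most
    [#|V| ^ (k - t - 1)] choices of [W], and boundedly many members for each. *)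
Lemma card_short_generated :
  #|V| * #|short_generated| <= (2 ^ k * (k * Q)) ^ t.+1 * #|V| ^ (k - t).
Proof.
have [kt|tk'] := leqP k t.
  have -> : short_generated = set0; last by rewrite cards0 muln0.
  apply/setP => A; rewrite !inE; apply/negP => /andP[_ /existsP[W /and3P[_ ? _]]].
  lia.
have -> : k - t = (k - t.+1).+1 by lia.
rewrite [#|V| ^ _]expnS mulnCA leq_mul2l; apply/orP; right.
apply: (@leq_trans (#|ksubsets [set: V] (k - t.+1)| * (2 ^ k * (k * Q)) ^ t.+1)); last first.
  by rewrite mulnC leq_mul2l card_ksubsets cardsT bin_leq_exp orbT.
apply: (@card_le_mul _ _ _ _ (reach t.+1)) => [A|W /ksubsetsP[_ Wc]]; last first.
  by apply: card_reach; rewrite Wc; lia.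
rewrite inE => /andP[AF /existsP[W /and3P[WA Wk /forall_inP gW]]].
have Ak := family_card Fk AF.
(* Supersets of a generating set generate, so its size may be taken to be exactly [k - t - 1]. *)
have [|W' [WW' WA' Wc']] := @between_exists _ W A (k - t.+1) WA; first by lia.
exists W'; first by apply/ksubsetsP; rewrite subsetT.
apply: reach_generating => //; last by rewrite Wc'; lia.
move=> Y YA WY; apply/eqP; have /implyP := gW Y YA; apply.
exact: subset_trans WW' WY.
Qed.

Lemma not_short_generated A W : A \in F -> A \notin short_generated ->
  W \subset A -> generating A (closed_in A) W -> k <= #|W| + t.
Proof.
move=> AF; rewrite inE AF /= => /existsPn/(_ W) noW WA gW.
rewrite leqNgt; apply/negP => lt; case/negP: noW; rewrite WA lt /=.
by apply/forall_inP => Y YA; apply/implyP => WY; apply/eqP; apply: gW.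
Qed.

Lemma not_short_good A : 1 <= t -> t <= k -> t = 1 \/ 3 * t <= k.+1 ->
  A \in F -> A \notin short_generated -> exists D, good t K D A.
Proof.
move=> t1 tlek tk3 AF As; have Ak := family_card Fk AF.
have cK := subsetP (closed_in_kern AF).
have [||||D [DA Dt DK]] := @closure_good _ k t A (closed_in A) Ak t1 (closed_in_self A) _ _ _ _
  tk3 tlek.
- by move=> Y /closed_inP[].
- exact: closed_in_meet.
- by move=> Y /cK /(kern_card_neq s2 tk Qk Fk Ff).
- by move=> W WA gW; apply: not_short_generated gW.
by exists D; apply/goodP; split=> // X DX XA; apply/cK/DK.
Qed.

Lemma not_short_corner A : t = 2 -> k = 4 ->
  A \in F -> A \notin short_generated -> (exists D, good t K D A) \/
  exists B C, [/\ B \in K, C \in K, #|B| = 2, #|C| = 2 & B :&: C = set0 /\ A = B :|: C].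
Proof.
move=> t2 k4 AF As; have Ak := family_card Fk AF.
have cK := subsetP (closed_in_kern AF).
have t1 : 1 <= t by rewrite t2.
have [||||[D [DA Dt DK]]|[B [C [/cK BK /cK CK B2 C2 BC]]]] :=
  @closure_corner _ k t A (closed_in A) Ak t1 (closed_in_self A) _ _ _ _ t2 k4.
- by move=> Y /closed_inP[].
- exact: closed_in_meet.
- by move=> Y /cK /(kern_card_neq s2 tk Qk Fk Ff).
- by move=> W WA gW; apply: not_short_generated gW.
- by left; exists D; apply/goodP; split=> // X DX XA; apply/cK/DK.
- by right; exists B, C.
Qed.

End Encoding.

(** * The common family of kernels *)

Lemma exists_leq_average (I : finType) (J : {set I}) (f : I -> nat) :
  0 < #|J| -> exists2 i, i \in J & #|J| * f i <= \sum_(i in J) f i.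
Proof.
case/card_gt0P => i0 i0J; case: (arg_minnP f i0J) => i iJ imin.
by exists i => //; rewrite -sum_nat_const; apply: leq_sum.
Qed.

Lemma core_card_lt (V : finType) s t (P : {set {set V}}) :
  2 <= s -> sunflower s P -> {in P, forall A : {set V}, #|A| = t} -> #|core P| < t.
Proof.
move=> s2 [Ps Pc] Pt; have [A [B [AP BP AB]]] : exists A B, [/\ A \in P, B \in P & A != B].
  have : 1 < #|P| by rewrite Ps.
  by case/card_gt1P => A [B [AP BP AB]]; exists A, B.
rewrite -(Pc _ _ AP BP AB) -(Pt _ AP); apply: proper_card.
rewrite properE subsetIl /= subsetI subxx /=; apply: contraNN AB => AB.
by rewrite eqEcard AB (Pt _ AP) (Pt _ BP) leqnn.
Qed.

Section Linking.
Variables (V : finType) (s k t Q : nat) (F : {set {set V}}).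
Hypotheses (s2 : 2 <= s) (t1 : 1 <= t) (tk : t - 1 < k) (Qk : s * k < Q).
Hypothesis Fk : F \subset ksubsets [set: V] k.
Hypothesis Ff : sunflower_free s (fun c => c = t - 1) F.
Local Notation K := (kern Q F).
Implicit Types (A X Y D E : {set V}).

Definition link X : {set {set V}} :=
  [set D in ksubsets (~: X) t | [forall X' in powerset X, D :|: X' \in K]].

Lemma linkP X D : reflect
  [/\ D \subset ~: X, #|D| = t & forall X' : {set V}, X' \subset X -> D :|: X' \in K]
  (D \in link X).
Proof.
rewrite inE; apply: (iffP andP) => [[/ksubsetsP[DX Dt] /forall_inP H]|[DX Dt H]].
  by split=> // X' X'X; apply: H; rewrite inE.
by split; [apply/ksubsetsP|apply/forall_inP => X'; rewrite inE; apply: H].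
Qed.

Lemma link_ksubsets X : link X \subset ksubsets [set: V] t.
Proof. by apply/subsetP => D /linkP[_ Dt _]; apply/ksubsetsP; rewrite subsetT. Qed.

Lemma link_kern X : link X \subset K.
Proof. by apply/subsetP => D /linkP[_ _ /(_ set0 (sub0set _))]; rewrite setU0. Qed.

Lemma link_anti X Y : X \subset Y -> link Y \subset link X.
Proof.
move=> XY; apply/subsetP => D /linkP[DY Dt H]; apply/linkP; split=> //.
  by apply: subset_trans DY _; rewrite setCS.
by move=> X' X'X; apply: H; apply: subset_trans XY.
Qed.

(** A core of a sunflower in the link has fewer than [t] points. Adding the same [t - 1 - #|core P|]
    points of [X] to all petals gives a sunflower in [K] with core of size [t - 1]. *)
Lemma link_free X : t - 1 <= #|X| -> sunflower_free s (fun=> True) (link X).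
Proof.
move=> tX P PX sP _; have PP D : D \in P -> D \in link X by move/(subsetP PX).
have ct : #|core P| < t.
  by apply: (core_card_lt s2 sP) => D /PP /linkP[].
have [|E EX Ec] := @ksubset_exists _ X (t - 1 - #|core P|); first by lia.
have [Ps Pc] := sP.
apply: (@kern_glue _ s k t Q F s2 tk Qk Fk Ff P (fun D => D :|: E) (core P :|: E) Ps).
- by move=> D /PP /linkP[_ _]; apply.
- by move=> D D' DP DP' DD'; rewrite -setUIl (Pc _ _ DP DP' DD').
rewrite cardsU (_ : core P :&: E = set0) ?cards0; first by lia.
have /card_gt0P[D DP] : 0 < #|P| by rewrite Ps ltnW.
apply/eqP; rewrite setI_eq0 disjoints_subset.
apply: subset_trans (bigcap_inf _ DP) _; have /linkP[DX _ _] := PP _ DP.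
by apply: subset_trans DX _; rewrite setCS.
Qed.

Lemma card_link X : t - 1 <= #|X| -> #|link X| <= phi s t.
Proof. by move=> tX; apply: (phi_ub s2 (link_ksubsets X)); apply: link_free. Qed.

Lemma good_link A D : good t K D A -> D \in link (A :\: D).
Proof.
move=> /goodP[DA Dt H]; apply/linkP; split=> //.
  by rewrite setCD subsetUr.
move=> X' X'A; apply: H; first exact: subsetUl.
by rewrite subUset DA; apply: subset_trans X'A (subsetDl _ _).
Qed.

Definition deficient : {set {set V}} :=
  [set X in ksubsets [set: V] (k - t) | #|link X| < phi s t].

Lemma deficientPn X : t - 1 <= k - t -> #|X| = k - t -> X \notin deficient -> #|link X| = phi s t.
Proof.
move=> kt Xk; rewrite inE negb_and => /orP[/ksubsetsP[]|]; first by rewrite subsetT.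
by rewrite -leqNgt => le; apply/eqP; rewrite eqn_leq le card_link // Xk.
Qed.

(** A member [A] with kernel [D] is encoded by [X = A :\: D] and [D] in [link X]. Each [X] has at
    most [phi s t] such [D], and a deficient [X] at least one fewer. *)
Lemma card_good : t <= k -> t - 1 <= k - t ->
  #|[set A in F | [exists D, good t K D A]]| + #|deficient| <= phi s t * 'C(#|V|, k - t).
Proof.
move=> tlek kt.
have le : #|[set A in F | [exists D, good t K D A]]| <=
    \sum_(X in ksubsets [set: V] (k - t)) #|link X|.
  apply: (@leq_trans (\sum_(X in ksubsets [set: V] (k - t)) #|[set D :|: X | D in link X]|)).
    apply: (@card_le_sum _ _ _ _ (fun X => [set D :|: X | D in link X])) => A.
    rewrite inE => /andP[AF /existsP[D gD]]; have /goodP[DA Dt _] := gD.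
    exists (A :\: D).
      apply/ksubsetsP; rewrite subsetT cardsD (setIidPr DA) Dt.
      by rewrite (family_card Fk AF).
    apply/imsetP; exists D; first exact: good_link.
    by rewrite -{1}(setID A D) (setIidPr DA).
  by apply: leq_sum => X _; apply: leq_imset_card.
apply: leq_trans (leq_add le (leqnn _)) _.
have -> : #|deficient| = \sum_(X in ksubsets [set: V] (k - t)) (#|link X| < phi s t).
  rewrite -sum1_card big_mkcond [RHS]big_mkcond /=; apply: eq_bigr => X _.
  by rewrite inE; case: (X \in _) => //=; case: ltnP.
rewrite -big_split /= mulnC -cardsT -card_ksubsets -sum_nat_const.
apply: leq_sum => X /ksubsetsP[_ Xk].
by case: ltnP => [|_]; [rewrite addn1|rewrite addn0 card_link // Xk].
Qed.

Section Anchor.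
Variable E0 : {set V}.
Hypothesis E0t : #|E0| = t - 1.
Hypothesis kt : t - 1 <= k - t.

Definition exceptional : {set {set V}} :=
  [set E in ksubsets [set: V] (t - 1) |
    [forall X in ksubsets [set: V] (k - t), (E0 :|: E \subset X) ==> (X \in deficient)]].

(** Some [X] containing [E0 :|: E] is not deficient. Its link has the maximal size [phi s t] and is
    contained in the links of [E] and of [E0], so all three agree. *)
Lemma link_anchor E : #|E| = t - 1 -> E \notin exceptional -> link E = link E0.
Proof.
move=> Et; rewrite inE negb_and => /orP[/ksubsetsP[]|]; first by rewrite subsetT.
case/forall_inPn => X /ksubsetsP[_ Xk]; rewrite negb_imply subUset => /andP[/andP[E0X EX]].
move=> /(deficientPn kt Xk) Xphi.
have eqX (Z : {set V}) : #|Z| = t - 1 -> Z \subset X -> link X = link Z.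
  move=> Zt ZX; apply/eqP; rewrite eqEcard link_anti //= Xphi.
  by apply: card_link; rewrite Zt.
by rewrite -(eqX _ Et EX) -(eqX _ E0t E0X).
Qed.

Lemma card_anchor : t <= k -> #|[set X in deficient | E0 \subset X]| < 'C(#|V| - (t - 1), k - t -
  (t - 1)) ->
  #|link E0| = phi s t.
Proof.
move=> tlek lt; have [X XP Xd] : exists2 X : {set V}, X \in [set X in ksubsets [set: V] (k - t) |
  E0 \subset X] & X \notin deficient.
  apply: NNPP => noX; move: lt; rewrite ltnNge => /negP; apply.
  rewrite -E0t -cardsT -card_supersets ?subsetT ?E0t //.
  apply/subset_leq_card/subsetP => X XP; have := XP; rewrite !inE => /andP[_ ->].
  rewrite andbT; have : X \in deficient by apply/negPn/negP => Xd; apply: noX; exists X.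
  by rewrite !inE.
move: XP; rewrite inE => /andP[/ksubsetsP[_ Xk] E0X].
apply/eqP; rewrite eqn_leq card_link ?E0t //=.
by rewrite -(deficientPn kt Xk Xd); apply/subset_leq_card/link_anti.
Qed.

(** Count pairs of an exceptional [E] and a deficient [X] containing [E0 :|: E]: every such [X] is
    deficient, and [X] has at most [2 ^ k] subsets. *)
Lemma card_exceptional : 2 * (t - 1) <= k - t -> 2 * (t - 1) <= #|V| ->
  #|exceptional| * 'C(#|V| - 2 * (t - 1), k - t - 2 * (t - 1)) <=
  #|[set X in deficient | E0 \subset X]| * 2 ^ k.
Proof.
move=> kt2 Vt.
apply: (@leq_trans (\sum_(E in exceptional) #|[set X in [set X in deficient | E0 \subset X] | E
  \subset X]|)).
  rewrite -sum_nat_const; apply: leq_sum => E; rewrite inE => /andP[/ksubsetsP[_ Et] /forall_inP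
    H].
  (* [E] and [E0] may overlap, so their union is padded to exactly [2 * (t - 1)] points. *)
  have [||Z [EZ _ Zc]] := @between_exists _ (E0 :|: E) [set: V] (2 * (t - 1)).
  - exact: subsetT.
  - by rewrite cardsT Vt andbT cardsU E0t Et; lia.
  rewrite -cardsT -Zc -card_supersets ?subsetT ?Zc //.
  apply/subset_leq_card/subsetP => X; rewrite inE => /andP[Xk ZX].
  have EX := subset_trans EZ ZX; have /implyP/(_ EX) Xd := H _ Xk.
  by move: EX; rewrite subUset => /andP[E0X E1X]; rewrite inE E1X andbT inE Xd.
rewrite (sum_card_exchange _ _ (fun E X => E \subset X)) -sum_nat_const.
apply: leq_sum => X; rewrite inE => /andP[+ _]; rewrite inE => /andP[/ksubsetsP[_ Xk] _].
apply: (@leq_trans #|powerset X|).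
  by apply/subset_leq_card/subsetP => E; rewrite !inE => /andP[].
by rewrite card_powerset Xk leq_exp2l // leq_subr.
Qed.

(** If the kernel [D] of [A] is not in [link E0], every [(t - 1)]-subset [E] of [A :\: D] is
    exceptional, because [D] is in [link E]. Hence [A] contains the [2 * t - 1] points of [D :|: E]
    for an exceptional [E] and one of at most [phi s t] sets [D]. *)
Lemma card_missing_anchor : t <= k ->
  #|[set A in F | [exists D, good t K D A] && ~~ [exists D in link E0, D \subset A]]| <=
  #|exceptional| * (phi s t * #|V| ^ (k - t - (t - 1))).
Proof.
move=> tlek.
pose G E := [set A in ksubsets [set: V] k | [exists D in link E, D :|: E \subset A]].
apply: (@card_le_mul _ _ _ _ G) => [A|E].
  rewrite inE => /and3P[AF /existsP[D gD] noD]; have /goodP[DA Dt _] := gD.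
  have Ak := family_card Fk AF; have DX := good_link gD.
  have Xk : #|A :\: D| = k - t by rewrite cardsD (setIidPr DA) Ak Dt.
  have [|E EX Et] := @ksubset_exists _ (A :\: D) (t - 1); first by rewrite Xk.
  have DE : D \in link E by apply: subsetP DX; apply: link_anti.
  exists E.
    apply: contraNT noD => Eexc; apply/existsP; exists D.
    by rewrite -(link_anchor Et Eexc) DE.
  rewrite inE; apply/andP; split; first by apply/ksubsetsP; rewrite subsetT.
  apply/existsP; exists D; rewrite DE subUset DA; exact: subset_trans EX (subsetDl _ _).
rewrite inE => /andP[/ksubsetsP[_ Et] _].
apply: (@leq_trans (#|link E| * #|V| ^ (k - t - (t - 1)))); last first.
  by rewrite leq_mul2r card_link ?orbT // Et.
apply: (@card_le_mul _ _ _ _ (fun D => [set A in ksubsets [set: V] k | D :|: E \subset A])).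
  by move=> A; rewrite inE => /andP[Ak /exists_inP[D DE DA]]; exists D => //; rewrite inE Ak.
move=> D /linkP[DE Dt _].
have DEc : #|D :|: E| = t + (t - 1).
  rewrite cardsU Dt Et (_ : D :&: E = set0) ?cards0 ?subn0 //.
  by apply/eqP; rewrite setI_eq0 disjoints_subset.
rewrite card_supersets ?subsetT ?DEc //; last by lia.
rewrite !subnDA.
apply: leq_trans (bin_leq_exp _ _) _.
case: (k - t - (t - 1)) => // j; rewrite leq_exp2r // cardsT; lia.
Qed.

End Anchor.

(** Average over all [(t - 1)]-sets; each deficient set contains at most [2 ^ k] of them. *)
Lemma exists_anchor : t - 1 <= #|V| ->
  exists2 E0 : {set V}, #|E0| = t - 1 &
    'C(#|V|, t - 1) * #|[set X in deficient | E0 \subset X]| <= #|deficient| * 2 ^ k.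
Proof.
move=> tV; have [|E0 /ksubsetsP[_ E0t] le] :=
  @exists_leq_average _ (ksubsets [set: V] (t - 1)) (fun E => #|[set X in deficient | E \subset
    X]|).
  by rewrite card_ksubsets cardsT bin_gt0.
exists E0 => //; rewrite -cardsT -card_ksubsets; apply: leq_trans le _.
rewrite (sum_card_exchange _ _ (fun E X => E \subset X)) -sum_nat_const.
apply: leq_sum => X; rewrite inE => /andP[/ksubsetsP[_ Xk] _].
apply: (@leq_trans #|powerset X|).
  by apply/subset_leq_card/subsetP => E; rewrite !inE => /andP[].
by rewrite card_powerset Xk leq_exp2l // leq_subr.
Qed.

End Linking.

(** In the application [b] and [b'] are the binomials of [n] and [n - T] over [k - t], [p] is
    [n ^ (k - t)], [f] is [phi s t], [g] and [ng] count the members with and without a kernel, and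
    [bd] counts the deficient sets. *)
Lemma deficient_arith n b b' p f T c1 F g ng bd :
  F = g + ng -> n * ng <= c1 * p -> f * b' <= F -> n * b <= n * b' + T * p ->
  g + bd <= f * b -> n * bd <= (f * T + c1) * p.
Proof.
move=> -> h1 h2 h3 h4.
have e1 := leq_mul (leqnn n) h4; have e2 := leq_mul (leqnn f) h3; have e3 := leq_mul (leqnn n) h2.
rewrite !mulnDr in e1 e2 e3; rewrite mulnDl.
have E1 : n * (f * b) = f * (n * b) by lia.
have E2 : n * (f * b') = f * (n * b') by lia.
have E3 : f * (T * p) = f * T * p by lia.
lia.
Qed.

Lemma card_split (T : finType) (A : {set T}) (p : pred T) :
  #|A| = #|[set x in A | p x]| + #|[set x in A | ~~ p x]|.
Proof.
rewrite -(cardsID [set x | p x] A); congr (_ + _); apply: eq_card => x; rewrite !inE //.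
by rewrite andbC.
Qed.

(** In orders of magnitude: there are [O(n^(k-t-1))] deficient sets, of which [O(n^(k-2t))] contain
    a suitable [E0]. This is less than the number of [(k - t)]-sets above [E0], so [link E0] is
    full. It leaves [O(n^(t-2))] exceptional sets, each responsible for [O(n^(k-2t+1))] members. *)
Lemma dense_family s k t Q c1 :
  2 <= s -> 1 <= t -> t <= k -> 2 * (t - 1) <= k - t -> s * k < Q ->
  exists C N, forall (V : finType) (F : {set {set V}}), N <= #|V| ->
    F \subset ksubsets [set: V] k ->
    sunflower_free s (fun c => c = t - 1) F ->
    #|V| * #|[set A in F | ~~ [exists D, good t (kern Q F) D A]]| <= c1 * #|V| ^ (k - t) ->
    phi s t * 'C(#|V| - bigT s t, k - t) <= #|F| ->
    exists D : {set {set V}},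
      [/\ D \subset ksubsets [set: V] t, sunflower_free s (fun=> True) D,
          #|D| = phi s t, D \subset kern Q F &
          #|V| * #|[set A in F | ~~ [exists B in D, B \subset A]]| <= C * #|V| ^ (k - t)].
Proof.
move=> s2 t1 tlek kt2 Qk.
have tk : t - 1 < k by lia.
have kt : t - 1 <= k - t by lia.
have [ca [ca0 [Na Ha]]] := exp_leq_bin 0 (t - 1).
have [cb [cb0 [Nb Hb]]] := exp_leq_bin (2 * (t - 1)) (k - t - 2 * (t - 1)).
have [cc [cc0 [Nc Hc]]] := exp_leq_bin (t - 1) (k - t - (t - 1)).
pose c2 := phi s t * bigT s t + c1; pose c3 := ca * 2 ^ k * c2.
exists (c1 + phi s t * (cb * 2 ^ k * c3)), (Na + Nb + Nc + 2 * t + (cc * c3).+1).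
move=> V F NV Fk Ff Fng Flow; set n := #|V| in NV Fng Flow *.
have cbd : n * #|deficient s k t Q F| <= c2 * n ^ (k - t).
  apply: deficient_arith (card_split _ (fun A => [exists D, good t (kern Q F) D A]))
    Fng Flow (bin_sub_leq _ _ _) _.
  exact: card_good.
have [|E0 E0t le0] := @exists_anchor V s k t Q F; first by lia.
set beta := #|[set X in _ | _]| in le0.
have n0 : 0 < n by lia.
have le1 : n * n ^ (t - 1) * beta <= c3 * n ^ (k - t).
  have h := Ha n; rewrite subn0 in h.
  have {}h : n ^ (t - 1) <= ca * 'C(n, t - 1) by apply: h; lia.
  apply: (@leq_trans (ca * (n * ('C(n, t - 1) * beta)))).
    by have := leq_mul (leq_mul (leqnn n) h) (leqnn beta); lia.
  apply: (@leq_trans (ca * (n * (#|deficient s k t Q F| * 2 ^ k)))).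
    by rewrite !leq_mul2l le0 !orbT.
  by have := leq_mul (leqnn (ca * 2 ^ k)) cbd; rewrite /c3; lia.
have kE : n ^ (k - t) = n ^ (t - 1) * n ^ (k - t - (t - 1)) by rewrite -expnD subnKC.
have linkE0 : #|link t Q F E0| = phi s t.
  apply: (@card_anchor _ s k t Q F) => //; rewrite -/beta ltnNge; apply/negP => le.
  have h : n ^ (k - t - (t - 1)) <= cc * beta.
    by apply: leq_trans (Hc n _) _; [lia|rewrite leq_mul2l le orbT].
  have : n * n ^ (k - t) <= cc * c3 * n ^ (k - t).
    rewrite {1}kE; have := leq_mul (leqnn (n * n ^ (t - 1))) h.
    by have := leq_mul (leqnn cc) le1; lia.
  by rewrite leq_mul2r expn_eq0 => /orP[/andP[/eqP]|]; lia.
have cexc : n * #|exceptional s k t Q F E0| * n ^ (k - t - (t - 1)) <= cb * 2 ^ k * c3 * n ^ (k -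
  t).
  have h : #|exceptional s k t Q F E0| * 'C(n - 2 * (t - 1), k - t - 2 * (t - 1)) <= beta * 2 ^ k.
    by apply: card_exceptional => //; lia.
  have hb : n ^ (k - t - 2 * (t - 1)) <= cb * 'C(n - 2 * (t - 1), k - t - 2 * (t - 1)).
    by apply: Hb; lia.
  have -> : n ^ (k - t - (t - 1)) = n ^ (t - 1) * n ^ (k - t - 2 * (t - 1)).
    by rewrite -expnD; congr (_ ^ _); lia.
  set e := #|exceptional _ _ _ _ _ _| in h *; set x := 'C(_, _) in h hb; set y := n ^ (k - t - _)
    in hb *.
  set z := n ^ (t - 1) in le1 *.
  apply: (@leq_trans (n * z * (e * (cb * x)))).
    by have := leq_mul (leqnn (n * z * e)) hb; lia.
  apply: (@leq_trans (n * z * cb * (beta * 2 ^ k))).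
    by have := leq_mul (leqnn (n * z * cb)) h; lia.
  by have := leq_mul le1 (leqnn (cb * 2 ^ k)); lia.
exists (link t Q F E0); split=> //.
- exact: link_ksubsets.
- by apply: link_free s2 t1 tk Qk Fk Ff _ _; rewrite E0t.
- exact: link_kern.
set M := [set A in F | _].
have cM : #|M| <= #|[set A in F | ~~ [exists D, good t (kern Q F) D A]]| +
    #|exceptional s k t Q F E0| * (phi s t * n ^ (k - t - (t - 1))).
  apply: leq_trans (leq_add (leqnn _) (card_missing_anchor s2 t1 tk Qk Fk Ff E0t kt tlek)).
  apply: leq_trans (leq_card_setU _ _); apply/subset_leq_card/subsetP => A.
  by rewrite !inE => /andP[-> ->]; rewrite andbT; case: [exists D, _].
apply: leq_trans (leq_mul (leqnn n) cM) _; rewrite mulnDr mulnDl leq_add //.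
by have := leq_mul (leqnn (phi s t)) cexc; lia.
Qed.

(** * The case s = t = 2, k = 4 *)

Lemma sunflower_two (V : finType) (A B : {set V}) :
  A != B -> sunflower 2 [set A; B] /\ core [set A; B] = A :&: B.
Proof.
move=> AB; apply: sunflower_intro => //; first by rewrite cards2 AB.
move=> X Y /set2P[] -> /set2P[] ->; rewrite ?eqxx //.
by rewrite setIC.
Qed.

Lemma phi_two t : phi 2 t = 1.
Proof.
have [[V [F [Ft Ff Fp]]] pmax] := phiP t (leqnn 2); apply/eqP; rewrite eqn_leq.
apply/andP; split.
  rewrite leqNgt -Fp; apply/negP => /card_gt1P[A [B [AF BF /sunflower_two[sAB _]]]].
  by apply: (Ff [set A; B]) => //; apply/subsetP => X /set2P[] ->.
apply: pmax; exists 'I_t, [set setT]; split.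
- by rewrite sub1set; apply/ksubsetsP; rewrite subsetT cardsT card_ord.
- by move=> P /subset_leq_card; rewrite cards1 => P1 [Ps _] _; rewrite Ps in P1.
- by rewrite cards1.
Qed.

(** With [u = n - tau] one has [q <= u] and [p <= u / 2], so the inequality reduces to
    [3 * u * n <= 4 * c * n]. *)
Lemma corner_arith n tau q p c : n <> 0 -> tau <= n -> 2 * p + tau + q <= n ->
  n ^ 2 <= c * n + tau ^ 2 + tau * q + p ^ 2 -> n - tau <= 2 * c.
Proof.
move=> n0 tn; have := subnKC tn; set u := n - tau => nE; rewrite -nE => h le.
have {}h : 2 * p + q <= u by lia.
have {le} : (tau + u) ^ 2 <= c * (tau + u) + tau ^ 2 + tau * u + p ^ 2.
  by apply: leq_trans le _; rewrite leq_add2r leq_add2l leq_mul2l; apply/orP; right; lia.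
have p2 : 4 * p ^ 2 <= u ^ 2.
  by have -> : 4 * p ^ 2 = (2 * p) ^ 2; [rewrite expnMn|rewrite leq_sqr; lia].
move=> le; have [u0|u0] := posnP u; first by rewrite u0.
have : 3 * u * (tau + u) <= 4 * c * (tau + u) by nia.
rewrite leq_mul2r; case/orP; first by lia.
by lia.
Qed.

Section Corner.
Variables (V : finType) (Q : nat) (F : {set {set V}}).
Hypothesis Qk : 2 * 4 < Q.
Hypothesis Fk : F \subset ksubsets [set: V] 4.
Hypothesis Ff : sunflower_free 2 (fun c => c = 2 - 1) F.
Local Notation K := (kern Q F).
Implicit Types (A B C D X Y : {set V}).

Lemma kern_meet X Y : X \in K -> Y \in K -> X != Y -> #|X :&: Y| <> 1.
Proof.
move=> XK YK /sunflower_two[sXY <-].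
apply: (@kern_free V 2 4 2 Q F) sXY => //.
by apply/subsetP => Z /set2P[] ->.
Qed.

Definition pairs : {set {set V}} := [set D in K | #|D| == 2].
Definition ext D : {set V} := [set x | (x \notin D) && (x |: D \in K)].

Lemma pairsP D : D \in pairs -> D \in K /\ #|D| = 2.
Proof. by rewrite in_set => /andP[? /eqP]. Qed.

Lemma extP x D : reflect (x \notin D /\ x |: D \in K) (x \in ext D).
Proof. by rewrite /ext in_set; apply: (iffP andP). Qed.

Lemma pairs_disjoint D D' : D \in pairs -> D' \in pairs -> D != D' -> D :&: D' = set0.
Proof.
move=> /pairsP[DK D2] /pairsP[DK' D2'] ne.
have := kern_meet DK DK' ne.
have := subset_leq_card (subsetIl D D'); rewrite D2.
case e : #|D :&: D'| => [|[|[|]]] // _ _; first by apply/eqP; rewrite -cards_eq0 e.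
case/negP: ne; suff /eqP <- : D :&: D' == D.
  by rewrite eqEcard subsetIr D2' e.
by rewrite eqEcard subsetIl D2 e.
Qed.

Lemma ext_pair D D' : D \in pairs -> D' \in pairs -> D != D' -> ext D :&: D' = set0.
Proof.
move=> DP DP' ne; apply/setP => x; rewrite in_setI in_set0; apply/negP => /andP[/extP[xD xDK]
  xD'].
have [DK' D2'] := pairsP DP'; have [_ D2] := pairsP DP.
apply: (kern_meet xDK DK').
  by apply/negP => /eqP e; have := cardsU1 x D; rewrite e D2' D2 xD.
rewrite setIUl (pairs_disjoint DP DP' ne) setU0 (_ : _ :&: _ = [set x]) ?cards1 //.
by apply/setIidPl; rewrite sub1set.
Qed.

Lemma ext_disjoint D D' : D \in pairs -> D' \in pairs -> D != D' -> ext D :&: ext D' = set0.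
Proof.
move=> DP DP' ne; apply/setP => x; rewrite in_setI in_set0.
apply/negP => /andP[/extP[xD xDK] /extP[xD' xDK']].
apply: (kern_meet xDK xDK').
  by apply: contraNneq ne => e; rewrite -(setU1K xD) e setU1K.
by rewrite -setUIr (pairs_disjoint DP DP' ne) setU0 cards1.
Qed.

(** The sets [D :|: ext D] are pairwise disjoint, since an overlap would give two sets of [K] with
    exactly one common point. *)
Lemma sum_pairs : \sum_(D in pairs) (2 + #|ext D|) <= #|V|.
Proof.
have E D : D \in pairs -> 2 + #|ext D| = #|D :|: ext D|.
  move=> DP; rewrite cardsU (_ : D :&: ext D = set0).
    by rewrite cards0 subn0; have [_ ->] := pairsP DP.
  by apply/setP => x; rewrite in_setI in_set0; apply/negP => /andP[xD /extP[]]; rewrite xD.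
rewrite (eq_bigr _ E) -cardsT.
have inj : {in pairs &, injective (fun D => D :|: ext D)}.
  move=> D D' DP DP' e; apply/eqP/negPn/negP => ne.
  have : D \subset D' :|: ext D' by rewrite -e subsetUl.
  move/setIidPl; rewrite setIUr (pairs_disjoint DP DP' ne) setIC (ext_pair DP' DP) 1?eq_sym //
    setU0.
  by move=> D0; have [_] := pairsP DP; rewrite -D0 cards0.
rewrite -(big_imset (fun X => #|X|) inj) /=.
have /eqP -> : trivIset [set D :|: ext D | D in pairs].
  apply/trivIsetP => _ _ /imsetP[D DP ->] /imsetP[D' DP' ->] ne.
  have {}ne : D != D' by apply: contraNneq ne => ->.
  rewrite -setI_eq0 setIUl !setIUr (pairs_disjoint DP DP' ne) (ext_disjoint DP DP' ne).
  by rewrite (ext_pair DP DP' ne) setIC (ext_pair DP' DP) 1?eq_sym // !setU0.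
exact/subset_leq_card/subsetT.
Qed.

Definition split_pairs A : bool :=
  [exists B in pairs, [exists C in pairs, (B != C) && (A == B :|: C)]].

Lemma good_ext D A : A \in F -> good 2 K D A -> D \in pairs /\ A :\: D \in ksubsets (ext D) 2.
Proof.
move=> AF /goodP[DA D2 H]; split; first by rewrite in_set H ?D2.
apply/ksubsetsP; split; last by rewrite cardsD (setIidPr DA) (family_card Fk AF) D2.
apply/subsetP => x /setDP[xA xD]; apply/extP; split=> //; apply: H; first exact: subsetUr.
by rewrite subUset DA sub1set xA.
Qed.

(** The terms bound the members that are neither good nor split, the good members via their kernel
    [D] and two points of [ext D], and the unions of two pairs. *)
Lemma card_corner :
  #|F| <= #|[set A in F | ~~ [exists D, good 2 K D A] && ~~ split_pairs A]| +
    \sum_(D in pairs) 'C(#|ext D|, 2) + 'C(#|pairs|, 2).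
Proof.
pose G := [set A in F | [exists D, good 2 K D A]].
pose Sp := [set A in F | split_pairs A].
have FU : F \subset ([set A in F | ~~ [exists D, good 2 K D A] && ~~ split_pairs A] :|: G) :|: Sp.
  by apply/subsetP => A AF; rewrite !inE AF /=; case: [exists D, _] => //=; case: split_pairs.
apply: leq_trans (subset_leq_card FU) _.
apply: leq_trans (leq_card_setU _ _) _; apply: leq_add.
  apply: leq_trans (leq_card_setU _ _) _; rewrite leq_add2l.
  apply: (@leq_trans (\sum_(D in pairs) #|[set D :|: X | X in ksubsets (ext D) 2]|)).
    apply: (@card_le_sum _ _ _ _ (fun D => [set D :|: X | X in ksubsets (ext D) 2])) => A.
    rewrite inE => /andP[AF /existsP[D gD]]; have [DP AD] := good_ext AF gD.
    exists D => //; apply/imsetP; exists (A :\: D) => //.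
    have /goodP[DA _ _] := gD.
    by rewrite -{1}(setID A D) (setIidPr DA).
  by apply: leq_sum => D _; rewrite -card_ksubsets; apply: leq_imset_card.
rewrite -card_ksubsets; apply: leq_trans (leq_imset_card cover _).
apply/subset_leq_card/subsetP => A; rewrite inE => /andP[_ /existsP[B /andP[BP /existsP[C]]]].
case/and3P=> CP BC /eqP ->; apply/imsetP; exists [set B; C].
  apply/ksubsetsP; rewrite cards2 BC; split=> //.
  by apply/subsetP => X /set2P[] ->.
by rewrite /cover bigcup_setU !big_set1.
Qed.

(** Pairs other than [D0], and their extension sets, are disjoint from [ext D0]. If [ext D0] is
    almost everything, this leaves boundedly many members without [D0]. *)
Lemma not_ext_sub D0 A : D0 \in pairs -> A \in F -> ~~ (D0 \subset A) ->
  [exists D, good 2 K D A] || split_pairs A -> A \subset ~: ext D0.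
Proof.
move=> P0 AF D0A.
have sub D : D \in pairs -> D \subset A -> D \subset ~: ext D0 /\ D0 != D.
  move=> DP DA; have ne : D0 != D by apply: contraNneq D0A => ->.
  by split=> //; rewrite -disjoints_subset -setI_eq0 setIC ext_pair.
case/orP => [/existsP[D gD]|/existsP[B /andP[BP /existsP[C /and3P[CP BC /eqP AE]]]]].
  have [DP /ksubsetsP[AD _]] := good_ext AF gD; have /goodP[DA _ _] := gD.
  have [DE ne] := sub _ DP DA.
  rewrite -(setID A D) (setIidPr DA) subUset DE /=; apply: subset_trans AD _.
  by rewrite -disjoints_subset -setI_eq0 ext_disjoint // eq_sym.
have BA : B \subset A by rewrite AE subsetUl.
have CA : C \subset A by rewrite AE subsetUr.
by rewrite AE subUset (sub _ BP BA).1 (sub _ CP CA).1.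
Qed.

(** Choose [D0] with [ext D0] largest: the sum of squares is nearly [n ^ 2] while the sizes sum to
    at most [n], so one of them is nearly [n]. *)
Lemma pair_exists c : c < #|V| -> 0 < #|V| ->
  #|V| ^ 2 <= c * #|V| + (\sum_(D in pairs) #|ext D| ^ 2) + #|pairs| ^ 2 ->
  exists2 D0, D0 \in pairs & #|~: ext D0| <= 2 * c.
Proof.
move=> cV V0 le; have [P0|/set0Pn[D1 D1P]] := eqVneq pairs set0.
  move: le; rewrite P0 big_set0 cards0 exp0n // !addn0 expnS expn1 leq_mul2r; lia.
case: (arg_maxnP (fun D => #|ext D|) D1P) => D0 D0P Dmax.
exists D0 => //.
have -> : #|~: ext D0| = #|V| - #|ext D0| by rewrite -(cardsC (ext D0)) addKn.
have := sum_pairs; rewrite big_split /= sum_nat_const (bigD1 D0) //=.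
set q := \sum_(D in pairs | D != D0) _ => sp.
apply: (@corner_arith _ _ q #|pairs|); [by move=> V00; rewrite V00 in V0|exact: max_card| |].
  by apply: leq_trans sp; rewrite mulnC addnA.
apply: leq_trans le _; rewrite leq_add2r -addnA leq_add2l (bigD1 D0) //= leq_add2l.
rewrite big_distrr /=; apply: leq_sum => D /andP[DP _].
by rewrite expnS expn1 leq_mul2r; apply/orP; right; apply: Dmax.
Qed.

End Corner.

(** * The admissible parameters, and the common family for all of them *)

Lemma leq_phi s t : 2 <= s -> 1 <= t -> s - 1 <= phi s t.
Proof.
move=> s2 t1; have [_] := phiP t s2; apply.
(* These are [s - 1] disjoint [t]-sets, too few for [s] petals. *)
pose f (i : 'I_(s - 1)) : {set 'I_(s - 1) * 'I_t} := setX [set i] setT.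
have finj : injective f.
  move=> i j /setP/(_ (i, Ordinal t1)); rewrite !in_setX !inE eqxx /= andbT.
  by move/esym/eqP.
have cF : #|f @: setT| = s - 1 by rewrite card_imset // cardsT card_ord.
exists ('I_(s - 1) * 'I_t)%type, (f @: setT); split=> //.
  apply/subsetP => _ /imsetP[i _ ->]; apply/ksubsetsP; rewrite subsetT.
  by rewrite cardsX cards1 cardsT card_ord mul1n.
by move=> P /subset_leq_card; rewrite cF => Ps1 [Ps _] _; lia.
Qed.

(** For [t >= 3] the bound on [k] is ample. For [t = 2] it reads [2 + 2 * phi s 2 <= k] with
    [phi s 2 >= s - 1], so [k >= 5] except possibly when [s = 2] and [k = 4]. *)
Lemma parameter_cases s k t : 2 <= s -> 1 <= t -> t <= k ->
  (t + bigT s t) * (t - 1) <= k ->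
  2 * (t - 1) <= k - t /\
  ((t = 1 \/ 3 * t <= k.+1) \/ [/\ s = 2, t = 2 & k = 4]).
Proof.
move=> s2 t1 tk hk; have tT := leq_bigT s2 t1.
have [t3|] := leqP 3 t; first by split; [nia|left; right; nia].
case: t t1 tk hk tT => [|[|[|]]] // _ tk hk tT _; first by split; [lia|left; left].
have h : 2 + bigT s 2 <= k by lia.
split; first by lia.
have [s3|s3] := leqP 3 s; last first.
  have [k4|k4] := eqVneq k 4; last by left; right; lia.
  by right; split=> //; lia.
left; right; have := leq_phi s2 (isT : 0 < 2); rewrite /bigT in h; lia.
Qed.

Lemma leq_muln_pow n a c j : 0 < j -> a <= c -> n * a <= c * n ^ j.
Proof.
case: j => // j _ ac; rewrite mulnC expnS mulnA; apply: leq_trans (_ : c * n <= _).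
  by rewrite leq_mul2r ac orbT.
have [->|n0] := posnP n; first by rewrite muln0.
by rewrite leq_pmulr // expn_gt0 n0.
Qed.

Lemma dense_family_corner Q c1 : 2 * 4 < Q ->
  exists C N, forall (V : finType) (F : {set {set V}}), N <= #|V| ->
    F \subset ksubsets [set: V] 4 ->
    sunflower_free 2 (fun c => c = 2 - 1) F ->
    #|V| * #|[set A in F | ~~ [exists D, good 2 (kern Q F) D A] && ~~ split_pairs Q F A]|
      <= c1 * #|V| ^ 2 ->
    'C(#|V| - 2, 2) <= #|F| ->
    exists D : {set {set V}},
      [/\ D \subset ksubsets [set: V] 2, sunflower_free 2 (fun=> True) D,
          #|D| = 1, D \subset kern Q F &
          #|V| * #|[set A in F | ~~ [exists B in D, B \subset A]]| <= C * #|V| ^ 2].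
Proof.
(* [5 * n] is the gap between [n ^ 2] and twice the lower bound for [F]; [2 * c1 * n] comes from the
   members that are neither good nor split. *)
move=> Qk; pose c := 2 * c1 + 5.
(* The other members without [D0] are 4-subsets of a set of at most [2 * c] points. *)
exists (c1 + (2 * c) ^ 4), c.+1 => V F NV Fk Ff Frest Flow.
set n := #|V| in NV Frest Flow *.
set R := [set A in F | _] in Frest.
have n0 : 0 < n by lia.
have Rn : #|R| <= c1 * n.
  by rewrite -(leq_pmul2l n0); apply: leq_trans Frest _; rewrite expnS expn1; lia.
have bin2_sqr m : 2 * 'C(m, 2) <= m ^ 2.
  by rewrite bin2 mul2n; apply: leq_trans (_ : (m * m.-1)./2.*2 <= m * m.-1) _;
     [rewrite -[leqRHS]odd_double_half leq_addl|rewrite expnS expn1 leq_mul2l leq_pred orbT].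
have sq : n ^ 2 <= c * n + (\sum_(D in pairs Q F) #|ext Q F D| ^ 2) + #|pairs Q F| ^ 2.
  have := @card_corner V Q F Fk; rewrite -/R => cF.
  have e1 : \sum_(D in pairs Q F) 2 * 'C(#|ext Q F D|, 2) <= \sum_(D in pairs Q F) #|ext Q F D| ^
    2.
    by apply: leq_sum.
  rewrite -big_distrr /= in e1.
  have e2 := bin2_sqr #|pairs Q F|.
  have e3 : n ^ 2 <= 2 * 'C(n - 2, 2) + 5 * n.
    case: (n) => [|[|m]] //; rewrite !subSS subn0.
    case: m => [|m] //; rewrite -mul_bin_diag; 
    by rewrite bin1 expnS expn1; lia.
  move: e1 e2 e3 (leq_trans Flow cF); set y := \sum_(D in pairs Q F) #|ext Q F D| ^ 2.
  set x := \sum_(D in pairs Q F) 'C(#|ext Q F D|, 2); set z := 'C(#|pairs Q F|, 2).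
  by set w := #|pairs Q F| ^ 2; rewrite /c => *; lia.
have [||D0 D0P cE] := pair_exists Qk Fk Ff _ _ sq; rewrite -/n //.
have [D0K D02] := pairsP D0P.
exists [set D0]; split.
- by rewrite sub1set; apply/ksubsetsP; rewrite subsetT.
- by move=> P /subset_leq_card; rewrite cards1 => P1 [Ps _] _; rewrite Ps in P1.
- by rewrite cards1.
- by rewrite sub1set.
rewrite mulnDl.
apply: (@leq_trans (n * (#|R| + #|ksubsets (~: ext Q F D0) 4|))).
  rewrite leq_mul2l; apply/orP; right.
  apply: leq_trans (leq_card_setU _ _); apply/subset_leq_card/subsetP => A.
  rewrite inE => /andP[AF noD].
  have D0A : ~~ (D0 \subset A).
    by apply: contraNN noD => D0A; apply/existsP; exists D0; rewrite inE eqxx.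
  rewrite in_setU in_set AF /= -negb_or; case: (boolP ([exists D, good 2 (kern Q F) D A] ||
    split_pairs Q F A)) => //= H.
  apply/ksubsetsP; split; last exact: family_card AF.
  exact: (not_ext_sub Qk Fk Ff D0P AF D0A H).
rewrite mulnDr leq_add // leq_muln_pow // card_ksubsets.
by apply: leq_trans (bin_leq_exp _ _) _; rewrite leq_exp2r.
Qed.

Lemma kernel_exists s k t Q : 2 <= s -> 1 <= t -> t <= k ->
  (t + bigT s t) * (t - 1) <= k -> s * k < Q ->
  exists C N, forall (V : finType) (F : {set {set V}}), N <= #|V| -> extremal s k t F ->
    exists D : {set {set V}},
      [/\ D \subset ksubsets [set: V] t, sunflower_free s (fun=> True) D,
          #|D| = phi s t, D \subset kern Q F &
          #|V| * #|[set A in F | ~~ [exists B in D, B \subset A]]| <= C * #|V| ^ (k - t)].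
Proof.
move=> s2 t1 tk hk Qk; have [kt2 cases] := parameter_cases s2 t1 tk hk.
have t1k : t - 1 < k by lia.
pose c1 := (2 ^ k * (k * Q)) ^ t.+1.
case: cases => [tk3|[se te ke]].
  have [C [N H]] := dense_family c1 s2 t1 tk kt2 Qk.
  exists C, (N + bigT s t) => V F NV Fext; have [[Fk Ff] _] := Fext.
  apply: H => //; [lia| |by apply: extremal_lower => //; lia].
  have [cov covP] := kern_cover Q Fk.
  apply: leq_trans (card_short_generated s2 t1k Qk Fk covP).
  rewrite leq_mul2l; apply/orP; right; apply/subset_leq_card/subsetP => A.
  rewrite inE => /andP[AF]; apply: contraNT => As.
  apply/existsP; exact: (not_short_good s2 t1k Qk Fk Ff covP t1 tk tk3 AF As).
subst s t k; have [C [N H]] := @dense_family_corner Q c1 Qk.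
exists C, (N + bigT 2 2) => V F NV Fext; have [[Fk Ff] _] := Fext.
rewrite phi_two; apply: H => //; [lia| |].
  have [cov covP] := kern_cover Q Fk.
  apply: leq_trans (card_short_generated s2 t1k Qk Fk covP).
  rewrite leq_mul2l; apply/orP; right; apply/subset_leq_card/subsetP => A.
  rewrite inE => /andP[AF]; apply: contraTT => As.
  have [gA|[B [C' [BK CK B2 C2 [BC AE]]]]] := not_short_corner s2 t1k Qk Fk Ff covP erefl erefl
    AF As.
    by rewrite negb_and !negbK; apply/orP; left; apply/existsP.
  rewrite negb_and !negbK; apply/orP; right.
  apply/existsP; exists B; rewrite in_set BK B2 /=.
  apply/existsP; exists C'; rewrite in_set CK C2 AE !eqxx /= andbT.
  by apply/negP => /eqP e; rewrite e setIid in BC; rewrite BC cards0 in C2.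
have := extremal_lower s2 t1 tk _ Fext; rewrite /bigT phi_two mul1n muln1; apply.
by rewrite /bigT phi_two in NV; lia.
Qed.

(** * Random sequences *)

Section Chains.
Variables (V : finType) (R : {set V}) (m : nat).
Implicit Types (X Y E : {set V}) (w : m.-tuple V).

Definition chains : {set m.-tuple V} := [set w : m.-tuple V | uniq w && all [in R] w].

Definition initial (j : nat) w : {set V} := [set x in take j w].

Lemma initial_card j w : w \in chains -> j <= m -> #|initial j w| = j.
Proof.
rewrite inE => /andP[uw _] jm; rewrite cardsE (card_uniqP _) ?take_uniq //.
by rewrite size_takel // size_tuple.
Qed.

Lemma initial_sub j w : w \in chains -> initial j w \subset R.
Proof.
rewrite inE => /andP[_ /allP wR]; apply/subsetP => x; rewrite inE => /mem_take.
exact: wR.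
Qed.

Lemma initial_mono i j w : i <= j -> initial i w \subset initial j w.
Proof.
by move=> ij; apply/subsetP => x; rewrite !inE -(take_takel w ij) => /mem_take.
Qed.

Lemma initial_map (f : V -> V) j w : initial j (map_tuple f w) = f @: initial j w.
Proof.
apply/setP => x; rewrite inE /= -map_take; apply/mapP/imsetP => -[y yw ->].
  by exists y; rewrite // inE.
by exists y => //; rewrite inE in yw.
Qed.

Definition chains_over j X : {set m.-tuple V} := [set w in chains | initial j w == X].

Lemma leq_chains_over_imset (f : V -> V) j X : injective f -> {homo f : x / x \in R} ->
  #|chains_over j X| <= #|chains_over j (f @: X)|.
Proof.
move=> finj fR; rewrite -(@card_in_imset _ _ (map_tuple f)) => [|w w' _ _ /(congr1 val) /= e].
  apply/subset_leq_card/subsetP => _ /imsetP[w + ->].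
  rewrite !inE -!andbA => /and3P[uw /allP wR /eqP wX]; apply/and3P; split.
  - by rewrite map_inj_uniq.
  - by apply/allP => _ /mapP[x /wR xR ->]; apply: fR.
  - by rewrite initial_map wX.
by apply: val_inj; apply: inj_map e.
Qed.

(** Transpositions inside [R] act on the sequences and carry [X] to [Y] in finitely many steps. *)
Lemma leq_chains_over j X Y : X \subset R -> Y \subset R -> #|X| = #|Y| ->
  #|chains_over j X| <= #|chains_over j Y|.
Proof.
have [n] := ubnP #|X :\: Y|; elim: n X => // n IH X Xn XR YR XY.
have [/eqP|/set0Pn[x xXY]] := eqVneq (X :\: Y) set0.
  by rewrite setD_eq0 => sXY; suff -> : X = Y by []; apply/eqP; rewrite eqEcard sXY XY /=.
have [y yYX] : exists y, y \in Y :\: X.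
  have : #|X :\: Y| = #|Y :\: X|.
    by apply/eqP; rewrite -(eqn_add2l #|X :&: Y|) cardsID setIC cardsID XY.
  move=> e; apply/set0Pn; rewrite -cards_eq0 -e cards_eq0; apply/set0Pn; by exists x.
have /setDP[xX xY] := xXY; have /setDP[yY yX] := yYX.
pose f : {perm V} := tperm x y.
have fR z : z \in R -> f z \in R.
  by rewrite /f; case: tpermP => // -> _; [apply: (subsetP YR)|apply: (subsetP XR)].
apply: leq_trans (leq_chains_over_imset j X (@perm_inj _ f) fR) _.
apply: IH => //.
- rewrite ltnS in Xn; apply: leq_trans Xn; apply: proper_card; apply/properP; split.
    apply/subsetP => z /setDP[/imsetP[u uX ->] zY]; rewrite inE zY /=.
    move: zY; rewrite /f; case: tpermP => [_|uy|//]; first by rewrite yY.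
    by rewrite -uy uX in yX.
  exists x => //; apply/negP => /setDP[/imsetP[u uX /esym]]; rewrite /f.
  case: tpermP => [_ e|uy|ux _ e] _; last by [].
    by rewrite e xX in yX.
  by rewrite -uy uX in yX.
- by apply/subsetP => _ /imsetP[u uX ->]; apply/fR/(subsetP XR).
- by rewrite card_imset //; apply: perm_inj.
Qed.

(** The first [j] entries of a uniformly random sequence form a uniformly random [j]-subset of
    [R]. *)
Lemma card_chains_over j X : j <= m -> X \in ksubsets R j ->
  #|chains_over j X| * 'C(#|R|, j) = #|chains|.
Proof.
move=> jm /ksubsetsP[XR Xj].
rewrite -[RHS]sum1_card (partition_big (initial j) [in ksubsets R j]) /=; last first.
  by move=> w wc; apply/ksubsetsP; rewrite initial_sub // initial_card.
rewrite mulnC -card_ksubsets -sum_nat_const; apply: eq_bigr => Y /ksubsetsP[YR Yj].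
transitivity #|chains_over j Y|.
  by apply/eqP; rewrite eqn_leq !leq_chains_over // Xj.
by rewrite -sum1_card; apply: eq_bigl => w; rewrite inE.
Qed.

Lemma card_chains_in j (H : {set {set V}}) : j <= m -> H \subset ksubsets R j ->
  #|[set w in chains | initial j w \in H]| * 'C(#|R|, j) = #|H| * #|chains|.
Proof.
move=> jm HR; rewrite -[X in X * _]sum1_card.
rewrite (partition_big (initial j) [in H]) /=; last by move=> w; rewrite inE => /andP[].
rewrite big_distrl /= -sum_nat_const; apply: eq_bigr => X XH.
rewrite -(card_chains_over jm (subsetP HR _ XH)); congr (_ * _).
rewrite -sum1_card; apply: eq_bigl => w; rewrite !inE -!andbA.
by do 2 congr (_ && _); case: eqP => [->|]; rewrite ?XH ?andbF.
Qed.

Lemma chain_exists i j E X : #|E| = i -> #|X| = j -> E \subset X -> X \subset R ->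
  j <= m -> m <= #|R| ->
  exists w, [/\ w \in chains, initial i w = E & initial j w = X].
Proof.
move=> Ei Xj EX XR jm mR.
have XEj : #|X :\: E| = j - i by rewrite cardsD (setIidPr EX) Xj Ei.
have ij : i <= j by rewrite -Ei -Xj subset_leq_card.
have RXj : #|R :\: X| = #|R| - j by rewrite cardsD (setIidPr XR) Xj.
pose s := enum E ++ enum (X :\: E).
pose r := take (m - j) (enum (R :\: X)).
have ss : size s = j by rewrite size_cat -!cardE Ei XEj subnKC.
have sX : s =i X.
  move=> x; rewrite mem_cat !mem_enum inE; case: (boolP (x \in E)) => //= xE.
  by rewrite (subsetP EX).
have rs : size r = m - j by rewrite size_takel // -cardE RXj leq_sub2r.
have szm : size (s ++ r) == m by rewrite size_cat ss rs subnKC.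
have rX x : x \in r -> x \in R :\: X by move/mem_take; rewrite mem_enum.
exists (Tuple szm); split.
- rewrite inE /=; apply/andP; split.
    rewrite cat_uniq; apply/and3P; split.
    + rewrite cat_uniq !enum_uniq /= andbT; apply/hasPn => x; rewrite !mem_enum.
      by move=> /setDP[].
    + by apply/hasPn => x /rX /setDP[_]; rewrite /= sX.
    + by rewrite take_uniq ?enum_uniq.
  rewrite all_cat; apply/andP; split; apply/allP => x.
    by rewrite sX; apply: (subsetP XR).
  by move=> /rX /setDP[].
- apply/setP => x; rewrite inE /= -catA take_size_cat ?mem_enum //.
  by rewrite -cardE.
- by apply/setP => x; rewrite inE /= take_size_cat // sX.
Qed.

End Chains.

(** * Deficits *)

Section Exactness.
Variables (V : finType) (s k t Q : nat) (F : {set {set V}}) (Y : {set V}).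
Hypotheses (s2 : 2 <= s) (t2 : 2 <= t) (tlek : t <= k) (Qk : s * k < Q).
Hypotheses (tY : t <= #|Y|) (Yk : #|Y| + 2 * (t - 1) <= k).
Hypothesis Yn : #|Y| + k <= #|V|.
Hypothesis Fext : extremal s k t F.
Local Notation K := (kern Q F).
Local Notation R := (~: Y).
Local Notation Omega := (chains R (k - t)).
Implicit Types (A B D E L X : {set V}) (P S : {set {set V}}) (w : (k - t).-tuple V).

Let Fk : F \subset ksubsets [set: V] k. Proof. by have [[]] := Fext. Qed.
Let Ff : sunflower_free s (fun c => c = t - 1) F. Proof. by have [[]] := Fext. Qed.
Let t1 : 1 <= t. Proof. exact: ltnW. Qed.
Let tk : t - 1 < k. Proof. by lia. Qed.

Lemma card_outside : #|Y| + #|R| = #|V|.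
Proof. by rewrite cardsC. Qed.

Lemma subset_card_Y A : A \subset Y -> #|A| + 2 * (t - 1) <= k.
Proof. by move=> /subset_leq_card AY; apply: leq_trans Yk; rewrite leq_add2r. Qed.

(** The family S_w of the overview. The segment has length [k - #|A|] so that [A] joined with all of
    it is a [k]-set of [K], hence a member of [F]. *)
Definition robust w : {set {set V}} :=
  [set A in powerset Y | (t <= #|A|) &&
     [forall X in powerset (initial (k - #|A|) w), A :|: X \in K]].

Lemma robustP w A : reflect
  [/\ A \subset Y, t <= #|A| &
      forall X : {set V}, X \subset initial (k - #|A|) w -> A :|: X \in K]
  (A \in robust w).
Proof.
rewrite inE; apply: (iffP and3P) => -[].
  by rewrite inE => AY tA /forall_inP H; split=> // X XI; apply: H; rewrite inE.
by move=> AY tA H; split; rewrite ?inE //; apply/forall_inP => X; rewrite inE; apply: H.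
Qed.

Lemma disjoint_outside A X : A \subset Y -> X \subset R -> A :&: X = set0.
Proof.
move=> AY XR; apply/eqP; rewrite setI_eq0 disjoints_subset.
by apply: subset_trans AY _; rewrite -setCS setCK.
Qed.

Lemma robust_glue w P E : w \in Omega -> (forall D, D \in P -> D \in robust w) ->
  E \subset initial (t - 1) w -> forall D, D \in P -> D :|: E \in K.
Proof.
move=> wO PS EI D /PS /robustP[DY tD]; apply; apply: subset_trans EI _.
by apply: initial_mono; have := subset_card_Y DY; lia.
Qed.

Lemma card_core_glue (C E : {set V}) w : w \in Omega -> C \subset Y -> #|C| <= t - 1 ->
  E \subset initial (t - 1) w -> #|E| = t - 1 - #|C| -> #|C :|: E| = t - 1.
Proof.
move=> wO CY ct EI Ec; rewrite cardsU disjoint_outside ?cards0 //; first by lia.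
exact: subset_trans EI (initial_sub _ wO).
Qed.

Lemma initial_exists w c : w \in Omega ->
  exists2 E : {set V}, E \subset initial (t - 1) w & #|E| = t - 1 - c.
Proof.
move=> wO; apply: ksubset_exists; rewrite (initial_card wO) ?leq_subr //.
by lia.
Qed.

(** Adding the same points among the first [t - 1] entries of [w] to all petals raises the core to
    size [t - 1] and stays inside [K]. *)
Lemma robust_free w : w \in Omega -> sunflower_free s (fun c => c <= t - 1) (robust w).
Proof.
move=> wO P PS [Ps Pc] ct; have [E EI Ec] := initial_exists #|core P| wO.
have PR D : D \in P -> D \in robust w by move/(subsetP PS).
apply: (@kern_glue V s k t Q F s2 tk Qk Fk Ff P (fun D => D :|: E) (core P :|: E) Ps).
- exact: robust_glue wO PR EI.
- by move=> D D' DP DP' DD'; rewrite -setUIl (Pc _ _ DP DP' DD').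
apply: card_core_glue wO _ ct EI Ec.
have /card_gt0P[D DP] : 0 < #|P| by rewrite Ps ltnW.
by apply: subset_trans (bigcap_inf _ DP) _; have /robustP[] := PR _ DP.
Qed.

(** The gluing of [robust_free], with the member [B] in place of the petal [A]: [B] meets the other
    petals as [A] does and already contains the added points. *)
Lemma robust_conflict w B A (P : {set {set V}}) : w \in Omega -> B \in F ->
  initial (t - 1) w \subset B -> P \subset robust w -> A \notin P ->
  {in P, forall D : {set V}, A :&: D = B :&: D} ->
  sunflower s (A |: P) -> ~ #|core (A |: P)| <= t - 1.
Proof.
move=> wO BF IB PS AP AB [Ps Pc] ct; have [E EI Ec] := initial_exists #|core (A |: P)| wO.
have PR D : D \in P -> D \in robust w by move/(subsetP PS).
have EB : E \subset B by apply: subset_trans IB.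
pose g D := if D == A then B else D :|: E.
have gA : g A = B by rewrite /g eqxx.
have gP D : D \in P -> g D = D :|: E.
  by move=> DP; rewrite /g; case: eqP => // e; rewrite -e DP in AP.
have ne D : D \in P -> A != D by move=> DP; apply: contraNneq AP => ->.
have gAP D : D \in P -> g A :&: g D = core (A |: P) :|: E.
  move=> DP; rewrite gA gP // setIUr -AB // (setIidPr EB).
  by rewrite (Pc A D) ?setU11 ?setU1r // ne.
apply: (@kern_glue V s k t Q F s2 tk Qk Fk Ff _ g (core (A |: P) :|: E) Ps).
- move=> D /setU1P[->|DP]; first by rewrite gA (subsetP (sub_kern _ _)).
  rewrite gP //; exact: robust_glue wO PR EI _ DP.
- move=> D D' /setU1P[->|DP] /setU1P[->|DP'] DD'.
  + by rewrite eqxx in DD'.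
  + exact: gAP.
  + by rewrite setIC gAP.
  + by rewrite !gP // -setUIl (Pc _ _ (setU1r _ DP) (setU1r _ DP') DD').
apply: card_core_glue wO _ ct EI Ec.
have /card_gt0P[D DP] : 0 < #|P| by rewrite -(ltn_add2l (A \notin P)) -cardsU1 Ps AP.
by apply: subset_trans (bigcap_inf _ (setU1r _ DP)) _; have /robustP[] := PR _ DP.
Qed.

(** For [A] inside [Y], the number of [k]-sets with trace [A] on [Y]. *)
Definition weight A : nat := 'C(#|R|, k - #|A|).

Lemma weight_leq (S : {set {set V}}) :
  (forall A, A \in S -> A \subset Y /\ t <= #|A|) ->
  sunflower_free s (fun c => c <= t - 1) S -> \sum_(A in S) weight A <= #|F|.
Proof.
move=> SY Sf; have [_ Fmax] := Fext; rewrite -(@card_trace_family _ k Y S).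
  by apply: Fmax; apply: trace_admissible => // A /SY[].
by move=> A /SY[AY _]; split=> //; have := subset_card_Y AY; lia.
Qed.

Definition robust_weight w : nat := \sum_(A in robust w) weight A.

Lemma robust_weight_leq w : w \in Omega -> robust_weight w <= #|F|.
Proof. by move=> wO; apply: weight_leq (robust_free wO) => A /robustP[]. Qed.

(** By [robust_conflict] the trace of [B] can be added to [robust w] without a forbidden sunflower,
    so its weight is missing from [robust_weight w]. *)
Lemma robust_weight_leq_add w B : w \in Omega -> B \in F -> initial (t - 1) w \subset B ->
  t <= #|B :&: Y| -> B :&: Y \notin robust w -> robust_weight w + weight (B :&: Y) <= #|F|.
Proof.
move=> wO BF IB tA AR; rewrite addnC -big_setU1 //=; apply: weight_leq.
  by move=> A /setU1P[->|/robustP[]]; rewrite ?subsetIr.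
move=> P PS sP ct; case: (boolP (B :&: Y \in P)) => AP.
  have PR : P :\ (B :&: Y) \subset robust w.
    by apply/subsetP => D /setD1P[ne /(subsetP PS) /setU1P[e|//]]; rewrite e eqxx in ne.
  apply: (@robust_conflict w B (B :&: Y) (P :\ (B :&: Y))) => //.
  - by rewrite !inE eqxx.
  - move=> D /(subsetP PR) /robustP[DY _ _].
    by rewrite -setIA (setIidPr DY).
  - by rewrite setD1K.
  - by rewrite setD1K.
apply: (robust_free wO _ sP ct); apply/subsetP => D DP.
by have /setU1P[e|//] := subsetP PS _ DP; rewrite -e DP in AP.
Qed.

(* A set of phi t-sets cannot be extended without creating a sunflower, in
   particular not by a t-set between B :&: Y and B. *)
Lemma layer_lt_phi w B : w \in Omega -> B \in F -> initial (t - 1) w \subset B ->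
  #|B :&: Y| < t -> #|layer (robust w) t| < phi s t.
Proof.
move=> wO BF IB At; have Bk := family_card Fk BF.
have Lt : layer (robust w) t \subset ksubsets [set: V] t.
  by apply/subsetP => D; rewrite inE => /andP[_ /eqP Dt]; apply/ksubsetsP; rewrite subsetT.
have LR : layer (robust w) t \subset robust w.
  by apply/subsetP => D; rewrite inE => /andP[].
have Lf : sunflower_free s (fun=> True) (layer (robust w) t).
  move=> P PL sP _; apply: (robust_free wO _ sP); first exact: subset_trans PL LR.
  have := core_card_lt s2 sP; move/(_ t) => c; rewrite -ltnS subn1 prednK //; apply: c.
  by move=> D /(subsetP PL); rewrite inE => /andP[_ /eqP].
rewrite ltn_neqAle (phi_ub s2 Lt Lf) andbT; apply/negP => /eqP Lphi.
have [||A [BA AB Ac]] := @between_exists _ (B :&: Y) B t.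
- exact: subsetIl.
- by rewrite ltnW //= Bk.
have AL : A \notin layer (robust w) t.
  apply/negP; rewrite inE => /andP[/robustP[AY _ _] _].
  suff : A \subset B :&: Y by move/subset_leq_card; rewrite Ac leqNgt At.
  by rewrite subsetI AB.
have [P PL sP] := phi_extend s2 Lt Lphi Lf Ac AL.
have PR := subset_trans PL LR.
apply: (@robust_conflict w B A P wO BF IB PR _ _ sP).
- by apply: contraNN AL; apply: (subsetP PL).
- move=> D /(subsetP PR) /robustP[DY _ _]; apply/eqP; rewrite eqEsubset setSI //=.
  rewrite subsetI subsetIr andbT; apply: subset_trans BA.
  exact: setIS.
have := core_card_lt s2 sP; move/(_ t) => c; rewrite -ltnS subn1 prednK //; apply: c.
move=> D /setU1P[->//|/(subsetP PL)]; by rewrite inE => /andP[_ /eqP].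
Qed.

Definition defective : {set {set V}} :=
  [set B in F | (#|B :&: Y| < t) || [exists X in powerset (B :\: Y), (B :&: Y) :|: X \notin K]].

Lemma card_Omega_gt0 : 0 < #|Omega|.
Proof.
have kR : k - t <= #|R| by have := card_outside; lia.
have [X XR Xc] := ksubset_exists kR.
have [|w [wO _ _]] := @chain_exists _ R (k - t) 0 (k - t) set0 X (cards0 _) Xc (sub0set _) XR _
  kR.
  by [].
by apply/card_gt0P; exists w.
Qed.

(** A set [A] is robust for [w] with probability [#|H A| / weight A], so it contributes [#|H A|] to
    the mean weight, which is the number of non-defective members with trace [A]. *)
Lemma sum_robust_weight : \sum_(w in Omega) robust_weight w = #|F :\: defective| * #|Omega|.
Proof.
(* [H A] consists of the sets [B :\: Y] for the non-defective members [B] with trace [A]. *)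
pose H A := [set X in ksubsets R (k - #|A|) | [forall X' in powerset X, A :|: X' \in K]].
transitivity (\sum_(A in [set A in powerset Y | t <= #|A|]) #|H A| * #|Omega|).
  transitivity (\sum_(w in Omega) \sum_(A in [set A in powerset Y | t <= #|A|])
      weight A * (initial (k - #|A|) w \in H A)).
    apply: eq_bigr => w wO; rewrite /robust_weight big_mkcond [RHS]big_mkcond /=.
    apply: eq_bigr => A _; rewrite [in RHS]in_set; case: (boolP (A \in powerset Y)) => AY /=;
      last first.
      case: (boolP (A \in robust w)) => // AR; have /robustP[AY' _ _] := AR.
      by rewrite inE AY' in AY.
    have {}AY : A \subset Y by rewrite inE in AY.
    case: (boolP (t <= #|A|)) => tA; last first.
      case: (boolP (A \in robust w)) => // AR; have /robustP[_ tA' _] := AR.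
      by rewrite tA' in tA.
    have -> : (A \in robust w) = (initial (k - #|A|) w \in H A).
      apply/robustP/idP => [[_ _ h]|].
        rewrite inE; apply/andP; split; last by apply/forall_inP => X; rewrite inE; apply: h.
        apply/ksubsetsP; rewrite (initial_sub _ wO) (initial_card wO) //.
        by have := subset_card_Y AY; lia.
      rewrite inE => /andP[_ /forall_inP h]; split=> // X XI; apply: h; by rewrite inE.
    by case: (_ \in H A); rewrite ?muln1 ?muln0.
  rewrite exchange_big /=; apply: eq_bigr => A; rewrite !inE => /andP[AY tA].
  rewrite -big_distrr /= (sum_bool_card _ (fun w => initial (k - #|A|) w \in H A)) mulnC.
  apply: card_chains_in; first by have := subset_card_Y AY; lia.
  by apply/subsetP => X; rewrite inE => /andP[].
rewrite -big_distrl /=; congr (_ * _); rewrite (card_by_trace _ Y).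
rewrite [RHS](bigID (fun A => t <= #|A|)) /= [X in _ = _ + X]big1 ?addn0; last first.
  move=> A /andP[_ tA]; apply/eqP; rewrite cards_eq0 -subset0; apply/subsetP => B.
  rewrite inE => /andP[/setDP[BF +] /eqP BA].
  by rewrite inE BF BA ltnNge tA.
rewrite (eq_bigl (fun A => (A \in powerset Y) && (t <= #|A|))); last by move=> A; rewrite inE.
apply: eq_bigr => A /andP[]; rewrite inE => AY tA.
have HR X : X \in H A -> [/\ X \subset R, #|X| = k - #|A| & forall X' : {set V}, X' \subset X ->
  A :|: X' \in K].
  rewrite inE => /andP[/ksubsetsP[XR Xc] /forall_inP h]; split=> // X' X'X.
  by apply: h; rewrite inE.
have YX X : X \subset R -> X :&: Y = set0 by move=> XR; rewrite setIC disjoint_outside.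
have XA X : X \subset R -> (A :|: X) :\: Y = X.
  move=> XR; rewrite setDUl (_ : A :\: Y = set0) ?set0U; last by apply/eqP; rewrite setD_eq0.
  by apply/setDidPl; rewrite -setI_eq0 YX.
rewrite -(@card_in_imset _ _ (fun X => A :|: X)) => [|X X' /HR[XR _ _] /HR[XR' _ _] e]; last
  first.
  by rewrite -(XA _ XR) e XA.
apply: eq_card => B; apply/imsetP/idP => [[X /HR[XR Xc HX] ->]|].
  have AXY : (A :|: X) :&: Y = A by rewrite setIUl (setIidPl AY) YX // setU0.
  have AXF : A :|: X \in F.
    apply: (kern_card_family s2 tk Qk Fk (HX _ (subxx _))).
    rewrite cardsU disjoint_outside // cards0 subn0 Xc subnKC //.
    by have := subset_card_Y AY; lia.
  rewrite inE AXY eqxx andbT; apply/setDP; split=> //.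
  rewrite inE AXF AXY ltnNge tA /=; apply/exists_inPn => X'.
  by rewrite inE XA // negbK; apply: HX.
rewrite inE => /andP[/setDP[BF BN] /eqP BA]; exists (B :\: Y); last by rewrite -BA setID.
rewrite inE; apply/andP; split.
  apply/ksubsetsP; split; first by rewrite setDE subsetIr.
  by have := cardsID Y B; rewrite BA (family_card Fk BF) => <-; rewrite addKn.
apply/forall_inP => X' X'B; apply/negPn/negP => h; case/negP: BN.
by rewrite inE BF BA ltnNge tA /=; apply/exists_inP; exists X'.
Qed.

Definition loss w : nat := #|F| - robust_weight w.

Lemma sum_loss : \sum_(w in Omega) loss w = #|defective| * #|Omega|.
Proof.
apply/eqP; rewrite -(eqn_add2r (\sum_(w in Omega) robust_weight w)) -big_split /=.
rewrite (eq_bigr (fun=> #|F|)) => [|w /robust_weight_leq le]; last by rewrite subnK.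
rewrite sum_nat_const sum_robust_weight -mulnDl mulnC eqn_mul2r; apply/orP; right; apply/eqP.
rewrite -(cardsID defective F) (setIidPr _) //.
by apply/subsetP => B; rewrite inE => /andP[].
Qed.

(** Markov's inequality: a random [w] begins with a set of [H] with probability [#|H|] over the
    binomial, and its mean loss is [#|defective|]. *)
Lemma loss_bound j (H : {set {set V}}) c d : j <= k - t -> H \subset ksubsets R j ->
  (forall w, w \in Omega -> initial j w \in H -> c <= d * loss w) ->
  c * #|H| <= d * ('C(#|R|, j) * #|defective|).
Proof.
move=> jk HR cl; rewrite -(leq_pmul2r card_Omega_gt0) -!mulnA -sum_loss.
rewrite -(card_chains_in jk HR) mulnA [X in _ <= d * X]mulnC mulnA leq_mul2r; apply/orP; right.
rewrite mulnC -sum_nat_const big_distrr /= big_mkcond [X in _ <= X]big_mkcond /=.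
apply: leq_sum => w _; rewrite inE; case: (boolP (w \in Omega)) => //= wO.
by case: (boolP (_ \in H)) => // /(cl _ wO).
Qed.

(** * Defective members with a trace of at least [t] points *)

Section Heavy.
Variable cov : {set V} -> {set V}.
Hypothesis covP : forall X : {set V}, X \notin K -> [/\ #|cov X| <= k * Q, [disjoint cov X & X] &
      {in F, forall A : {set V}, X \subset A -> exists2 z, z \in cov X & z \in A}].
Variable A : {set V}.
Hypotheses (AY : A \subset Y) (tA : t <= #|A|).

Definition witnesses l : {set {set V}} :=
  [set L in ksubsets R l | [exists B in F, [&& B :&: Y == A, L \subset B &
     [exists X in powerset L, A :|: X \notin K]]]].

(** If [w] begins with a witness, [A] is not robust for [w], while it could be added by
    [robust_weight_leq_add]; so the loss is at least [weight A]. The lower bound on [l] puts the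
    first [t - 1] entries into [B], the upper one puts [X] into the tested segment. *)
Lemma card_witnesses l : t - 1 <= l <= k - #|A| ->
  weight A * #|witnesses l| <= 'C(#|R|, l) * #|defective|.
Proof.
move=> /andP[tl lk]; rewrite -['C(_, l) * _]mul1n; apply: loss_bound; first by lia.
  by apply/subsetP => L; rewrite inE => /andP[].
move=> w wO; rewrite inE => /andP[_ /exists_inP[B BF /and3P[/eqP BA LB /exists_inP[X]]]].
rewrite inE => XL XK; rewrite mul1n -BA /loss.
have := @robust_weight_leq_add w B wO BF; rewrite BA => /(_ _ tA) h; have {}h : robust_weight w +
  weight A <= #|F|.
  apply: h; first exact: subset_trans (initial_mono _ tl) LB.
  apply/negP => /robustP[_ _ /(_ X)] HX; case/negP: XK; apply: HX.
  exact: subset_trans XL (initial_mono _ lk).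
by lia.
Qed.

(* A defective B over A contains a set X with A :|: X outside K and a point z of
   the cover of A :|: X. The witness L lies in B, contains X and avoids z, so that
   B is determined by L, X, z and at most k - #|A| - #|L| - 1 further points. *)
Lemma card_defective_over :
  #|[set B in defective | B :&: Y == A]| <=
  \sum_(l < k - #|A| | t - 1 <= l) #|witnesses l| * (2 ^ k * (k * Q) * #|V| ^ (k - #|A| - l.+1)).
Proof.
have Ak := subset_card_Y AY.
pose G (l : nat) := [set B in defective | (B :&: Y == A) && [exists L in witnesses l,
   [exists X in powerset L, [exists z in cov (A :|: X),
      [&& A :|: X \notin K, z \notin L, z \notin A, L \subset B & z \in B]]]]].
apply: (@leq_trans (\sum_(l < k - #|A| | t - 1 <= l) #|G l|)).
  apply: leq_trans (leq_card_bigcup _ _); apply/subset_leq_card/subsetP => B.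
  rewrite inE => /andP[Bd /eqP BA]; have := Bd; rewrite inE => /andP[BF].
  rewrite BA ltnNge tA /= => /exists_inP[X]; rewrite inE => XB XK.
  have Bk := family_card Fk BF; have [_ dX /(_ B BF)[]] := covP XK.
    by rewrite subUset -{1}BA subsetIl; apply: subset_trans XB (subsetDl _ _).
  move=> z zc zB; have /negbT := disjointFr dX zc; rewrite inE negb_or => /andP[zA zX].
  have zY : z \notin Y by apply: contraNN zA => zY; rewrite -BA inE zB.
  have Xz : X \subset (B :\: Y) :\ z by rewrite subsetD1 XB.
  have Bz : #|(B :\: Y) :\ z| = k - #|A| - 1.
    have BYc : #|B :\: Y| = k - #|A| by rewrite -Bk -(cardsID Y B) BA addKn.
    by rewrite -BYc (cardsD1 z (B :\: Y)) !inE zY zB subn1.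
  (* The smallest size that allows [L] to contain [X] and still meets the requirement [t - 1 <= l]
     of [card_witnesses]. *)
  have [|L [XL LB Lc]] := @between_exists _ X ((B :\: Y) :\ z) (maxn #|X| (t - 1)) Xz.
    rewrite leq_maxl geq_max subset_leq_card //= Bz.
    by clear - Ak t2; lia.
  have LBY : L \subset B :\: Y by apply: subset_trans LB (subD1set _ _).
  have LB' : L \subset B by apply: subset_trans LBY (subsetDl _ _).
  have zL : z \notin L by apply/negP => /(subsetP LB); rewrite !inE eqxx.
  have lt : maxn #|X| (t - 1) < k - #|A|.
    rewrite -Lc; apply: leq_ltn_trans (subset_leq_card LB) _; rewrite Bz.
    by clear - Ak t2; lia.
  apply/bigcupP; exists (Ordinal lt); first by rewrite /= leq_maxr.
  rewrite inE Bd BA eqxx /=; apply/exists_inP; exists L.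
    rewrite inE; apply/andP; split.
      apply/ksubsetsP; split=> //; apply: subset_trans LBY _; by rewrite setDE subsetIr.
    apply/exists_inP; exists B; rewrite // BA eqxx LB' /=.
    by apply/exists_inP; exists X; first by rewrite inE.
  apply/exists_inP; exists X; first by rewrite inE.
  by apply/exists_inP; exists z => //; rewrite XK zL zA LB' zB.
apply: leq_sum => l _.
pose G1 L := [set B in defective | (B :&: Y == A) &&
   [exists X in powerset L, [exists z in cov (A :|: X),
      [&& A :|: X \notin K, z \notin L, z \notin A, L \subset B & z \in B]]]].
apply: (@card_le_mul _ _ _ _ G1) => [B|L].
  by rewrite inE => /and3P[Bd BA /exists_inP[L LW HL]]; exists L; rewrite // inE Bd BA.
rewrite inE => /andP[/ksubsetsP[LR Lc] _].
have lk := ltn_ord l.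
rewrite -mulnA; apply: (@leq_trans (#|powerset L| * (k * Q * #|V| ^ (k - #|A| - l.+1)))); last
  first.
  by rewrite leq_mul2r card_powerset Lc leq_exp2l //; apply/orP; right; lia.
pose G2 X := [set B in defective | (B :&: Y == A) &&
   [exists z in cov (A :|: X),
      [&& A :|: X \notin K, z \notin L, z \notin A, L \subset B & z \in B]]].
apply: (@card_le_mul _ _ _ _ G2) => [B|X _].
  by rewrite inE => /and3P[Bd BA /exists_inP[X XL HX]]; exists X; rewrite // inE Bd BA.
case: (boolP (A :|: X \in K)) => AXK.
  rewrite (_ : G2 X = set0) ?cards0 //; apply/setP => B; rewrite in_set in_set0.
  by apply/negP => /and3P[_ _ /exists_inP[z _ /andP[]]]; rewrite AXK.
have [cX _ _] := covP AXK.
apply: (@leq_trans (#|cov (A :|: X)| * #|V| ^ (k - #|A| - l.+1))); last by rewrite leq_mul2r cX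
  orbT.
pose G3 z := [set B in ksubsets [set: V] k | (z |: (A :|: L) \subset B) && ((z \notin L) && (z
  \notin A))].
apply: (@card_le_mul _ _ _ _ G3) => [B|z _].
  rewrite inE => /and3P[Bd /eqP BA /exists_inP[z zc /and5P[_ zL zA LB zB]]]; exists z => //.
  rewrite inE zL zA !subUset sub1set zB LB -{1}BA subsetIl !andbT.
  by apply/ksubsetsP; rewrite subsetT; split=> //; move: Bd; rewrite inE => /andP[/(family_card
    Fk)].
case: (boolP ((z \notin L) && (z \notin A))) => [/andP[zL zA]|no]; last first.
  rewrite (_ : G3 z = set0) ?cards0 //; apply/setP => B; rewrite in_set in_set0 (negPf no).
  by rewrite !andbF.
have Zc : #|z |: (A :|: L)| = #|A| + l.+1.
  by rewrite cardsU1 cardsU disjoint_outside // cards0 Lc !inE (negPf zL) (negPf zA); lia.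
apply: (@leq_trans #|[set B in ksubsets [set: V] k | z |: (A :|: L) \subset B]|).
  by apply/subset_leq_card/subsetP => B; rewrite !inE => /and3P[-> -> _].
rewrite card_supersets ?subsetT ?Zc //; last by lia.
rewrite cardsT -[in leqRHS]subnDA; apply: leq_trans (bin_leq_exp _ _) _.
case: (k - (#|A| + l.+1)) => // j; rewrite leq_exp2r //; exact: leq_subr.
Qed.

End Heavy.

(** * Members with a trace of fewer than [t] points *)

Definition light_witnesses A : {set {set V}} :=
  [set E in ksubsets R (t - 1) | [exists B in F, (B :&: Y == A) && (E \subset B)]].

(** [B :\: Y] is encoded by [m] disjoint [(t - 1)]-subsets, all of them light witnesses, and the
    remaining points. *)
Lemma card_light A m : A \subset Y -> m * (t - 1) <= k - #|A| ->
  #|[set B in F | B :&: Y == A]| <= #|light_witnesses A| ^ m * #|V| ^ (k - #|A| - m * (t - 1)).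
Proof.
move=> AY; have Ak := subset_card_Y AY.
(* The induction removes one witness at a time; that all [(t - 1)]-subsets are witnesses is
   inherited by the remainders. *)
suff H (G : {set {set V}}) q : G \subset ksubsets R q -> m * (t - 1) <= q ->
    (forall X E, X \in G -> E \subset X -> #|E| = t - 1 -> E \in light_witnesses A) ->
    #|G| <= #|light_witnesses A| ^ m * #|V| ^ (q - m * (t - 1)).
  move=> mk; apply: leq_trans (H [set B :\: Y | B in [set B in F | B :&: Y == A]] _ _ mk _).
  - rewrite card_in_imset // => B B'; rewrite !inE => /andP[_ /eqP BA] /andP[_ /eqP BA'] e.
    by rewrite -(setID B Y) -(setID B' Y) BA BA' e.
  - apply/subsetP => _ /imsetP[B + ->]; rewrite inE => /andP[BF /eqP BA].
    apply/ksubsetsP; split; first by rewrite setDE subsetIr.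
    by have := cardsID Y B; rewrite BA (family_card Fk BF) => <-; rewrite addKn.
  - move=> _ E /imsetP[B + ->] EB Et; rewrite inE => /andP[BF BA].
    rewrite inE; apply/andP; split.
      by apply/ksubsetsP; split=> //; apply: subset_trans EB _; rewrite setDE subsetIr.
    by apply/exists_inP; exists B; rewrite // BA; apply: subset_trans EB (subsetDl _ _).
elim: m G q => [|m IH] G q GR mK HG.
  rewrite mul1n subn0; apply: leq_trans (subset_leq_card GR) _; rewrite card_ksubsets.
  apply: leq_trans (bin_leq_exp _ _) _; case: q {GR mK} => // q; rewrite leq_exp2r //.
  exact: max_card.
rewrite mulSn in mK *; rewrite expnS -mulnA subnDA.
pose G1 E := [set X in G | E \subset X].
apply: (@card_le_mul _ _ _ _ G1) => [X XG|E].
  have /ksubsetsP[XR Xc] := subsetP GR _ XG.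
  have [|E EX Et] := @ksubset_exists _ X (t - 1); first by rewrite Xc (leq_trans (leq_addr _ _)
    mK).
  by exists E; [apply: HG EX Et|rewrite inE XG].
rewrite inE => /andP[/ksubsetsP[ER Et] _].
have E1 X : X \in G1 E -> [/\ X \in G, E \subset X, X \subset R & #|X| = q].
  by rewrite inE => /andP[XG EX]; have /ksubsetsP[] := subsetP GR _ XG.
rewrite -(@card_in_imset _ _ (fun X => X :\: E)) => [|X X' /E1[_ EX _ _] /E1[_ EX' _ _] e]; last
  first.
  by rewrite -(setID X E) -(setID X' E) (setIidPr EX) (setIidPr EX') e.
apply: IH => [||X E' /imsetP[X' /E1[X'G _ _ _] ->] E'X]; last 1 first.
- by apply: HG X'G _; apply: subset_trans E'X (subsetDl _ _).
- apply/subsetP => _ /imsetP[X /E1[_ EX XR Xc] ->]; apply/ksubsetsP.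
  by rewrite (subset_trans (subsetDl _ _) XR) cardsD (setIidPr EX) Xc Et.
- by lia.
Qed.

End Exactness.

(** * Without defective members, [F] is a trace family *)

Section NoDefect.
Variables (V : finType) (s k t Q : nat) (F : {set {set V}}) (Y : {set V}).
Hypotheses (s2 : 2 <= s) (t2 : 2 <= t) (tlek : t <= k) (Qk : s * k < Q).
Hypotheses (tY : t <= #|Y|) (Yk : #|Y| + 2 * (t - 1) <= k) (Yn : #|Y| + k <= #|V|).
Hypothesis Fext : extremal s k t F.
Hypothesis noD : defective t Q F Y = set0.
Local Notation K := (kern Q F).
Local Notation R := (~: Y).
Local Notation Omega := (chains R (k - t)).
Implicit Types (A B D E L X : {set V}) (S : {set {set V}}) (w : (k - t).-tuple V).

Let Fk : F \subset ksubsets [set: V] k. Proof. by have [[]] := Fext. Qed.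

Lemma defect_free_card B : B \in F -> t <= #|B :&: Y|.
Proof.
move=> BF; rewrite leqNgt; apply/negP => lt.
by have : B \in defective t Q F Y; [rewrite inE BF lt|rewrite noD inE].
Qed.

(** The losses sum to zero, so none is positive; a trace that is not robust would cost its positive
    weight. *)
Lemma defect_free_robust w B : w \in Omega -> B \in F -> initial (t - 1) w \subset B ->
  B :&: Y \in robust Q F Y w.
Proof.
move=> wO BF IB; apply/negPn/negP => BR; have tB := defect_free_card BF.
have h := robust_weight_leq_add s2 t2 tlek Qk tY Yk Yn Fext wO BF IB tB BR.
have : \sum_(v in Omega) loss Q F Y v == 0.
  by rewrite (sum_loss s2 t2 tlek Qk tY Yk Yn Fext) noD cards0.
rewrite sum_nat_eq0 => /forall_inP/(_ _ wO); rewrite /loss subn_eq0 => le.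
have : 0 < weight k Y (B :&: Y).
  by rewrite bin_gt0; apply: leq_trans (leq_subr _ _) _; have := cardsC Y; lia.
by move: h le; set x := robust_weight _ _ _ _; set y := weight _ _ _; lia.
Qed.

Lemma robust_full w A j : w \in Omega -> A \in robust Q F Y w -> j = k - #|A| ->
  A :|: initial j w \in F.
Proof.
move=> wO /robustP[AY tA H] ->.
have tk : t - 1 < k by lia.
apply: (kern_card_family s2 tk Qk Fk (H _ (subxx _))).
rewrite cardsU (disjoint_outside AY (initial_sub _ wO)) cards0 subn0 (initial_card wO).
  by rewrite subnKC //; have := subset_leq_card AY; lia.
by lia.
Qed.

(** Pass from [B :\: Y] to [X] through a set [X2] containing [t - 1] points of each: a sequence
    beginning inside [B] shows that [A :|: X2] is a member, and one beginning inside [X2] then does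
    this for [A :|: X]. *)
Lemma defect_free_full B X : B \in F -> X \subset R -> #|X| = k - #|B :&: Y| ->
  (B :&: Y) :|: X \in F.
Proof.
move=> BF XR Xc; set A := B :&: Y in Xc *; have tA : t <= #|A| := defect_free_card BF.
have AY : A \subset Y := subsetIr _ _; have Ac := subset_leq_card AY.
have Rc : #|R| = #|V| - #|Y| by have := cardsC Y; lia.
have BYc : #|B :\: Y| = k - #|A| by rewrite -(family_card Fk BF) -(cardsID Y B) addKn.
have BR : B :\: Y \subset R by rewrite setDE subsetIr.
have mR : k - t <= #|R| by lia.
have jk : k - #|A| <= k - t by lia.
have [|E EB Et] := @ksubset_exists _ (B :\: Y) (t - 1); first by rewrite BYc; lia.
have [|E1 E1X E1t] := @ksubset_exists _ X (t - 1); first by rewrite Xc; lia.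
have [||X2 [EX2 X2R X2c]] := @between_exists _ (E :|: E1) R (k - #|A|).
- by rewrite subUset (subset_trans EB BR) (subset_trans E1X XR).
- rewrite cardsU Et E1t Rc; clear - Yk Yn Ac tA; lia.
have [EX EX'] := andP (etrans (esym (subUset _ _ _)) EX2).
have [w [wO wE wX]] := chain_exists Et X2c EX X2R jk mR.
have AR : A \in robust Q F Y w.
  by apply: defect_free_robust; rewrite // wE; apply: subset_trans EB (subsetDl _ _).
have := robust_full wO AR erefl; rewrite wX => B2F.
have B2Y : (A :|: X2) :&: Y = A.
  by rewrite setIUl (setIidPl AY) [X2 :&: Y]setIC (disjoint_outside (subxx Y) X2R) setU0.
have [w' [wO' wE' wX']] := chain_exists E1t Xc E1X XR jk mR.
have AR' : A \in robust Q F Y w'.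
  rewrite -B2Y; apply: defect_free_robust; rewrite // wE'.
  exact: subset_trans EX' (subsetUr _ _).
by have := robust_full wO' AR' erefl; rewrite wX'.
Qed.

Lemma defect_free_trace : exists S,
  [/\ forall A, A \in S -> A \subset Y /\ t <= #|A|,
      sunflower_free s (fun c => c <= t - 1) S & F = trace_family k Y S].
Proof.
pose S := [set B :&: Y | B in F].
have SP A : A \in S -> A \subset Y /\ t <= #|A|.
  by case/imsetP => B BF ->; rewrite subsetIr defect_free_card.
exists S; split=> //.
  have /card_gt0P[w wO] := card_Omega_gt0 s2 t2 tlek Qk tY Yk Yn Fext.
  move=> P PS; apply: (robust_free s2 t2 tlek Qk tY Yk Yn Fext wO).
  apply: subset_trans PS _; apply/subsetP => _ /imsetP[B BF ->].
  have AY : B :&: Y \subset Y := subsetIr _ _; have Ac := subset_leq_card AY.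
  have tA := defect_free_card BF; set A := B :&: Y in AY Ac tA *.
  (* To see that [A] is robust for the fixed [w], replace [B] by a member with the same trace that
     contains the beginning of [w]. *)
  have B1F : A :|: initial (k - #|A|) w \in F.
    apply: defect_free_full => //; first exact: initial_sub wO.
    by rewrite (initial_card wO) //; lia.
  have B1Y : (A :|: initial (k - #|A|) w) :&: Y = A.
    rewrite setIUl (setIidPl AY) [_ _ w :&: Y]setIC.
    by rewrite (disjoint_outside (subxx Y) (initial_sub _ wO)) setU0.
  rewrite -B1Y; apply: defect_free_robust => //.
  apply: subset_trans (subsetUr _ _); apply: initial_mono; clear - Yk Ac; lia.
apply/setP => B; apply/idP/trace_familyP => [BF|[Bk /imsetP[B' B'F BB']]].
  by rewrite (family_card Fk BF); split=> //; apply/imsetP; exists B.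
rewrite -(setID B Y) BB'; apply: defect_free_full => //; first by rewrite setDE subsetIr.
by rewrite -BB' -Bk -(cardsID Y B) addKn.
Qed.

End NoDefect.

(** * Counting defective members *)

Lemma sum_ord_cond_leq m (p : pred 'I_m) (f : 'I_m -> nat) c :
  (forall i, p i -> f i <= c) -> \sum_(i < m | p i) f i <= m * c.
Proof.
move=> fc; apply: (@leq_trans (\sum_(i < m) c)); last by rewrite sum_nat_const card_ord.
by rewrite big_mkcond /=; apply: leq_sum => i _; case: ifP => // /fc.
Qed.

Lemma scale_bound c w N k' k m g p :
  w * N <= k' * (m * g * p) -> k' <= k -> c * w * N <= c * (k * m) * g * p.
Proof.
move=> h kk; rewrite -!mulnA leq_mul2l; apply/orP; right; apply: leq_trans h _.
by rewrite -!mulnA leq_mul2r kk orbT.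
Qed.

Section Asymptotics.
Variables (V : finType) (s k t Q T c : nat) (F : {set {set V}}) (Y : {set V}).
Hypotheses (s2 : 2 <= s) (t2 : 2 <= t) (tlek : t <= k) (Qk : s * k < Q).
Hypotheses (tY : t <= #|Y|) (Yk : #|Y| + 2 * (t - 1) <= k) (Yn : #|Y| + k <= #|V|).
Hypothesis Fext : extremal s k t F.
Hypotheses (YT : #|Y| <= T) (c0 : 0 < c) (n0 : 0 < #|V|).
Hypothesis cP : forall j, j <= k -> #|V| ^ j <= c * 'C(#|V| - T, j).
Local Notation K := (kern Q F).
Local Notation R := (~: Y).
Local Notation Omega := (chains R (k - t)).
Local Notation NG := (defective t Q F Y).
Implicit Types (A B D E L X : {set V}) (S : {set {set V}}) (w : (k - t).-tuple V).

Let Fk : F \subset ksubsets [set: V] k. Proof. by have [[]] := Fext. Qed.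
(** Bounds the choices of [X] inside a witness and of [z] in a cover. *)
Let M := 2 ^ k * (k * Q).
Local Notation n := #|V|.

Lemma outside_leq : #|R| <= n. Proof. exact: max_card. Qed.

Lemma outside_geq : n - T <= #|R|.
Proof. by have := cardsC Y; lia. Qed.

Lemma exp_leq_weight A : n ^ (k - #|A|) <= c * weight k Y A.
Proof.
apply: leq_trans (cP (leq_subr _ _)) _; rewrite leq_mul2l; apply/orP; right.
by apply: leq_bin2l; apply: outside_geq.
Qed.

Lemma bin_outside_leq j : 'C(#|R|, j) <= n ^ j.
Proof.
apply: leq_trans (bin_leq_exp _ _) _; case: j => // j.
by rewrite leq_exp2r // outside_leq.
Qed.

Lemma exp_split a l : l < a -> n ^ l * n ^ (a - l.+1) = n ^ (a - 1).
Proof. by move=> la; rewrite -expnD; congr (_ ^ _); lia. Qed.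

(** The a priori bound, from at most [n ^ l] witnesses of size [l]. *)
Lemma card_defective_over_exp A : A \subset Y -> t <= #|A| ->
  n * #|[set B in NG | B :&: Y == A]| <= k * M * n ^ (k - #|A|).
Proof.
move=> AY tA; have Ac := subset_leq_card AY.
have [cov covP] := kern_cover Q Fk.
have ka : 0 < k - #|A| by clear - Yk Ac t2; lia.
rewrite -[in n ^ _](prednK ka) expnS mulnCA leq_mul2l; apply/orP; right.
apply: leq_trans (card_defective_over s2 t2 tlek Qk tY Yk Yn Fext covP AY tA) _.
apply: (@leq_trans ((k - #|A|) * (M * n ^ (k - #|A|).-1))); last first.
  by rewrite -mulnA leq_mul2r leq_subr orbT.
apply: sum_ord_cond_leq => l _; rewrite -/M mulnCA leq_mul2l; apply/orP; right.
rewrite -subn1 -(exp_split (ltn_ord l)) leq_mul2r; apply/orP; right.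
apply: leq_trans (bin_outside_leq _); rewrite -card_ksubsets.
by apply/subset_leq_card/subsetP => L; rewrite inE => /andP[].
Qed.

(** The same count with [card_witnesses], which limits the witnesses in terms of [#|NG|] and so
    gains a factor [n] over the defective members. *)
Lemma card_defective_over_loss A : A \subset Y -> t <= #|A| ->
  n * #|[set B in NG | B :&: Y == A]| <= c * (k * M) * #|NG|.
Proof.
move=> AY tA; have Ac := subset_leq_card AY.
have [cov covP] := kern_cover Q Fk.
have ka : 0 < k - #|A| by clear - Yk Ac t2; lia.
set N := #|[set B in _ | _]|.
have h : weight k Y A * N <= (k - #|A|) * (M * #|NG| * n ^ (k - #|A|).-1).
  apply: leq_trans (leq_mul (leqnn _) (card_defective_over s2 t2 tlek Qk tY Yk Yn Fext covP AY
    tA)) _.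
  rewrite big_distrr /=; apply: sum_ord_cond_leq => l tl.
  rewrite -/M -subn1 -(exp_split (ltn_ord l)) mulnA.
  have := card_witnesses s2 t2 tlek Qk tY Yk Yn Fext AY tA (l := l).
  rewrite tl (ltnW (ltn_ord l)) => /(_ isT) hl.
  have b := bin_outside_leq l; move: hl b.
  set x := weight _ _ _ * _; set y := n ^ l; set z := n ^ _; set u := 'C(_, _) => hl b.
  apply: (@leq_trans (y * #|NG| * (M * z))); last by rewrite mulnACA [leqRHS]mulnACA [y * M]mulnC.
  by rewrite leq_mul2r (leq_trans hl) ?orbT // leq_mul2r b orbT.
rewrite -(leq_pmul2r (_ : 0 < n ^ (k - #|A|).-1)) ?expn_gt0 ?n0 //.
rewrite -[n * N * _]mulnAC -expnS prednK //.
apply: leq_trans (leq_mul (exp_leq_weight A) (leqnn N)) _.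
exact: scale_bound h (leq_subr _ _).
Qed.

(** [card_light] is used with [m.+2] blocks. One factor is converted into [#|NG|] by the first
    bound; each of the other [m.+1] saves a factor [n] by the second. Of these savings
    [m = t - #|A|] make up for the small trace, and one remains. *)
Lemma card_light_exp m A C1 : A \subset Y -> #|A| < t ->
  m = t - #|A| -> m.+2 * (t - 1) <= k - #|A| ->
  n ^ (k - t) * #|light_witnesses t F Y A| <= 2 * c * (n ^ (t - 1) * #|NG|) ->
  n * #|light_witnesses t F Y A| <= C1 * n ^ (t - 1) ->
  n * #|[set B in F | B :&: Y == A]| <= C1 ^ m.+1 * (2 * c) * #|NG|.
Proof.
move=> AY At mE mk h1 h2.
have := card_light s2 t2 tlek Qk tY Yk Yn Fext AY mk.
set N := #|[set B in F | _]|; set x := #|light_witnesses _ _ _ _| in h1 h2 *.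
move=> h; apply: leq_trans (leq_mul (leqnn n) h) _.
have h3 : x <= C1 * n ^ (t - 2).
  rewrite -(leq_pmul2l n0) mulnCA -expnS; apply: leq_trans h2 _.
  by rewrite (_ : (t - 2).+1 = t - 1) //; lia.
have h4 : n ^ (k - t - (t - 1)) * x <= 2 * c * #|NG|.
  rewrite -(leq_pmul2l (_ : 0 < n ^ (t - 1))) ?expn_gt0 ?n0 // mulnA -expnD.
  rewrite subnKC; last by clear - tY Yk t2; lia.
  by apply: leq_trans h1 _; rewrite mulnCA.
have h5 : x ^ m.+1 <= C1 ^ m.+1 * n ^ ((t - 2) * m.+1).
  by rewrite expnM -expnMn leq_exp2r.
rewrite expnS -mulnA [n * _]mulnCA.
have -> : n * (x ^ m.+1 * n ^ (k - #|A| - m.+2 * (t - 1))) =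
   x ^ m.+1 * n ^ (k - #|A| - m.+2 * (t - 1)).+1 by rewrite mulnCA -expnS.
apply: (@leq_trans (x * (C1 ^ m.+1 * n ^ ((t - 2) * m.+1) * n ^ (k - #|A| - m.+2 * (t - 1)).+1))).
  by rewrite leq_mul2l leq_mul2r h5 !orbT.
rewrite -!mulnA -expnD mulnCA leq_mul2l; apply/orP; right.
rewrite [2 * (c * _)]mulnA mulnC; apply: leq_trans h4; rewrite leq_mul2r; apply/orP; right.
rewrite leq_eqVlt; apply/orP; left; apply/eqP; congr (_ ^ _).
have e1 : (t - 2) * m.+1 + m.+1 = m.+1 * (t - 1).
  by rewrite -mulSnr mulnC; congr (_ * _); lia.
have e2 : m.+2 * (t - 1) = m.+1 * (t - 1) + (t - 1) by rewrite mulSn addnC.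
rewrite e2 in mk *; clear - e1 mk mE t2 At Yk tY; move: e1 mk.
set u := (t - 2) * _; set v := _ * (t - 1) => e1 mk; lia.
Qed.

(** Here [robust w] has at most [phi s t - 1] sets of size [t], so its weight falls short of the
    lower bound for [F] by about one binomial of order [n ^ (k - t)]. The error
    [g * n ^ (k - t - 1)], from changing binomials and from the larger sets, is absorbed by
    [2 * (c * g) <= n]. *)
Lemma light_loss A w g : A \subset Y -> #|A| < t -> w \in Omega ->
  initial (t - 1) w \in light_witnesses t F Y A ->
  g = phi s t * T + 2 ^ T -> 2 * (c * g) <= n ->
  phi s t * 'C(n - T, k - t) <= #|F| ->
  n ^ (k - t) <= 2 * c * loss Q F Y w.
Proof.
move=> AY At wO; rewrite inE => /andP[_ /exists_inP[B BF /andP[/eqP BA EB]]] gE ng Flow.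
have lt : #|layer (robust Q F Y w) t| < phi s t.
  by apply: (layer_lt_phi s2 t2 tlek Qk tY Yk Yn Fext wO BF EB); rewrite BA.
have ktS : k - t = (k - t.+1).+1 by clear - tY Yk t2; lia.
have le : robust_weight Q F Y w <= (phi s t - 1) * 'C(#|R|, k - t) + 2 ^ T * n ^ (k - t.+1).
  rewrite /robust_weight (bigID (fun A' => #|A'| == t)) /=; apply: leq_add.
    rewrite (eq_bigr (fun=> 'C(#|R|, k - t))) => [|A' /andP[_ /eqP At']]; last by rewrite /weight
      At'.
    rewrite sum_nat_const leq_mul2r; apply/orP; right; rewrite -ltnS -subSn ?subn1 /=; last by
      lia.
    rewrite (_ : #|_| = #|layer (robust Q F Y w) t|) //.
    by apply: eq_card => A'; rewrite [in RHS]inE.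
  apply: (@leq_trans (\sum_(A' in powerset Y) n ^ (k - t.+1))); last first.
    by rewrite sum_nat_const card_powerset leq_mul2r leq_exp2l // YT orbT.
  rewrite big_mkcond [leqRHS]big_mkcond /=; apply: leq_sum => A' _.
  case: ifP => // /andP[/robustP[AY' tA' _] nt]; rewrite inE AY'.
  apply: leq_trans (bin_outside_leq _) _; rewrite leq_pexp2l //.
  by apply: leq_sub2l; rewrite ltn_neqAle eq_sym nt.
have b := bin_sub_leq T (k - t) n.
have cT := cP (leq_subr t k).
have le2 : 'C(#|R|, k - t) <= 'C(n, k - t) by apply: leq_bin2l; apply: outside_leq.
have E : n * n ^ (k - t.+1) = n ^ (k - t) by rewrite -expnS -ktS.
have Wl := robust_weight_leq s2 t2 tlek Qk tY Yk Yn Fext wO.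
move: le b cT le2 E Flow lt Wl; rewrite /loss.
set W := robust_weight _ _ _ _; set p := n ^ (k - t); set p1 := n ^ _; set br := 'C(#|R|, _).
set bn := 'C(n, _); set bT := 'C(n - T, _); set f := phi s t in gE *.
move=> le b cT le2 E Flow lt Wl.
have f0 : f = (f - 1) + 1 by lia.
have nW : n * W + n * bT <= n * #|F| + g * p.
  have q1 : n * W <= (f - 1) * (n * bn) + 2 ^ T * p.
    have := leq_mul (leqnn n) le; rewrite mulnDr (mulnCA n (2 ^ T)) E (mulnCA n (f - 1)) => h.
    apply: leq_trans h _; rewrite leq_add2r leq_mul2l; apply/orP; right.
    by rewrite leq_mul2l le2 orbT.
  have q2 : (f - 1) * (n * bn) <= (f - 1) * (n * bT) + (f - 1) * (T * p).
    by rewrite -mulnDr leq_mul2l b orbT.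
  have q3 : n * (f * bT) <= n * #|F| by rewrite leq_mul2l Flow orbT.
  have q4 : n * (f * bT) = (f - 1) * (n * bT) + n * bT.
    by rewrite {1}f0 mulnDl mulnDr mul1n mulnCA.
  have q5 : (f - 1) * (T * p) + 2 ^ T * p <= g * p.
    rewrite gE mulnA -mulnDl leq_mul2r leq_add2r leq_mul2r leq_subr !orbT //.
  lia.
have nL : n * bT <= n * (#|F| - W) + g * p by rewrite mulnBr; lia.
have q6 : n * p <= n * (c * (#|F| - W)) + c * g * p.
  have := leq_mul (leqnn c) nL; rewrite mulnDr => h.
  have q : n * p <= c * (n * bT) by rewrite mulnCA leq_mul2l cT orbT.
  by apply: leq_trans q _; apply: leq_trans h _; rewrite mulnCA [c * (g * p)]mulnA.
have q7 : 2 * (c * g * p) <= n * p by rewrite mulnA leq_mul2r ng orbT.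
rewrite -(leq_pmul2l n0) -mulnA (mulnCA n 2).
by move: q6 q7; set x := c * g * p; set y := n * (c * _); set z := n * p; lia.
Qed.

End Asymptotics.

(** The room that the bound on [k] provides: two disjoint [(t - 1)]-sets outside [Y], and the blocks
    for [card_light_exp] over a trace of size [a]. *)
Lemma kernel_size_bounds k t T a : 2 <= t -> t <= T -> (t + T) * (t - 1) <= k ->
  T + 2 * (t - 1) <= k /\ (a < t -> (t - a).+2 * (t - 1) <= k - a).
Proof.
case: t => [|[|u]] // _ /subnK; set v := T - _ => <-; rewrite subn1 /= => hk.
split; first by nia.
move=> au; have /subnK wE : a <= u.+2 := ltnW au; set w := u.+2 - a in wE *.
(* With [t = u + 2] and [w = t - a] the left side is [w * u + 3 * u + 4], which is largest at
   [a = 0]. *)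
have h : w.+2 * u.+1 + a <= u * u + 5 * u + 4.
  have wu : w * u <= (u + 2) * u by rewrite leq_mul2r; apply/orP; right; lia.
  rewrite mulnS; clearbody w; nia.
have h2 : u * u + 5 * u + 4 <= (u.+2 + (v + u.+2)) * u.+1 by nia.
have := leq_trans h (leq_trans h2 hk); lia.
Qed.

(** A bootstrap: the a priori bound makes light witnesses rare, and then each of the at most [2 ^ T]
    traces carries at most [C2 * #|NG| / n] defective members. Summing leaves no defective member
    for large [n]. *)
Lemma no_defective s k t Q C0 :
  2 <= s -> 2 <= t -> t <= k -> s * k < Q -> (t + bigT s t) * (t - 1) <= k ->
  exists N, forall (V : finType) (F : {set {set V}}) (Y : {set V}), N <= #|V| ->
    extremal s k t F -> t <= #|Y| -> #|Y| <= bigT s t ->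
    #|V| * #|[set B in F | #|B :&: Y| < t]| <= C0 * #|V| ^ (k - t) ->
    defective t Q F Y = set0.
Proof.
move=> s2 t2 tlek Qk hk; have t1 := ltnW t2.
set T := bigT s t in hk *; have tT : t <= T by apply: leq_bigT.
have [c [c0 [Nc cP]]] := exp_leq_bin_uniform T k.
pose M := 2 ^ k * (k * Q); pose g := phi s t * T + 2 ^ T.
pose C0' := C0 + 2 ^ T * (k * M); pose C1 := (2 * c * C0').+1.
pose C2 := c * (k * M) + C1 ^ t.+1 * (2 * c).
exists (Nc + 2 * (c * g) + (2 ^ T * C2).+1 + T + k) => V F Y NV Fext tY YT Flight.
set n := #|V| in NV Flight *.
have n0 : 0 < n by lia.
have Yk : #|Y| + 2 * (t - 1) <= k by have [] := kernel_size_bounds 0 t2 tT hk; lia.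
have Yn : #|Y| + k <= n by lia.
have cP' j : j <= k -> n ^ j <= c * 'C(n - T, j) by apply: cP; lia.
have Flow : phi s t * 'C(n - T, k - t) <= #|F| by apply: extremal_lower => //; lia.
set NG := defective t Q F Y.
have sub_powerset (G : {set {set V}}) d : (forall A : {set V}, A \subset Y -> n * #|[set B in G |
  B :&: Y == A]| <= d) ->
    n * #|G| <= 2 ^ T * d.
  move=> H; rewrite (card_by_trace G Y) big_distrr /=.
  apply: (@leq_trans (\sum_(A in powerset Y) d)); first by apply: leq_sum => A; rewrite inE;
    apply: H.
  by rewrite sum_nat_const card_powerset leq_mul2r leq_exp2l // YT orbT.
have apriori : n * #|NG| <= C0' * n ^ (k - t).
  pose G := [set B in NG | t <= #|B :&: Y|].
  have NGU : NG \subset [set B in F | #|B :&: Y| < t] :|: G.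
    apply/subsetP => B BNG; rewrite in_setU in_set [B \in G]in_set BNG /=.
    have : B \in F by move: BNG; rewrite inE => /andP[].
    by move=> ->; case: ltnP.
  have := leq_trans (subset_leq_card NGU) (leq_card_setU _ _) => h.
  apply: leq_trans (leq_mul (leqnn n) h) _; rewrite mulnDr mulnDl leq_add // -mulnA.
  apply: sub_powerset => A AY; case: (leqP t #|A|) => tA.
    apply: (@leq_trans (k * M * n ^ (k - #|A|))); last first.
      by rewrite leq_mul2l leq_pexp2l ?orbT // leq_sub2l.
    apply: leq_trans (card_defective_over_exp s2 t2 tlek Qk tY Yk Yn Fext YT c0 n0 AY tA).
    rewrite leq_mul2l; apply/orP; right; apply/subset_leq_card/subsetP => B.
    by rewrite !in_set => /andP[/andP[-> _] ->].
  rewrite (_ : [set B in G | _] = set0) ?cards0 ?muln0 //; apply/setP => B.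
  rewrite [B \in set0]in_set0 in_set; apply/negP => /andP[BG /eqP BA].
  by move: BG; rewrite in_set BA leqNgt tA andbF.
have light (A : {set V}) : A \subset Y -> #|A| < t ->
    n * #|[set B in F | B :&: Y == A]| <= C1 ^ t.+1 * (2 * c) * #|NG|.
  move=> AY At.
  have h1 : n ^ (k - t) * #|light_witnesses t F Y A| <= 2 * c * (n ^ (t - 1) * #|NG|).
    have LR : light_witnesses t F Y A \subset ksubsets (~: Y) (t - 1).
      by apply/subsetP => E; rewrite inE => /andP[].
    apply: (@leq_trans (2 * c * ('C(#|~: Y|, t - 1) * #|NG|))).
      apply: (loss_bound s2 t2 tlek Qk tY Yk Yn Fext _ LR); first by lia.
      move=> w wO wL; apply: (light_loss s2 t2 tlek Qk tY Yk Yn Fext YT c0 n0 cP' AY At wO wL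
        (erefl g)) => //.
      by lia.
    rewrite leq_mul2l leq_mul2r; do 2 (apply/orP; right).
    exact: bin_outside_leq.
  (* By [h1] and the a priori bound, light witnesses are at most a fraction of order [1 / n] of
     [n ^ (t - 1)]. *)
  have h2 : n * #|light_witnesses t F Y A| <= C1 * n ^ (t - 1).
    rewrite -(leq_pmul2l (_ : 0 < n ^ (k - t))) ?expn_gt0 ?n0 // mulnCA.
    apply: leq_trans (leq_mul (leqnn n) h1) _.
    have := leq_mul (leqnn (2 * c * n ^ (t - 1))) apriori.
    rewrite /C1; set a := n ^ (t - 1); set b := n ^ (k - t); set d := #|NG| => h.
    apply: (@leq_trans (2 * c * a * (n * d))); first by lia.
    apply: leq_trans h _; rewrite mulSn mulnDr; apply: leq_trans (leq_addl (b * a) _).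
    by rewrite [leqRHS]mulnC -[leqRHS]mulnA -!mulnA [C0' * (a * b)]mulnCA.
  have [_ /(_ At) mk] := kernel_size_bounds #|A| t2 tT hk.
  apply: leq_trans (card_light_exp s2 t2 tlek Qk tY Yk Yn Fext YT c0 n0 AY At erefl mk h1 h2) _.
  by rewrite !leq_mul2r leq_pexp2l ?orbT //; lia.
have : n * #|NG| <= 2 ^ T * (C2 * #|NG|).
  apply: sub_powerset => A AY; case: (leqP t #|A|) => tA.
    apply: leq_trans (card_defective_over_loss s2 t2 tlek Qk tY Yk Yn Fext YT c0 n0 cP' AY tA) _.
    by rewrite leq_mul2r leq_addr orbT.
  apply: (@leq_trans (C1 ^ t.+1 * (2 * c) * #|NG|)); last by rewrite leq_mul2r leq_addl orbT.
  apply: leq_trans (light _ AY tA); rewrite leq_mul2l; apply/orP; right.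
  apply/subset_leq_card/subsetP => B; rewrite in_set [in X in _ -> X]in_set => /andP[BNG ->].
  by rewrite andbT; move: BNG; rewrite inE => /andP[].
rewrite mulnA leq_mul2r cards_eq0 => /orP[/eqP //|]; lia.
Qed.

(** * Weights and the lexicographic order *)

Lemma mkseq_lexi_cons (f g : nat -> nat) m :
  ((mkseq f m.+1 : seqlexi nat) <= mkseq g m.+1)%O =
  (f 0 <= g 0) && ((g 0 <= f 0) ==> ((mkseq (f \o S) m : seqlexi nat) <= mkseq (g \o S) m)%O).
Proof.
have E h : mkseq h m.+1 = h 0 :: mkseq (h \o S) m :> seq nat.
  by rewrite /mkseq /= (iotaDl 1 0) -map_comp.
by rewrite !E Order.SeqLexiOrder.Exports.lexi_cons.
Qed.

Lemma mkseq_lexi_pointwise (f g : nat -> nat) m :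
  (forall i, i < m -> f i <= g i) -> ((mkseq f m : seqlexi nat) <= mkseq g m)%O.
Proof.
elim: m f g => [|m IH] f g fg; first exact: Order.SeqLexiOrder.Exports.lexi0s.
by rewrite mkseq_lexi_cons fg //=; apply/implyP => _; apply: IH => i im; apply: fg.
Qed.

(** At the first difference, a surplus of one unit in [f] outweighs everything that [g] has in later
    positions. *)
Lemma mkseq_lexi_weighted (f g w : nat -> nat) m :
  (forall i, i < m -> \sum_(i.+1 <= j < m) g j * w j < w i) ->
  \sum_(0 <= i < m) f i * w i <= \sum_(0 <= i < m) g i * w i ->
  ((mkseq f m : seqlexi nat) <= mkseq g m)%O.
Proof.
elim: m f g w => [|m IH] f g w gw; first by move=> _; apply: Order.SeqLexiOrder.Exports.lexi0s.
rewrite !big_nat_recl // mkseq_lexi_cons => le.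
have w0 := gw 0 isT; rewrite big_add1 /= in w0.
have fg : f 0 <= g 0.
  rewrite leqNgt; apply/negP => gf.
  have := leq_mul gf (leqnn (w 0)); rewrite mulSn; move: le w0.
  set x := \sum_(_ <= i < _) f _ * _; set y := \sum_(_ <= i < _) g _ * _; lia.
rewrite fg /=; apply/implyP => gf; apply: (IH _ _ (w \o S)) => [i im|].
  by have := gw i.+1 im; rewrite big_add1.
have e : f 0 = g 0 by apply/eqP; rewrite eqn_leq fg.
by move: le; rewrite e leq_add2l.
Qed.

Section KernelWeight.
Variables (V : finType) (s t k n : nat).
Local Notation T := (bigT s t).
Hypotheses (s2 : 2 <= s) (t1 : 1 <= t) (Tk : T <= k).
Implicit Types (S : {set {set V}}).

Lemma kernel_familyP S : kernel_family s t S <->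
  sunflower_free s (fun c => c <= t - 1) S /\
  forall A, A \in S -> A \subset supp (layer S t) /\ t <= #|A| <= T.
Proof.
rewrite /kernel_family; set Y := supp _; split=> -[Sf SY]; split=> //.
  move=> A /(subsetP SY); rewrite big_nat; elim/big_rec: _ => [|q U qT IH]; first by rewrite inE.
  by case/setUP => // /ksubsetsP[AY ->].
apply/subsetP => A /SY[AY At].
rewrite (bigD1_seq #|A|) ?mem_index_iota ?ltnS ?iota_uniq //=.
by apply/setUP; left; apply/ksubsetsP.
Qed.

Lemma layer_free S : sunflower_free s (fun c => c <= t - 1) S ->
  sunflower_free s (fun=> True) (layer S t).
Proof.
move=> Sf P PL sP _; apply: (Sf P _ sP).
  by apply: subset_trans PL _; apply/subsetP => A; rewrite inE => /andP[].
have c := @core_card_lt V s t P s2 sP; rewrite -ltnS subn1 prednK //; apply: c.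
by move=> A /(subsetP PL); rewrite inE => /andP[_ /eqP].
Qed.

Lemma layer_ksubsets S : layer S t \subset ksubsets [set: V] t.
Proof. by apply/subsetP => A; rewrite inE => /andP[_ /eqP At]; apply/ksubsetsP; rewrite subsetT.
  Qed.

Lemma card_supp_layer S : sunflower_free s (fun c => c <= t - 1) S -> #|supp (layer S t)| <= T.
Proof.
move=> Sf; apply: card_supp_leq; first exact: layer_ksubsets.
exact: (phi_ub s2 (layer_ksubsets S) (layer_free Sf)).
Qed.

(** Vandermonde's identity splits the points outside the support into [T - y] and [n - T] points.
    Collecting terms, the entries of the vector are the coefficients of the weight in binomials that
    do not depend on [S]. *)
Lemma sum_weight_phi_tilde S : T <= n -> kernel_family s t S ->
  \sum_(A in S) 'C(n - #|supp (layer S t)|, k - #|A|) =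
  \sum_(0 <= i < (T - t).+1) phi_tilde s t S i * 'C(n - T, k - t - i).
Proof.
move=> Tn /kernel_familyP[Sf SP]; have YT := card_supp_layer Sf.
set y := #|supp _| in YT *; have tT := leq_bigT s2 t1.
have phiE i : phi_tilde s t S i = \sum_(0 <= j < i.+1) #|layer S (t + j)| * 'C(T - y, i - j).
  rewrite /phi_tilde big_nat_recr //= subnn bin0 muln1 addnC; congr (_ + _).
pose L j := #|layer S (t + j)|.
transitivity (\sum_(0 <= j < (T - t).+1) L j * 'C(n - y, k - t - j)).
  rewrite [RHS]big_mkord.
  rewrite (partition_big (fun A : {set V} => inord (#|A| - t) : 'I_(T - t).+1) xpredT) //=.
  apply: eq_bigr => j _.
  rewrite /L -sum_nat_const; apply: eq_big => A.
    rewrite inE; case: (boolP (A \in S)) => //= AS; have [_ /andP[tA AT]] := SP _ AS.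
    by rewrite -val_eqE /= inordK; lia.
  move=> /andP[AS /eqP Aj]; have [_ /andP[tA AT]] := SP _ AS.
  congr 'C(_, _); rewrite -Aj inordK; lia.
(* A set of size [t + j] forces [t + j <= y], so the terms of the identity beyond [T - t] vanish. *)
have vand j : j <= T - t -> 0 < L j ->
    'C(n - y, k - t - j) = \sum_(j <= i < (T - t).+1) 'C(T - y, i - j) * 'C(n - T, k - t - i).
  move=> jT /card_gt0P[A]; rewrite inE => /andP[AS /eqP Aj].
  have tjy : t + j <= y by rewrite -Aj; apply: subset_leq_card; have [] := SP _ AS.
  rewrite (_ : n - y = (T - y) + (n - T)); last by lia.
  rewrite -Vandermonde -(big_mkord xpredT (fun i => 'C(T - y, i) * 'C(n - T, k - t - j - i))).
  rewrite [RHS](big_addn 0 (T - t).+1 j).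
  rewrite (@big_cat_nat _ _ _ ((T - t).+1 - j)) //=; last by lia.
  rewrite [X in _ + X]big_nat [X in _ + X]big1 ?addn0 => [|i /andP[iT _]]; last first.
    by rewrite (@bin_small (T - y) i) //; lia.
  by apply: eq_bigr => i _; rewrite addnK addnC subnDA.
rewrite (eq_big_nat _ _ (F2 := fun j => \sum_(j <= i < (T - t).+1) L j * ('C(T - y, i - j) * 'C(n
  - T, k - t - i)))); last first.
  move=> j /andP[_ jT]; case: (posnP (L j)) => [->|Lj].
    by rewrite mul0n big1 // => i _; rewrite mul0n.
  by rewrite vand // -big_distrr.
transitivity (\sum_(0 <= j < (T - t).+1) \sum_(0 <= i < (T - t).+1 | j <= i)
    L j * ('C(T - y, i - j) * 'C(n - T, k - t - i))).
  by apply: eq_bigr => j _; rewrite (big_nat_widenl j 0).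
rewrite (exchange_big_dep_nat xpredT) //=; apply: eq_big_nat => i /andP[_ im].
rewrite phiE big_distrl /= (big_nat_widen 0 i.+1 (T - t).+1) //=.
by apply: eq_big => [j|j _]; rewrite ?ltnS ?mulnA.
Qed.

End KernelWeight.

Definition phi_tilde_bound T := 2 ^ T + T * (2 ^ T * T.+1 ^ T).

Lemma phi_tilde_leq (V : finType) s t (S : {set {set V}}) i :
  2 <= s -> 1 <= t -> kernel_family s t S -> i <= bigT s t ->
  phi_tilde s t S i <= phi_tilde_bound (bigT s t).
Proof.
move=> s2 t1 /kernel_familyP[Sf SP] iT; have YT := card_supp_layer s2 t1 Sf.
set T := bigT s t in iT YT *.
have L h : #|layer S h| <= 2 ^ T.
  apply: (@leq_trans #|powerset (supp (layer S t))|).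
    by apply/subset_leq_card/subsetP => A; rewrite !inE => /andP[/SP[]].
  by rewrite card_powerset leq_exp2l.
rewrite /phi_tilde /phi_tilde_bound leq_add ?L //.
apply: (@leq_trans (\sum_(0 <= j < i) 2 ^ T * T.+1 ^ T)); last first.
  by rewrite sum_nat_const_nat subn0 leq_mul2r iT orbT.
apply: leq_sum => j _; rewrite leq_mul ?L //; apply: leq_trans (bin_leq_exp _ _) _.
apply: (@leq_trans (T.+1 ^ (i - j))).
  by case: (i - j) => // d; rewrite leq_exp2r //; lia.
by rewrite leq_pexp2l //; lia.
Qed.

(** The weight at position [i] is at least [n ^ (k - t - i) / c], while all later terms together are
    at most [T * Bd * n ^ (k - t - i - 1)]. *)
Lemma phi_tilde_lexi (V : finType) s t k c n (S S' : {set {set V}}) :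
  2 <= s -> 1 <= t -> bigT s t <= k -> bigT s t <= n ->
  c * (bigT s t * phi_tilde_bound (bigT s t)) < n ->
  (forall j, j <= k -> n ^ j <= c * 'C(n - bigT s t, j)) ->
  kernel_family s t S -> kernel_family s t S' ->
  \sum_(A in S') 'C(n - #|supp (layer S' t)|, k - #|A|) <=
  \sum_(A in S) 'C(n - #|supp (layer S t)|, k - #|A|) ->
  (phi_tilde_vec s t S' <= phi_tilde_vec s t S)%O.
Proof.
move=> s2 t1 Tk Tn; set T := bigT s t in Tk Tn *; set Bd := phi_tilde_bound T => nB cP Sk Sk'.
have tT : t <= T by apply: leq_bigT.
rewrite !(@sum_weight_phi_tilde V s t k n) // -/T; apply: mkseq_lexi_weighted => i.
rewrite ltnS => iT; have wi := cP (k - t - i); rewrite -subnDA leq_subr in wi.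
have {}wi := wi isT; rewrite subnDA in wi.
have n0 : 0 < n by lia.
have w0 : 0 < 'C(n - T, k - t - i).
  rewrite lt0n; apply/negP => /eqP e; move: wi; rewrite e muln0 leqn0 expn_eq0; lia.
case: (leqP (T - t) i) => iT'; first by rewrite big_geq.
have cc : 0 < c by case: (c) wi => // ; rewrite mul0n leqn0 expn_eq0; lia.
rewrite -(ltn_pmul2l cc).
apply: leq_trans wi; have kS : k - t - i = (k - t - i.+1).+1 by lia.
rewrite kS expnS; apply: leq_ltn_trans (_ : c * (T * Bd) * n ^ (k - t - i.+1) < _); last first.
  by rewrite ltn_pmul2r // expn_gt0 n0.
rewrite -mulnA leq_mul2l; apply/orP; right.
apply: (@leq_trans (\sum_(i.+1 <= j < (T - t).+1) Bd * n ^ (k - t - i.+1))).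
  rewrite big_nat [leqRHS]big_nat; apply: leq_sum => j /andP[ij jT].
  apply: leq_mul; first by apply: phi_tilde_leq => //; lia.
  apply: (@leq_trans (n ^ (k - t - j))).
    apply: leq_trans (bin_leq_exp _ _) _; case: (k - t - j) => // d.
    by rewrite leq_exp2r // leq_subr.
  by rewrite leq_pexp2l //; lia.
by rewrite sum_nat_const_nat -mulnA leq_mul2r; apply/orP; right; lia.
Qed.

Lemma kernel_trace_leq (V : finType) s t k (F S : {set {set V}}) :
  2 <= s -> 1 <= t -> bigT s t <= k -> extremal s k t F -> kernel_family s t S ->
  \sum_(A in S) 'C(#|V| - #|supp (layer S t)|, k - #|A|) <= #|F|.
Proof.
move=> s2 t1 Tk [_ Fmax] /kernel_familyP[Sf SP].
have E (Y : {set V}) : #|V| - #|Y| = #|~: Y| by rewrite -(cardsC Y) addKn.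
rewrite E -card_trace_family; last by move=> A /SP[AY /andP[_ AT]]; split=> //; lia.
by apply: Fmax; apply: trace_admissible => // A /SP[_ /andP[]].
Qed.

(** * The structure of extremal families for [t >= 2] *)

Lemma extremal_structure s k t : 2 <= s -> 2 <= t -> (t + bigT s t) * (t - 1) <= k ->
  exists N, forall (V : finType) (F : {set {set V}}), N <= #|V| -> extremal s k t F ->
    exists S : {set {set V}}, lex_maximal_kernel s t S /\
      F = [set A in ksubsets [set: V] k | A :&: supp (layer S t) \in S].
Proof.
move=> s2 t2 hk; have t1 := ltnW t2; have tT := leq_bigT s2 t1.
set T := bigT s t in hk tT *.
have [Tk _] := kernel_size_bounds 0 t2 tT hk.
have tlek : t <= k by lia.
have Tlek : T <= k by lia.
(* Besides exceeding [s * k], [Q] exceeds [#|Y|], so that [kern_avoid] applies with [Y] below. *)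
pose Q := (s * k + T).+1; have Qk : s * k < Q by rewrite ltnS leq_addr.
have [C [N1 H1]] := kernel_exists s2 t1 tlek hk Qk.
have [N2 H2] := no_defective C s2 t2 tlek Qk hk.
have [c [c0 [N3 cP]]] := exp_leq_bin_uniform T k.
exists (N1 + N2 + N3 + (c * (T * phi_tilde_bound T)).+1 + T + k) => V F NV Fext.
have [[Fk Ff] _] := Fext.
have NV1 : N1 <= #|V| by lia.
have [D [Dt Df Dphi DK Dmiss]] := H1 V F NV1 Fext.
have Dcard A : A \in D -> #|A| = t by move=> /(subsetP Dt) /ksubsetsP[].
pose Y := supp D; have DY A : A \in D -> A \subset Y by move=> AD; apply: bigcup_sup AD.
have YT : #|Y| <= T by apply: card_supp_leq Dt _; rewrite Dphi.
have tY : t <= #|Y|.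
  have /card_gt0P[A AD] : 0 < #|D| by rewrite Dphi phi_gt0.
  by rewrite -(Dcard _ AD) subset_leq_card ?DY.
have Yk : #|Y| + 2 * (t - 1) <= k by lia.
have Yn : #|Y| + k <= #|V| by lia.
have noD : defective t Q F Y = set0.
  apply: H2 => //; first by lia.
  apply: leq_trans Dmiss; rewrite leq_mul2l; apply/orP; right.
  apply/subset_leq_card/subsetP => B; rewrite !inE => /andP[-> lt] /=.
  apply/negP => /exists_inP[A AD AB]; move: lt; rewrite ltnNge -(Dcard _ AD) => /negP; apply.
  by apply: subset_leq_card; rewrite subsetI AB DY.
have [S [SP Sf FS]] := defect_free_trace s2 t2 tlek Qk tY Yk Yn Fext noD.
(* Each [B] in [D] extends to a member of [F] that meets [Y] only in [B], so [B] is in [S]; the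
   layer cannot be larger as [D] has the maximal size [phi s t]. *)
have DS : layer S t = D.
  apply/esym/eqP; rewrite eqEcard; apply/andP; split; last first.
    by rewrite Dphi (phi_ub s2 (layer_ksubsets _ _) (layer_free s2 t1 Sf)).
  apply/subsetP => B BD; rewrite inE Dcard // eqxx andbT.
  have [|A [AF BA AYB]] := @kern_avoid _ _ _ _ Y (subsetP DK _ BD).
    by rewrite ltnS; apply: leq_trans YT (leq_addl _ _).
  suff -> : B = A :&: Y by move: AF; rewrite {1}FS => /trace_familyP[].
  by apply/eqP; rewrite eqEsubset subsetI BA DY // AYB.
have Sk : kernel_family s t S.
  apply/kernel_familyP; split=> // A /SP[AY tA].
  by rewrite DS tA; split=> //; apply: leq_trans YT; apply: subset_leq_card.
exists S; split; last by rewrite DS {1}FS.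
split=> // S' Sk'; apply: (@phi_tilde_lexi V s t k c #|V|) => //; rewrite -?/T; try lia.
  by move=> j jk; apply: cP => //; lia.
apply: leq_trans (kernel_trace_leq s2 t1 Tlek Fext Sk') _.
rewrite DS {1}FS -/Y card_trace_family.
  rewrite (_ : #|V| - #|Y| = #|~: Y|) //; by rewrite -(cardsC Y) addKn.
by move=> A /SP[AY _]; split=> //; have := subset_leq_card AY; lia.
Qed.

(** * The case t = 1 *)

Lemma set1_meet (V : finType) (A B : {set V}) : #|A| = 1 -> ~~ (A \subset B) -> A :&: B = set0.
Proof.
by move=> /eqP/cards1P[x ->]; rewrite sub1set -disjoints1 -setI_eq0 => /eqP.
Qed.

Lemma phi_one s : 2 <= s -> phi s 1 = s - 1.
Proof.
move=> s2; apply/eqP; rewrite eqn_leq leq_phi // andbT.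
have [[V [F [Ft Ff <-]]] _] := phiP 1 s2.
have [//|sF] := leqP #|F| (s - 1).
have [|P PF Ps] := @ksubset_exists _ F s; first by lia.
have P1 A : A \in P -> #|A| = 1 by move=> /(subsetP PF) /(subsetP Ft) /ksubsetsP[].
have [|sP _] := @sunflower_intro V s s2 P set0 Ps; last by case: (Ff P PF sP).
move=> A B AP BP AB; apply: set1_meet; first exact: P1.
by apply: contraNN AB => AB; rewrite eqEcard AB !P1.
Qed.

Lemma card_layer_supp (V : finType) (S : {set {set V}}) t h :
  (forall A, A \in S -> A \subset supp (layer S t)) ->
  #|layer S h| <= 'C(#|supp (layer S t)|, h).
Proof.
move=> SY; rewrite -card_ksubsets; apply/subset_leq_card/subsetP => A.
by rewrite inE => /andP[/SY AY /eqP Ah]; apply/ksubsetsP.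
Qed.

Lemma phi_tilde_full_supp (V : finType) s t (S : {set {set V}}) i :
  bigT s t <= #|supp (layer S t)| -> phi_tilde s t S i = #|layer S (t + i)|.
Proof.
move=> le; have e : bigT s t - #|supp (layer S t)| = 0 by apply/eqP; rewrite subn_eq0.
rewrite /phi_tilde e big_nat big1 ?addn0 // => j /andP[_ ji].
by rewrite bin_small ?muln0 // subn_gt0.
Qed.

(** For [t = 1], [D] consists of [s - 1] singletons with union [Y]. A member missing [Y] would form
    with them [s] disjoint sets of [K], a sunflower with core of size 0. So [F] consists of all
    [k]-sets meeting [Y], and [S] of all non-empty subsets of [Y]. *)
Lemma star_structure s k : 2 <= s -> 1 <= k ->
  exists N, forall (V : finType) (F : {set {set V}}), N <= #|V| -> extremal s k 1 F ->
    exists S : {set {set V}}, lex_maximal_kernel s 1 S /\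
      F = [set A in ksubsets [set: V] k | A :&: supp (layer S 1) \in S].
Proof.
move=> s2 k1; have t1 : 1 <= 1 by [].
have TE : bigT s 1 = s - 1 by rewrite /bigT phi_one // mul1n.
pose Q := (s * k).+1; have Qk : s * k < Q by [].
have hk : (1 + bigT s 1) * (1 - 1) <= k by rewrite muln0.
have [C [N1 H1]] := kernel_exists s2 t1 k1 hk Qk.
exists N1 => V F NV Fext; have [[Fk Ff] Fmax] := Fext.
have [D [Dt Df]] := H1 V F NV Fext; rewrite phi_one // => Ds DK _.
have D1 A : A \in D -> #|A| = 1 by move=> /(subsetP Dt) /ksubsetsP[].
pose Y := supp D; have DY A : A \in D -> A \subset Y by move=> AD; apply: bigcup_sup AD.
have Ys : #|Y| = s - 1.
  apply/eqP; rewrite eqn_leq; apply/andP; split.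
    by rewrite -TE; apply: card_supp_leq Dt _; rewrite phi_one // Ds.
  rewrite -Ds -(bin1 #|Y|) -card_ksubsets.
  by apply/subset_leq_card/subsetP => A AD; apply/ksubsetsP; rewrite DY ?D1.
have FY B : B \in F -> B :&: Y != set0.
  move=> BF; apply/eqP => BY; have Bk := family_card Fk BF.
  have BD : B \notin D.
    by apply/negP => BD; move: BY; rewrite (setIidPl (DY _ BD)) => B0; rewrite B0 cards0 in Bk;
      lia.
  have [||sP cP] := @sunflower_intro V s s2 (B |: D) set0.
  - by rewrite cardsU1 BD Ds; lia.
  - have BA A : A \in D -> B :&: A = set0.
      move=> AD; apply/eqP; rewrite -subset0 -BY subsetI subsetIl.
      by apply: subset_trans (subsetIr _ _) (DY _ AD).
    move=> A A' /setU1P[->|AD] /setU1P[->|AD'] ne.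
    + by rewrite eqxx in ne.
    + exact: BA.
    + by rewrite setIC BA.
    + apply: set1_meet; first exact: D1.
      by apply: contraNN ne => AA'; rewrite eqEcard AA' !D1.
  have := @kern_free V s k 1 Q F s2 _ Qk Fk Ff (B |: D) _ sP; rewrite cP cards0; apply=> //.
  by rewrite subUset DK andbT sub1set (subsetP (sub_kern _ _)).
pose S := [set A in powerset Y | A != set0].
have SP A : A \in S -> A \subset Y /\ 1 <= #|A| by rewrite !inE card_gt0 => /andP[].
have Sf : sunflower_free s (fun c => c <= 1 - 1) S.
  move=> P PS [Ps Pc]; rewrite leqn0 cards_eq0 => /eqP c0.
  have tP : trivIset P.
    by apply/trivIsetP => A B AP BP AB; rewrite -setI_eq0 Pc // c0.
  (* Disjoint non-empty sets, [s] in number, do not fit into [s - 1] points. *)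
  have : #|cover P| <= #|Y|.
    by apply/subset_leq_card/bigcupsP => A /(subsetP PS) /SP[].
  rewrite -(eqP tP) Ys => le; have : s <= \sum_(A in P) #|A|.
    by rewrite -[in leqLHS]Ps -sum1_card; apply: leq_sum => A /(subsetP PS) /SP[].
  lia.
have LS h : 0 < h -> layer S h = ksubsets Y h.
  move=> h0; apply/setP => A; apply/idP/ksubsetsP.
    by rewrite inE => /andP[/SP[AY _] /eqP].
  by move=> [AY Ah]; rewrite !inE AY Ah eqxx andbT -card_gt0 Ah.
have suppS : supp (layer S 1) = Y.
  rewrite LS //; apply/setP => x; apply/bigcupP/idP => [[A /ksubsetsP[AY _] xA]|xY].
    exact: (subsetP AY).
  by exists [set x]; rewrite ?inE // sub1set xY cards1.
have Sk : kernel_family s 1 S.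
  apply/kernel_familyP; split=> // A /SP[AY A1]; rewrite suppS AY A1 TE -Ys.
  by split=> //; apply: subset_leq_card.
exists S; split; last first.
  rewrite suppS; apply/eqP; rewrite eqEcard; apply/andP; split.
    apply/subsetP => B BF; apply/trace_familyP; rewrite (family_card Fk BF); split=> //.
    by rewrite !inE subsetIr FY.
  by apply: Fmax; apply: (@trace_admissible V s s2 k 1 Y S) => // A /SP[].
split=> // S' /kernel_familyP[Sf' SP'].
have YT' := card_supp_layer s2 t1 Sf'.
have tE i : phi_tilde s 1 S i = 'C(s - 1, 1 + i).
  by rewrite phi_tilde_full_supp ?suppS ?Ys ?TE // LS // card_ksubsets Ys.
have L1 := card_layer_supp 1 (fun A AS => (SP' A AS).1); rewrite bin1 in L1.
(* Either the first entry is already smaller, or the support has [bigT s 1] points; then the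
   binomials in the vector vanish, and its entries count subsets of a set of [s - 1] points. *)
rewrite /phi_tilde_vec; have [lt|ge] := ltnP #|layer S' 1| (s - 1).
  rewrite mkseq_lexi_cons; have lt0 : phi_tilde s 1 S' 0 < phi_tilde s 1 S 0.
    by rewrite tE bin1 {1}/phi_tilde big_geq // addn0.
  by rewrite ltnW //= leqNgt lt0.
have Y' : #|supp (layer S' 1)| = s - 1.
  by apply/eqP; rewrite eqn_leq -{1}TE YT' (leq_trans ge L1).
apply: mkseq_lexi_pointwise => i _; rewrite tE phi_tilde_full_supp ?Y' ?TE //.
by rewrite -Y'; apply: card_layer_supp => A /SP'[].
Qed.

(** * One threshold for all [t] *)

Theorem theorem2p1 (s k : nat) (hs : 2 <= s) (hk : 1 <= k) :
  exists n0 : nat, forall t : nat, 1 <= t ->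
    (t + bigT s t) * (t - 1) <= k ->
    forall n : nat, n0 <= n ->
    forall F : {set {set 'I_n}}, extremal s k t F ->
    exists S : {set {set 'I_n}},
      lex_maximal_kernel s t S /\
      F = [set A in ksubsets [set: 'I_n] k | A :&: supp (layer S t) \in S].
Proof.
(* For [t >= 2] the bound on [k] gives [t <= k], so finitely many [t] occur and their thresholds can
   be added up. *)
suff H m : exists n0, forall t, t < m -> 1 <= t -> (t + bigT s t) * (t - 1) <= k ->
    forall n : nat, n0 <= n -> forall F : {set {set 'I_n}}, extremal s k t F ->
    exists S : {set {set 'I_n}}, lex_maximal_kernel s t S /\
      F = [set A in ksubsets [set: 'I_n] k | A :&: supp (layer S t) \in S].
  have [n0 H0] := H k.+2; exists n0 => t t1 tk; apply: H0 => //.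
  have [|t2] := leqP t 1; first by lia.
  by rewrite ltnS leqW //; apply: leq_trans tk; rewrite -[leqLHS]muln1 leq_mul ?leq_addr //; lia.
elim: m => [|m [N1 IH]]; first by exists 0.
have [m0|m0] := posnP m; first by exists 0 => t; rewrite m0 ltnS leqn0 => /eqP ->.
have [mk|mk] := leqP ((m + bigT s m) * (m - 1)) k; last first.
  exists N1 => t; rewrite ltnS leq_eqVlt => /orP[/eqP -> _|tm]; last exact: IH.
  by rewrite leqNgt mk.
have [N2 H2] : exists N, forall (V : finType) (F : {set {set V}}), N <= #|V| -> extremal s k m F
  ->
    exists S : {set {set V}}, lex_maximal_kernel s m S /\
      F = [set A in ksubsets [set: V] k | A :&: supp (layer S m) \in S].
  have [m1|m1] := leqP m 1; last exact: extremal_structure.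
  have -> : m = 1 by lia.
  exact: star_structure.
exists (N1 + N2) => t; rewrite ltnS leq_eqVlt => /orP[/eqP -> _ _|tm t1 tk] n nN F Fext.
  by apply: H2 => //; rewrite card_ord; lia.
by apply: (IH t) => //; lia.
Qed.
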